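(* Let $\Omega\subset\mathbb{R}^d$ ($d\in\{2,3\}$), the coefficient $\mathbf{A}$, the source $f$, the meshes $\mathcal{T}_h,\mathcal{T}_H$ and the localized multiscale space $V^{\mathrm{ms},k}_{H,h}$ be as described in the context. Then for all integers $k\ge1$ and all $h$ and $H$, the localized multiscale problem: find $\mathbf{u}^{\mathrm{ms},k}_{H,h}\in V^{\mathrm{ms},k}_{H,h}$ and $p_H\in Q_H$ such that $$a(\mathbf{u}^{\mathrm{ms},k}_{H,h},\mathbf{v}_h)+b(\mathbf{v}_h,p_H)=0,\qquad b(\mathbf{u}^{\mathrm{ms},k}_{H,h},q_H)=-(f,q_H)\qquad\text{for all }\mathbf{v}_h\in V^{\mathrm{ms},k}_{H,h},\ q_H\in Q_H,$$ has a unique solution.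
   Context: **Domain and data.** $d\in\{2,3\}$; $\Omega\subset\mathbb{R}^d$ is a bounded Lipschitz domain with polygonal (or polyhedral) boundary and outer normal $\mathbf{n}$. $\mathbf{A}\in[L^\infty(\Omega)]^{d\times d}$ is a.e. symmetric and there are real numbers $0<\alpha\le\beta<\infty$ with $\alpha\le \frac{(\mathbf{A}(x)^{-1}\mathbf{v})\cdot\mathbf{v}}{\mathbf{v}\cdot\mathbf{v}}\le\beta$ for a.e. $x\in\Omega$ and all $\mathbf{v}\in\mathbb{R}^d\setminus\{0\}$. The source satisfies $f\in L^2(\Omega)$, $\int_\Omega f=0$. **Forms.** $(\cdot,\cdot)_\omega$ is the $L^2(\omega)$ scalar product (scalar or vector valued), $(\cdot,\cdot)=(\cdot,\cdot)_\Omega$. $V=H_0(\mathrm{div},\Omega)=\{\mathbf{v}\in[L^2(\Omega)]^d:\nabla\cdot\mathbf{v}\in L^2(\Omega),\ \mathbf{v}\cdot\mathbf{n}|_{\partial\Omega}=0\}$, $Q=\{q\in L^2(\Omega):\int_\Omega q=0\}$, $a(\mathbf{u},\mathbf{v})=(\mathbf{A}^{-1}\mathbf{u},\mathbf{v})$, $b(\mathbf{v},q)=(\nabla\cdot\mathbf{v},q)$. **Meshes.** $\{\mathcal{T}_h\}$ (fine) and $\{\mathcal{T}_H\}$ (coarse) are families of conforming simplicial meshes of $\Omega$ (elements are closed sets); $h$ and $H$ are the maximum element diameters. Each $\mathcal{T}_h$ is obtained from $\mathcal{T}_H$ by one or more conforming (possibly non-uniform) refinements such that $\mathcal{T}_h\cap\mathcal{T}_H=\emptyset$.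 Both families are shape regular, and the coarse family is quasi-uniform (the fine meshes may be adaptively refined). **Spaces.** $V_h\subset V$ and $V_H\subset V$ are the lowest-order Raviart–Thomas spaces: functions in $V$ whose restriction to each element of $\mathcal{T}_h$ (resp. $\mathcal{T}_H$) lies in $[\mathbb{P}^0]^d+x\,\mathbb{P}^0$. $Q_H\subset Q$ is the space of mean-zero piecewise constants on $\mathcal{T}_H$. $\Pi_H$ is the nodal Raviart–Thomas interpolation onto $V_H$, determined by preserving the average normal flux $\frac1{|E|}\int_E\mathbf{v}\cdot\mathbf{n}_E$ over each coarse edge/face $E$. For a union $U$ of coarse elements, $K_h^{\mathrm f}(U)=\{\mathbf{w}\in V_h:\Pi_H\mathbf{w}=0,\ \nabla\cdot\mathbf{w}=0,\ \mathbf{w}=0\text{ in }\Omega\setminus U\}$. **Patches.** For $T\in\mathcal{T}_H$: $U_0(T)=T$, $U_k(T)=\bigcup\{T'\in\mathcal{T}_H:T'\cap U_{k-1}(T)\ne\emptyset\}$, $k\ge1$. **Localized correctors and space.** For $T\in\mathcal{T}_H$, $k\ge1$, $G^T_{h,k}:V\to K_h^{\mathrm f}(U_k(T))$ is defined by $a(G^T_{h,k}\mathbf{v},\mathbf{w})=(\mathbf{A}^{-1}\mathbf{v},\mathbf{w})_T$ for all $\mathbf{w}\in K_h^{\mathrm f}(U_k(T))$. $G_{h,k}=\sum_{T\in\mathcal{T}_H}G^T_{h,k}$ and $V^{\mathrm{ms},k}_{H,h}=(\mathrm{Id}-G_{h,k})(V_H)$. *)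

(* Defs.v *)
(* Points and vectors of R^d are row vectors
   ['rV[R]_n.+1], i.e. d = n.+1; faces are parametrised over ['rV[R]_n]. *)
From HB Require Import structures.
From mathcomp Require Import all_boot all_order all_algebra.
From mathcomp Require Import all_classical all_reals all_analysis.
Set Implicit Arguments.
Unset Strict Implicit.
Unset Printing Implicit Defensive.
Import Order.TTheory GRing.Theory Num.Theory.
Import numFieldNormedType.Exports.
Local Open Scope classical_set_scope.
Local Open Scope ring_scope.

Definition measure_rV_display : measure_display.
Proof. exact: default_measure_display. Qed.

Section measurable_rV.
Context {R : realType} (n : nat).

Let coors : 'I_n -> 'rV[R]_n -> measurableTypeR R := fun i x => x ord0 i.

Let rV_set0 : g_sigma_preimage coors set0.
Proof. exact: sigma_algebra0. Qed.

Let rV_setC A : g_sigma_preimage coors A -> g_sigma_preimage coors (~` A).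
Proof. exact: sigma_algebraC. Qed.

Let rV_bigcup (F : (set 'rV[R]_n)^nat) :
  (forall i, g_sigma_preimage coors (F i)) ->
  g_sigma_preimage coors (\bigcup_i (F i)).
Proof. exact: sigma_algebra_bigcup. Qed.

HB.instance Definition _ := @isMeasurable.Build measure_rV_display
  'rV[R]_n (g_sigma_preimage coors) rV_set0 rV_setC rV_bigcup.

End measurable_rV.

Definition cons_rV {R : realType} (n : nat)
    (y : 'rV[R]_n * measurableTypeR R) : 'rV[R]_n.+1 :=
  row_mx (y.2)%:M y.1.

Section lebesgue_rV.
Context {R : realType}.

Lemma measurable_coord n (i : 'I_n) :
  measurable_fun setT ((fun x => x ord0 i) : 'rV[R]_n -> measurableTypeR R).
Proof.
move=> _ B mB; apply: sub_sigma_algebra.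
case: n i => [[] []//|n] i.
rewrite -bigcup_mkord_ord; exists i; first exact: ltn_ord.
by exists B => //; rewrite inord_val.
Qed.

Lemma measurable_rVP d (T : measurableType d) n (f : T -> 'rV[R]_n) :
  (forall i, measurable_fun setT
     ((fun x => f x ord0 i) : T -> measurableTypeR R)) ->
  measurable_fun setT f.
Proof.
move=> mf _ A mA; rewrite setTI; move: A mA.
suff : g_sigma_preimage
    (fun i => (fun x : 'rV[R]_n => x ord0 i) \o f : T -> measurableTypeR R)
    `<=` measurable.
  by rewrite g_sigma_preimage_comp => h A mA; apply: h; exists A; rewrite ?setTI.
apply: smallest_sub; first exact: sigma_algebra_measurable.
case: n f mf => [|n] f mf; first by rewrite big_ord0.
by rewrite -bigcup_mkord_ord; apply: bigcup_sub => i _ A [B mB <-]; exact: mf.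
Qed.

Lemma measurable_cons_rV n : measurable_fun setT (@cons_rV R n).
Proof.
apply: measurable_rVP => i.
have [j ->|j ->] := split_ordP (i : 'I_(1 + n)).
  rewrite (_ : (fun x => _) = snd); first exact: measurable_snd.
  by apply/funext => x; rewrite [LHS](@row_mxEl _ 1 1 n) mxE (ord1 j) eqxx.
rewrite (_ : (fun x => _) = (fun x : 'rV[R]_n => x ord0 j) \o fst).
  by apply: measurableT_comp => //; exact: measurable_coord.
by apply/funext => x; rewrite [LHS](@row_mxEr _ 1 1 n).
Qed.

Definition lebesgue_rVS n (mu : {measure set 'rV[R]_n -> \bar R}) :
  {measure set 'rV[R]_n.+1 -> \bar R}.
Proof.
refine (pushforward (mu \x lebesgue_measure)%E (@cons_rV R n)).
exact: measurable_cons_rV.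
Defined.

Fixpoint lebesgue_rV (n : nat) : {measure set 'rV[R]_n -> \bar R} :=
  if n is m.+1 return {measure set 'rV[R]_n -> \bar R}
  then lebesgue_rVS (lebesgue_rV m)
  else \d_(0 : 'rV[R]_0).

Lemma lebesgue_rV_box n (a b : 'I_n -> R) : (forall i, a i <= b i) ->
  lebesgue_rV n [set x : 'rV[R]_n | forall i, x ord0 i \in `]a i, b i]] =
  (\prod_(i < n) (b i - a i))%:E.
Proof.
elim: n a b => [|n IH] a b ab.
  rewrite big_ord0 /= diracE mem_set//= => -[] //.
rewrite /= /pushforward.
rewrite (_ : _ @^-1` _ = [set x : 'rV[R]_n | forall i, x ord0 i \in `]a (lift ord0 i), b (lift ord0 i)]] `*` `]a ord0, b ord0]); last first.
  apply/seteqP; split => -[x t] /=.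
    move=> h; split.
      move=> i; have := h (lift ord0 i); rewrite /cons_rV/=.
      by rewrite -rshift1 (@row_mxEr _ 1 1 n).
    have := h ord0; rewrite /cons_rV /=.
    rewrite (_ : ord0 = lshift n (ord0 : 'I_1)); last exact/val_inj.
    by rewrite (@row_mxEl _ 1 1 n) mxE eqxx.
  move=> [h1 h2] i; rewrite /cons_rV /=.
  have [j ->|j ->] := split_ordP (i : 'I_(1 + n)).
    rewrite (@row_mxEl _ 1 1 n) mxE (ord1 j) eqxx /=.
    by rewrite (_ : lshift n 0 = ord0)//; exact/val_inj.
  by rewrite (@row_mxEr _ 1 1 n) rshift1.
rewrite product_measure1E//=.
  rewrite IH //.
  rewrite lebesgue_measure_itv/= lte_fin big_ord_recl.
  have := ab ord0; rewrite le_eqVlt => /orP[/eqP ->|->].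
    by rewrite ltxx subrr mul0r mule0.
  by rewrite -EFinD -EFinM mulrC.
rewrite (_ : mkset _ = \big[setI/setT]_(i < n) ((fun x : 'rV[R]_n => x ord0 i) @^-1` `]a (lift ord0 i), b (lift ord0 i)])).
  apply: bigsetI_measurable => i _; rewrite -[X in measurable X]setTI.
  exact: (measurable_coord i).
rewrite -bigcap_seq; apply/seteqP; split => x /= h i //=.
by have := h i (mem_index_enum i).
Qed.

End lebesgue_rV.

Section euclidean.
Context {R : realType} {m : nat}.
Implicit Types u v : 'rV[R]_m.

Definition dot u v : R := \sum_i u ord0 i * v ord0 i.
Definition enorm u : R := Num.sqrt (dot u u).
Definition diam (S : set 'rV[R]_m) : R :=
  sup [set enorm (x - y) | x in S & y in S].

Definition grad (phi : 'rV[R]_m -> R) (x : 'rV[R]_m) : 'rV[R]_m :=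
  \row_i 'D_(delta_mx ord0 i) phi x.

Definition C1 (phi : 'rV[R]_m -> R) : Prop :=
  (forall x, differentiable phi x) /\
  (forall i, continuous (fun x => grad phi x ord0 i)).

End euclidean.

Section forms.
Context {R : realType} {n : nat}.
Local Notation vec := 'rV[R]_n.+1.
Local Notation leb := (lebesgue_rV n.+1 : {measure set vec -> \bar R}).
Implicit Types (Omega D : set vec) (v w : vec -> vec) (q g f : vec -> R).

(* Elements of Lebesgue spaces are represented by Borel functions on the whole
   of R^d, of which only the values almost everywhere in Omega matter. *)
Definition L2 D f : Prop :=
  measurable_fun D f /\ leb.-integrable D (fun x => (f x ^+ 2)%:E).

Definition L2vec D v : Prop := forall i, L2 D (fun x => v x ord0 i).

Definition is_div Omega v g : Prop :=
  forall phi : vec -> R, C1 phi ->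
  (exists K : set vec,
     [/\ compact K, K `<=` Omega & forall x, ~ K x -> phi x = 0]) ->
  \int[leb]_(x in Omega) dot (v x) (grad phi x) =
  - \int[leb]_(x in Omega) (g x * phi x).

Definition Hdiv Omega v : Prop :=
  L2vec Omega v /\ exists g, L2 Omega g /\ is_div Omega v g.

(* For [v] in H(div), [div Omega v] is a representative of the (a.e. unique)
   weak divergence. *)
Definition div Omega v : vec -> R :=
  get [set g | L2 Omega g /\ is_div Omega v g].

(* The normal trace of [v] in H(div) is the functional on the traces of
   functions of C^1(closure Omega) given by Green's formula
   <v.n, phi> = (v, grad phi) + (div v, phi). *)
Definition normal_trace Omega v (phi : vec -> R) : R :=
  \int[leb]_(x in Omega) dot (v x) (grad phi x) +
  \int[leb]_(x in Omega) (div Omega v x * phi x).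

Definition H0div Omega v : Prop :=
  Hdiv Omega v /\ forall phi, C1 phi -> normal_trace Omega v phi = 0.

Definition L2_mean_zero Omega q : Prop :=
  L2 Omega q /\ \int[leb]_(x in Omega) q x = 0.

(* [Ainv A x u] is the column vector A(x)^-1 u, written as a row. *)
Definition Ainv (A : vec -> 'M[R]_n.+1) (x u : vec) : vec :=
  u *m (invmx (A x))^T.

(* (A^-1 u, v)_D *)
Definition Ainv_form (A : vec -> 'M[R]_n.+1) D v w : R :=
  \int[leb]_(x in D) dot (Ainv A x (v x)) (w x).

Definition form_b Omega v q : R := \int[leb]_(x in Omega) (div Omega v x * q x).

Definition Linfty D f : Prop :=
  measurable_fun D f /\
  exists C : R, \forall x \ae leb, D x -> `|f x| <= C.

Definition elliptic_coefficient Omega (A : vec -> 'M[R]_n.+1)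
    (alpha beta : R) : Prop :=
  [/\ forall i j, Linfty Omega (fun x => A x i j),
      \forall x \ae leb, Omega x -> (A x)^T = A x,
      0 < alpha <= beta &
      \forall x \ae leb, Omega x -> A x \in unitmx /\
        forall u : vec, u != 0 ->
          alpha <= dot (Ainv A x u) u / dot u u <= beta].

(* Near each boundary point, in the orthogonal frame with last axis [e], the
   domain is the strict epigraph of a Lipschitz function [gamma] of the
   component orthogonal to [e]. *)
Definition lipschitz_boundary Omega : Prop :=
  forall x, closure Omega x -> ~ Omega x ->
  exists (e : vec) (gamma : vec -> R),
    [/\ enorm e = 1, lipschitz (gamma : vec -> R^o) &
     \forall y \near x,
       Omega y <-> gamma (y - dot y e *: e) < dot y e].

Definition polytopal_boundary Omega : Prop :=
  exists s : seq (vec * R),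
    (forall ab, ab \in s -> ab.1 != 0) /\
    (forall x, closure Omega x -> ~ Omega x ->
       exists2 ab, ab \in s & dot ab.1 x = ab.2).

Definition polytopal_lipschitz_domain Omega : Prop :=
  [/\ open Omega, connected Omega & Omega !=set0] /\
  [/\ bounded_set Omega, lipschitz_boundary Omega & polytopal_boundary Omega].

End forms.

Section meshes.
Context {R : realType} {n : nat}.
Local Notation vec := 'rV[R]_n.+1.
Local Notation leb := (lebesgue_rV n.+1 : {measure set vec -> \bar R}).
Implicit Types (Omega : set vec) (p : 'I_n.+2 -> vec).

Definition subsimplex p (S : {set 'I_n.+2}) : set vec :=
  [set x | exists l : 'I_n.+2 -> R,
     [/\ forall i, 0 <= l i, forall i, i \notin S -> l i = 0,
         \sum_i l i = 1 & x = \sum_i l i *: p i]].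

Definition affinely_independent p : bool :=
  row_free (\matrix_(i < n.+1) (p (lift ord0 i) - p ord0)).

Record mesh := Mesh {
  elt :> finType;
  vertex : elt -> 'I_n.+2 -> vec }.
Implicit Types M TH Th : mesh.

Definition cell M (T : M) : set vec := subsimplex (vertex T) [set: 'I_n.+2].

Definition conforming_mesh Omega M : Prop :=
  [/\ forall T : M, affinely_independent (vertex T),
      closure Omega = \bigcup_(T in [set: M]) cell T &
      forall T T' : M, T != T' -> exists S S' : {set 'I_n.+2},
        [/\ S \proper [set: 'I_n.+2], S' \proper [set: 'I_n.+2],
            cell T `&` cell T' = subsimplex (vertex T) S &
            cell T `&` cell T' = subsimplex (vertex T') S']].

(* Successive refinements compose, so this covers one or several of them. *)
Definition refinement TH Th : Prop :=
  forall t : Th, exists T : TH, cell t `<=` cell T.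

Definition no_common_element TH Th : Prop :=
  forall (T : TH) (t : Th), cell T <> cell t.

Definition mesh_size M : R := \big[Num.max/0]_(T : M) diam (cell T).

Definition shape_regular (I : Type) (F : I -> mesh) : Prop :=
  exists2 rho : R, 0 < rho &
    forall i (T : F i), exists x,
      [set y | enorm (y - x) <= rho * diam (cell T)] `<=` cell T.

Definition quasi_uniform (I : Type) (F : I -> mesh) : Prop :=
  exists2 C : R, 0 < C &
    forall i (T : F i), mesh_size (F i) <= C * diam (cell T).

(* The face of [T] opposite to its [i]-th vertex. *)
Definition face M (T : M) (i : 'I_n.+2) : 'I_n.+1 -> vec :=
  fun j => vertex T (lift i j).

Definition face_edges (F : 'I_n.+1 -> vec) : 'M[R]_(n, n.+1) :=
  \matrix_(j < n) (F (lift ord0 j) - F ord0).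

(* Surface integral over the convex hull of the points [F], computed in the
   affine parametrisation of the face by the unit simplex of R^n; the square
   root is the area factor (Gram determinant of the edges). *)
Definition face_integral (F : 'I_n.+1 -> vec) (g : vec -> R) : R :=
  Num.sqrt (\det (face_edges F *m (face_edges F)^T)) *
  \int[lebesgue_rV n]_(s in [set s : 'rV[R]_n |
      (forall j, 0 <= s ord0 j) /\ \sum_j s ord0 j <= 1])
    g (F ord0 + s *m face_edges F).

Definition face_average (F : 'I_n.+1 -> vec) (g : vec -> R) : R :=
  face_integral F g / face_integral F (fun=> 1).

Definition unit_normal (F : 'I_n.+1 -> vec) (nu : vec) : Prop :=
  enorm nu = 1 /\ forall j, dot (F j - F ord0) nu = 0.

(* [c] gives the polynomials a + b x of the restrictions of [v] to the
   elements. *)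
Definition RT_pieces M (v : vec -> vec) (c : M -> vec * R) : Prop :=
  forall T : M, \forall x \ae leb, cell T x -> v x = (c T).1 + (c T).2 *: x.

Definition RT_space Omega M (v : vec -> vec) : Prop :=
  H0div Omega v /\ exists c : M -> vec * R, RT_pieces v c.

Definition P0_mean_zero Omega M (q : vec -> R) : Prop :=
  L2_mean_zero Omega q /\
  forall T : M, exists c : R, \forall x \ae leb, cell T x -> q x = c.

(* Trace, from within [D], of the piecewise polynomial function with pieces
   [c]; where several elements of [M] inside [D] meet (for the points of a face
   of [D]: in a null set of the face), one of them is picked. *)
Definition trace M (c : M -> vec * R) (D : set vec) (x : vec) : vec :=
  if [pick t : M | `[< cell t `<=` D /\ cell t x >]] is Some t
  then (c t).1 + (c t).2 *: x else 0.

Definition average_normal_flux TH M (c : M -> vec * R) (T : TH)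
    (i : 'I_n.+2) (nu : vec) : R :=
  face_average (face T i) (fun x => dot (trace c (cell T) x) nu).

(* [z] is the nodal interpolant in the coarse space of [w] in the fine one. *)
Definition RT_interpolant Omega TH Th (w z : vec -> vec) : Prop :=
  RT_space Omega TH z /\
  exists (cw : Th -> vec * R) (cz : TH -> vec * R),
    [/\ RT_pieces w cw, RT_pieces z cz &
     forall (T : TH) i nu, unit_normal (face T i) nu ->
       average_normal_flux cz T i nu = average_normal_flux cw T i nu].

Definition fine_kernel Omega TH Th (U : set vec) (w : vec -> vec) : Prop :=
  [/\ RT_space Omega Th w, RT_interpolant Omega TH Th w (fun=> 0),
      is_div Omega w (fun=> 0) & w = (fun=> 0) %[ae leb in Omega `\` U]].

Fixpoint patch TH (T : TH) (k : nat) : set vec :=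
  if k is k'.+1
  then \bigcup_(T' in [set T' : TH | cell T' `&` patch T k' !=set0]) cell T'
  else cell T.

(* The element [cell T] is intersected with [Omega] because the coefficient and
   the fields are only specified there; the rest of [cell T] is a null set. *)
Definition localized_corrector Omega (A : vec -> 'M[R]_n.+1) TH Th (k : nat)
    (T : TH) (v g : vec -> vec) : Prop :=
  fine_kernel Omega TH Th (patch T k) g /\
  forall w, fine_kernel Omega TH Th (patch T k) w ->
    Ainv_form A Omega g w = Ainv_form A (cell T `&` Omega) v w.

Definition multiscale_space Omega (A : vec -> 'M[R]_n.+1) TH Th (k : nat)
    (u : vec -> vec) : Prop :=
  exists (v : vec -> vec) (g : TH -> vec -> vec),
    [/\ RT_space Omega TH v,
        forall T : TH, localized_corrector Omega A Th k T v (g T) &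
        u = fun x => v x - \sum_(T : TH) g T x].

Definition multiscale_solution Omega (A : vec -> 'M[R]_n.+1) (f : vec -> R)
    TH Th (k : nat) (u : vec -> vec) (p : vec -> R) : Prop :=
  [/\ multiscale_space Omega A TH Th k u, P0_mean_zero Omega TH p,
      forall v, multiscale_space Omega A TH Th k v ->
        Ainv_form A Omega u v + form_b Omega v p = 0 &
      forall q, P0_mean_zero Omega TH q ->
        form_b Omega u q = - \int[leb]_(x in Omega) (f x * q x)].

End meshes.
Arguments mesh : clear implicits.

(* Main.v *)
Require Import Defs.
From HB Require Import structures.
From mathcomp Require Import all_boot all_order all_algebra.
From mathcomp Require Import all_classical all_reals all_analysis.
From mathcomp Require Import measurable_realfun ring lra.
Set Implicit Arguments.
Unset Strict Implicit.
Unset Printing Implicit Defensive.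
Import Order.TTheory GRing.Theory Num.Theory.
Import numFieldNormedType.Exports.
Local Open Scope classical_set_scope.
Local Open Scope ring_scope.

(* Modulo null sets, the problem is a square linear system, so it suffices that
   the homogeneous adjoint system has only the zero solution; the correctors
   exist for the same reason. Testing with (w, -q) shows a(w, w) = 0, hence
   w = 0 because a is coercive. What remains is b(u, q) = 0 on the multiscale
   space, hence on V_H since correctors are divergence free. For two coarse
   elements sharing a facet, the Raviart-Thomas function a (x - P) on the first,
   - a' (x - P') on the second, where P and P' are the vertices opposite to the
   facet, has b(v, q) equal to a positive multiple of the jump of q. Elements
   are connected through facets because Omega is connected and subsets of
   codimension 2 do not separate a ball, so q is constant, hence zero.

   Membership of this function in H_0(div) is Green's formula: the integral over
   a simplex of div ((x - P) phi) only depends on phi on the facet opposite to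
   P. The weak divergence is unique, up to what b sees, by testing with smooth
   cutoffs supported in the open elements. *)

(** * Lebesgue measure on row vectors *)

(** Elements of the spaces are functions, not classes, and [div] picks an arbitrary representative
    of the weak divergence. The trial and test spaces are therefore predicates closed under linear
    combinations, each with a finite family in it that spans it up to null sets ([finspan]).
    Linearity of b in the field has to pass through the uniqueness of weak divergences against
    piecewise constants. The generators may be dependent modulo null sets, so the linear algebra is
    a Fredholm alternative for the matrix of the form, not an inversion.

    The factors a and a' are the reciprocals of the Jacobians of the affine maps, with the apex as
    origin, from one reference simplex onto the two elements. The Jacobian comes from the uniqueness
    of Haar measure, as an unnamed positive constant. Green's formula then reduces to one identity
    on the reference simplex for functions vanishing on the face where the coordinates sum to 1,
    without any surface integral. The test function phi = 1 gives a |T| = a' |T'|, which is why b(v,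
    q) sees exactly the jump of q. *)

Section boxes.
Context {R : realType} {n : nat}.
Local Notation vec := 'rV[R]_n.
Local Notation leb := (lebesgue_rV n : {measure set vec -> \bar R}).

Definition box (a b : 'I_n -> R) : set vec :=
  [set x | forall i, x ord0 i \in `]a i, b i]].

Lemma measurable_box a b : measurable (box a b).
Proof.
rewrite (_ : box a b = \bigcap_(i in [set: 'I_n])
    ((fun x : vec => x ord0 i) @^-1` [set` `]a i, b i]])); last first.
  by apply/seteqP; split=> [x h i _|x h i]; [exact: h|exact: (h i)].
apply: fin_bigcap_measurable; first exact: finite_finset.
by move=> i _; rewrite -[X in measurable X]setTI; exact: (measurable_coord i).
Qed.

Lemma box_nbhs (x : vec) (e : R) : 0 < e ->
  exists a b : 'I_n -> rat,
    box (ratr \o a) (ratr \o b) x /\ box (ratr \o a) (ratr \o b) `<=` ball x e.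
Proof.
move=> e0.
have /choice[a ha] (i : 'I_n) :
    exists q : rat, ratr q \in `](x ord0 i - e), (x ord0 i)[.
  by apply: rat_in_itvoo; rewrite ltrBlDr ltrDl.
have /choice[b hb] (i : 'I_n) :
    exists q : rat, ratr q \in `](x ord0 i), (x ord0 i + e)[.
  by apply: rat_in_itvoo; rewrite ltrDl.
exists a, b; split=> [i|y hy].
  by have := ha i; have := hb i; rewrite !in_itv/= => /andP[/ltW -> _] /andP[_ ->].
split=> // j i; rewrite ord1 /ball/= /ball_/=.
have := hy i; have := ha i; have := hb i; rewrite !in_itv/=.
move=> /andP[h1 h2] /andP[h3 h4] /andP[h5 h6]; rewrite ltr_norml.
apply/andP; split.
  by rewrite ltrBrDr addrC ltrBlDr; exact: le_lt_trans h6 h2.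
by rewrite ltrBlDr -ltrBlDl; exact: lt_trans h3 h5.
Qed.

(** The measurable sets are generated by the coordinates, not by the topology. The two are linked by
    writing an open set as the union of the rational boxes it contains, which are countably many. *)
Lemma open_measurable_rV (U : set vec) : open U -> measurable U.
Proof.
move=> oU.
pose F (q : {ffun 'I_n -> rat * rat}) :=
  let B := box (fun i => ratr (q i).1) (fun i => ratr (q i).2) in
  if `[< B `<=` U >] then B else set0.
rewrite (_ : U = \bigcup_q F q); last first.
  apply/seteqP; split=> [x Ux|x [q _]]; last first.
    by rewrite /F; case: asboolP => // h; exact: h.
  have /nbhs_ballP[e e0 eU] := open_nbhs_nbhs (conj oU Ux).
  have [a [b [xab abU]]] := box_nbhs x e0.
  exists [ffun i => (a i, b i)] => //; rewrite /F.
  have E : box (fun i => ratr ([ffun j => (a j, b j)] i).1)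
               (fun i => ratr ([ffun j => (a j, b j)] i).2) =
           box (ratr \o a) (ratr \o b).
    by congr box; apply/funext => i; rewrite ffunE.
  rewrite E; case: asboolP => // -[].
  by apply: subset_trans eU.
apply: countable_bigcupT_measurable => [|q].
  exact: countableP.
by rewrite /F; case: asboolP => // _; exact: measurable_box.
Qed.

Lemma closed_measurable_rV (U : set vec) : closed U -> measurable U.
Proof.
move=> cU; rewrite -[U]setCK; apply: measurableC; apply: open_measurable_rV.
exact: closed_openC.
Qed.

Lemma bounded_subset_box (A : set vec) : bounded_set A ->
  exists k : nat, A `<=` box (fun=> - k%:R) (fun=> k%:R).
Proof.
move=> [M [_ hM]]; exists (Num.bound `|M + 1|) => x Ax i.
have {}hM := hM (M + 1) (ltac:(by rewrite ltrDl)) x Ax.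
have h1 : `|x ord0 i| <= `|x|.
  rewrite [leRHS]/Num.norm/= mx_normrE.
  by apply/bigmax_geP; right; exists (ord0, i).
have h2 : `|x ord0 i| < (Num.bound `|M + 1|)%:R.
  apply: (@le_lt_trans _ _ `|M + 1|); last exact: archi_boundP.
  by apply: le_trans h1 _; apply: le_trans hM _; exact: ler_norm.
by move: h2; rewrite in_itv/= ltr_norml => /andP[-> /ltW ->].
Qed.

Lemma lebesgue_rV_box_fin a b : (leb (box a b) < +oo)%E.
Proof.
pose a' i := Num.min (a i) (b i).
have ab i : a' i <= b i by rewrite /a' ge_min lexx orbT.
apply: (@le_lt_trans _ _ (leb (box a' b))).
  apply: le_measure; rewrite ?inE; [exact: measurable_box..|].
  move=> x h i; have := h i; rewrite !in_itv/= /a' => /andP[h1 ->].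
  by rewrite gt_min h1.
by rewrite lebesgue_rV_box// ltry.
Qed.

Lemma lebesgue_rV_bounded (A : set vec) : measurable A -> bounded_set A ->
  (leb A < +oo)%E.
Proof.
move=> mA /bounded_subset_box[k kA].
apply: le_lt_trans (lebesgue_rV_box_fin (fun=> - k%:R) (fun=> k%:R)).
by apply: le_measure; rewrite ?inE//; exact: measurable_box.
Qed.

Lemma bigcup_box :
  \bigcup_k (box (fun=> - k%:R) (fun=> k%:R)) = [set: vec].
Proof.
apply/seteqP; split=> // x _.
have [|k hk] := @bounded_subset_box [set x]; last by exists k => //; exact: hk.
exact/compact_bounded/compact_set1.
Qed.

(** Half-open boxes are stable under intersection, generate the measurable sets, and exhaust the
    space with finite mass, so the uniqueness theorem on a generating pi-system applies. *)
Lemma lebesgue_rV_unique (mu nu : {measure set vec -> \bar R}) :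
  (forall a b, (forall i, a i <= b i) -> mu (box a b) = nu (box a b)) ->
  (forall a b, (mu (box a b) < +oo)%E) ->
  forall A, measurable A -> mu A = nu A.
Proof.
move=> munu mufin.
have munu' a b : mu (box a b) = nu (box a b).
  have [ab|] := pselect (forall i, a i <= b i); first exact: munu.
  move=> /existsNP[i /negP]; rewrite -ltNge => abi.
  suff -> : box a b = set0 by rewrite !measure0.
  rewrite -subset0 => x /(_ i); rewrite in_itv/= => /andP[h1 h2].
  by have := lt_trans (lt_le_trans h1 h2) abi; rewrite ltxx.
pose G := [set B | exists a b, B = box a b].
apply: (@measure_unique _ _ _ G (fun k => box (fun=> - k%:R) (fun=> k%:R))).
- apply/seteqP; split; last first.
    apply: smallest_sub; first exact: sigma_algebra_measurable.
    by move=> _ [a [b ->]]; exact: measurable_box.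
  have mc (i : 'I_n) : measurable_fun setT
      ((fun x => x ord0 i) : g_sigma_algebraType G -> measurableTypeR R).
    apply: (@measurability _ _ _ _ _ _ (@ocitv R)) => //.
    move=> _ [_ [[a b] _ <-]] <-; rewrite setTI.
    (* A slab in direction [i] is an increasing union of boxes whose other sides grow with [k]. *)
    rewrite (_ : _ @^-1` _ = \bigcup_k box
        (fun j => if j == i then a else - k%:R)
        (fun j => if j == i then b else k%:R)).
      apply: bigcup_measurable => k _; apply: sub_sigma_algebra.
      by eexists; eexists.
    apply/seteqP; split=> [x/= xab|x [k _] /(_ i)]; last by rewrite eqxx.
    have : [set: vec] x by [].
    rewrite -bigcup_box => -[k _ hk]; exists k => // j.
    by case: eqP => [->|_]; [exact: xab|exact: hk].
  apply: smallest_sub; first exact: smallest_sigma_algebra.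
  elim/big_ind: _ => [//|X Y hX hY|i _]; first by rewrite subUset.
  by move=> A [B mB <-]; exact: (mc i).
- move=> _ _ [a [b ->]] [a' [b' ->]].
  exists (fun i => Num.max (a i) (a' i)), (fun i => Num.min (b i) (b' i)).
  apply/seteqP; split=> [x [h1 h2] i|x h].
    have := h1 i; have := h2 i; rewrite !in_itv/= => /andP[h3 h4] /andP[h5 h6].
    by rewrite gt_max le_min h3 h4 h5 h6.
  by split=> i; have := h i; rewrite !in_itv/= gt_max le_min;
    move=> /andP[/andP[h1 h2] /andP[h3 h4]]; apply/andP.
- by move=> k; eexists; eexists.
- exact: bigcup_box.
- by move=> _ [a [b ->]]; exact: munu'.
- by [].
Qed.

Lemma measurable_affine m (M : 'M[R]_(m, n)) (b : vec) :
  measurable_fun setT (fun x : 'rV[R]_m => b + x *m M).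
Proof.
apply: measurable_rVP => i.
rewrite (_ : (fun x => _) =
  (fun x : 'rV[R]_m => b ord0 i + \sum_j x ord0 j * M j i)); last first.
  by apply/funext => x; rewrite !mxE.
apply: measurable_funD => //; apply: measurable_sum => j.
by apply: measurable_funM => //; exact: measurable_coord.
Qed.

Lemma lebesgue_rV_translation (a : vec) A : measurable A ->
  leb ((fun x => a + x) @^-1` A) = leb A.
Proof.
move=> mA.
have mt : measurable_fun setT (fun x : vec => a + x).
  have := measurable_affine 1%:M a.
  by rewrite (_ : (fun x => _) = (fun x => a + x))//; apply/funext => x; rewrite mulmx1.
apply/esym; apply: (lebesgue_rV_unique (nu := pushforward leb (fun x : vec => a + x))) => //; last first.
  by move=> *; exact: lebesgue_rV_box_fin.
have E c d : (fun x : vec => a + x) @^-1` box c d =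
    box (fun i => c i - a ord0 i) (fun i => d i - a ord0 i).
  by apply/seteqP; split=> x/= h i; have := h i;
    rewrite !in_itv/= !mxE ltrBlDl lerBrDl.
move=> c d cd; transitivity (leb ((fun x : vec => a + x) @^-1` box c d)) => //.
rewrite E !lebesgue_rV_box//; last by move=> i; rewrite lerB.
by congr (_%:E); apply: eq_bigr => i _; rewrite opprB addrA subrK.
Qed.

(** The explicit factor matters here, in contrast to [lebesgue_rV_affine]: [ref_simplex_divergence]
    compares it with 1 as [r] tends to 1. *)
Lemma lebesgue_rV_scale (r : R) (A : set vec) : 0 < r -> measurable A ->
  ((r ^+ n)%:E * leb ((fun x => r *: x) @^-1` A) = leb A)%E.
Proof.
move=> r0 mA.
have mt : measurable_fun setT (fun x : vec => r *: x).
  have := measurable_affine r%:M 0.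
  by rewrite (_ : (fun x => _) = (fun x => r *: x))//; apply/funext => x;
     rewrite mul_mx_scalar add0r.
have rn0 : 0 <= r ^+ n by rewrite exprn_ge0// ltW.
apply/esym; apply: (lebesgue_rV_unique
  (nu := mscale (NngNum rn0) (pushforward leb (fun x : vec => r *: x)))) => //; last first.
  by move=> *; exact: lebesgue_rV_box_fin.
have E c d : (fun x : vec => r *: x) @^-1` box c d =
    box (fun i => r^-1 * c i) (fun i => r^-1 * d i).
  by apply/seteqP; split=> x/= h i; have := h i;
    rewrite !in_itv/= !mxE ltr_pdivrMl// ler_pdivlMl.
move=> c d cd.
transitivity ((r ^+ n)%:E * leb ((fun x : vec => r *: x) @^-1` box c d))%E => //.
rewrite E !lebesgue_rV_box//; last by move=> i; rewrite ler_wpM2l// invr_ge0 ltW.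
rewrite -EFinM; congr (_%:E).
rewrite -[X in _ ^+ X](card_ord n) -prodr_const -big_split/=.
by apply: eq_bigr => i _; rewrite -mulrBr mulrA mulfV ?mul1r// gt_eqF.
Qed.

End boxes.

(** * Uniqueness of Haar measure, null hyperplanes, affine change of variables *)

Section haar.
Context {R : realType} {n : nat}.
Local Notation vec := 'rV[R]_n.
Local Notation leb := (lebesgue_rV n : {measure set vec -> \bar R}).

Lemma box_finite_sigma_finite (nu : {measure set vec -> \bar R}) :
  (forall a b, (nu (box a b) < +oo)%E) -> sigma_finite setT nu.
Proof.
move=> nufin; exists (fun k => box (fun=> - k%:R) (fun=> k%:R)).
  by rewrite bigcup_box.
by move=> k; split; [exact: measurable_box|exact: nufin].
Qed.

Section sigma_finite_copy.
Variables (nu : {measure set vec -> \bar R})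
  (nufin : forall a b, (nu (box a b) < +oo)%E).

(* An alias of [nu] keyed on the finiteness proof, which a canonical
   sigma-finite structure cannot take from [nu] alone. *)
Definition sigma_finite_copy (_ : forall a b, (nu (box a b) < +oo)%E) :
  set vec -> \bar R := nu.

Let copy := sigma_finite_copy nufin.

HB.instance Definition _ := isMeasure.Build _ _ _ copy
  (measure0 nu) (measure_ge0 nu) (@measure_semi_sigma_additive _ _ _ nu).

HB.instance Definition _ := Measure_isSigmaFinite.Build _ _ _ copy
  (box_finite_sigma_finite nufin).

Definition sigma_finite_pack : {sigma_finite_measure set vec -> \bar R} := copy.

End sigma_finite_copy.

Definition lebesgue_sf := sigma_finite_pack (@lebesgue_rV_box_fin R n).

Lemma measurable_lin2 (a b : R) : measurable_fun setT
  (fun z : vec * vec => a *: z.1 + b *: z.2).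
Proof.
apply: measurable_rVP => i.
rewrite (_ : (fun x => _) =
    (fun z : vec * vec => a * z.1 ord0 i + b * z.2 ord0 i)); last first.
  by apply/funext => z; rewrite !mxE.
by apply: measurable_funD; apply: measurable_funM => //;
  [apply: (measurableT_comp (measurable_coord i) measurable_fst)|
   apply: (measurableT_comp (measurable_coord i) measurable_snd)].
Qed.

Definition unit_box : set vec := box (fun=> 0) (fun=> 1).

Lemma lebesgue_rV_unit_box : leb unit_box = 1%E.
Proof.
rewrite lebesgue_rV_box//.
by rewrite big1// => i _; rewrite subr0.
Qed.

(* Uniqueness of Haar measure: integrate [1_Q(x) 1_B(x + y)] over
   [leb \x nu] in both orders, using translation invariance on each side. *)
Lemma translation_invariant_lebesgue (nu : {measure set vec -> \bar R}) :
  (forall a b, (nu (box a b) < +oo)%E) ->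
  (forall (a : vec) (A : set vec), measurable A ->
     nu ((fun x => a + x) @^-1` A) = nu A) ->
  forall B : set vec, measurable B ->
    nu B = (nu (-%R @^-1` unit_box) * leb B)%E.
Proof.
move=> nufin nut B mB.
pose nus := sigma_finite_pack nufin.
have mQ : measurable unit_box by exact: measurable_box.
have mN (a b : R) (A : set vec) : measurable A ->
    measurable [set z : vec * vec | A (a *: z.1 + b *: z.2)].
  by move=> mA; rewrite -[X in measurable X]setTI; exact: measurable_lin2.
have mL (a b : R) (c : vec) (A : set vec) : measurable A ->
    measurable [set z : vec | A (a *: c + b *: z)].
  move=> mA; rewrite -[X in measurable X]setTI.
  rewrite (_ : [set z | _] = (fun z : vec => a *: c + z *m b%:M) @^-1` A).
    exact: measurable_affine.
  by apply/funext => z /=; rewrite mul_mx_scalar.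
pose E1 := [set z : vec * vec | unit_box z.1] `&`
           [set z : vec * vec | B (1 *: z.1 + 1 *: z.2)].
(* [E2] is the set where x is in B and x - y in Q. For fixed y, [E1] and [E2] are translates of each
   other by y. For fixed x, their sections are translates of B (if x is in Q) and of -Q (if x is in
   B), so the two integrals are nu(B) leb(Q) and nu(-Q) leb(B). *)
pose E2 := [set z : vec * vec | B z.1] `&`
           [set z : vec * vec | unit_box (1 *: z.1 + -1 *: z.2)].
have mfst (A : set vec) : measurable A -> measurable [set z : vec * vec | A z.1].
  by move=> mA; rewrite -[X in measurable X]setTI; exact: measurable_fst.
have mE1 : measurable E1 by apply: measurableI; [exact: mfst|exact: mN].
have mE2 : measurable E2 by apply: measurableI; [exact: mfst|exact: mN].
have X (A C : set vec) (E : set (vec * vec)) (D : vec -> set vec) k : measurable A ->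
    (forall x, measurable (D x)) -> (forall x, nu (D x) = k) ->
    E = [set z | A z.1 /\ D z.1 z.2] ->
    (\int[leb]_x nu (xsection E x) = k * leb A)%E.
  move=> mA mD Dk ->.
  transitivity (\int[leb]_x (k * (\1_A x)%:E))%E.
    apply: eq_integral => x _; rewrite indicE.
    have [Ax|Ax] := boolP (x \in A).
      rewrite mule1 -(Dk x); congr (nu _); apply/seteqP; split=> y.
        by rewrite /xsection/= inE => -[].
      by move=> Dy; rewrite /xsection/= inE; split=> //; rewrite inE in Ax.
    rewrite mule0 (_ : xsection _ _ = set0) ?measure0//.
    rewrite -subset0 => y; rewrite /xsection/= inE/= => -[Ax' _].
    by move: Ax; rewrite notin_setE.
  rewrite ge0_integralZl//.
  - by rewrite integral_indic// setIT.
  - by apply/measurable_EFinP; exact: measurable_indic.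
  - by rewrite -(Dk 0) measure_ge0.
have H1 : (\int[leb]_x nu (xsection E1 x) = nu B * leb unit_box)%E.
  apply: (X _ set0 _ (fun x => [set y | B (1 *: x + 1 *: y)])) => //.
    by move=> x; exact: mL.
  move=> x; rewrite -(nut x B)//; congr (nu _).
  by apply/funext => y /=; rewrite !scale1r.
have H2 : (\int[leb]_x nu (xsection E2 x) = nu (-%R @^-1` unit_box) * leb B)%E.
  apply: (X _ set0 _ (fun x => [set y | unit_box (1 *: x + -1 *: y)])) => //.
    by move=> x; exact: mL.
  move=> x; rewrite -(nut (- x) (-%R @^-1` unit_box)).
    by congr (nu _); apply/funext => y /=; rewrite opprD opprK scale1r scaleN1r.
  have := mL 0 (-1) 0 unit_box mQ.
  by congr measurable; apply/funext => y /=; rewrite scaler0 add0r scaleN1r.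
rewrite -H2; rewrite lebesgue_rV_unit_box mule1 in H1; rewrite -H1.
have := @indic_fubini_tonelli _ _ _ _ _ lebesgue_sf nus E1 mE1.
rewrite indic_fubini_tonelli_FE// indic_fubini_tonelli_GE// => ->.
have := @indic_fubini_tonelli _ _ _ _ _ lebesgue_sf nus E2 mE2.
rewrite indic_fubini_tonelli_FE// indic_fubini_tonelli_GE// => ->.
apply: eq_integral => y _ /=.
have mY (E : set (vec * vec)) : measurable E -> measurable (ysection E y).
  by move=> mE; exact: measurable_ysection.
rewrite -[RHS](lebesgue_rV_translation y); last exact: mY.
have P (E : set (vec * vec)) x : ysection E y x = E (x, y).
  by apply/propext; rewrite /ysection/=; split; rewrite inE.
suff -> : ysection E1 y = (fun x => y + x) @^-1` ysection E2 y by [].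
apply/funext => x; rewrite /preimage/= !P /E1 /E2 /setI/= !scale1r scaleN1r.
rewrite [y + x]addrC addrK; apply/propext; tauto.
Qed.

(** Fubini for the set of pairs (x, t) with x + t e in A: integrating first in t gives 0, while for
    fixed t the section is a translate of A. *)
Lemma line_null (e : vec) (A : set vec) : measurable A ->
  (forall x, lebesgue_measure [set t : R | A (x + t *: e)] = 0%E) -> leb A = 0%E.
Proof.
move=> mA A0.
pose E := [set z : vec * measurableTypeR R | A (z.1 + z.2 *: e)].
have mE : measurable E.
  rewrite -[X in measurable X]setTI.
  have : measurable_fun setT (fun z : vec * measurableTypeR R => z.1 + z.2 *: e).
    apply: measurable_rVP => i.
    rewrite (_ : (fun x => _) =
        (fun z : vec * measurableTypeR R => z.1 ord0 i + z.2 * e ord0 i)); last first.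
      by apply/funext => z; rewrite !mxE.
    apply: measurable_funD.
      by apply: (measurableT_comp (measurable_coord i) measurable_fst).
    by apply: measurable_funM => //; exact: measurable_snd.
  exact.
have := @indic_fubini_tonelli _ _ _ _ _ lebesgue_sf
  (@lebesgue_measure R : {sigma_finite_measure set _ -> \bar R}) E mE.
rewrite indic_fubini_tonelli_FE// indic_fubini_tonelli_GE//.
under eq_integral.
  move=> x _ /=.
  rewrite (_ : xsection E x = [set t : R | A (x + t *: e)]); last first.
    by apply/seteqP; split=> t; rewrite /xsection/= inE.
  rewrite A0; over.
rewrite integral0.
under [X in _ = X -> _]eq_integral.
  move=> t _ /=.
  rewrite (_ : ysection E t = (fun x => t *: e + x) @^-1` A); last first.
    by apply/seteqP; split=> x; rewrite /ysection/= inE/= addrC.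
  have -> : sigma_finite_copy (@lebesgue_rV_box_fin R n)
      ((fun x => t *: e + x) @^-1` A) = leb A by exact: lebesgue_rV_translation.
  over.
(* The integral equals [leb A] times the infinite length of the real line, and it is 0. *)
rewrite integral_cst//= => /esym/eqP.
rewrite mule_eq0 => /orP[/eqP //|/eqP].
rewrite (_ : [set: R] = [set` `]-oo, +oo[])//; last by rewrite set_itvE.
by rewrite lebesgue_measure_itv.
Qed.

Lemma measurable_dot (a : vec) :
  measurable_fun setT (fun x : vec => dot a x : measurableTypeR R).
Proof.
apply: measurable_sum => i.
by apply: measurable_funM => //; exact: measurable_coord.
Qed.

Lemma hyperplane_null (a : vec) (b : R) : a != 0 ->
  leb [set x | dot a x = b] = 0%E.
Proof.
move=> a0.
have [i ai] : exists i, a ord0 i != 0.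
  apply/existsP; apply: contraNT a0 => /existsPn h; apply/eqP/rowP => i.
  by rewrite mxE; apply/eqP; move: (h i); rewrite negbK.
apply: (@line_null (delta_mx ord0 i)).
  rewrite -[X in measurable X]setTI.
  have := @measurable_dot a measurableT [set b] (measurable_set1 b).
  by [].
move=> x.
rewrite [X in lebesgue_measure X](_ : _ = [set (b - dot a x) / a ord0 i]).
  exact: lebesgue_measure_set1.
have E t : dot a (x + t *: delta_mx ord0 i) = dot a x + t * a ord0 i.
  rewrite /dot (bigD1 i)//= [in RHS](bigD1 i)//= !mxE !eqxx mulr1 mulrDr.
  rewrite [RHS]addrAC [t * _]mulrC; congr (_ + _).
  apply: eq_bigr => j ji.
  by rewrite !mxE eqxx (negbTE ji) mulr0 addr0.
apply/seteqP; split=> t /=; rewrite E.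
  by move=> <-; rewrite addrAC subrr add0r mulfK.
by move=> ->; rewrite divfK// addrC subrK.
Qed.

Lemma open_lebesgue_gt0 (U : set vec) : open U -> U !=set0 -> (0 < leb U)%E.
Proof.
move=> oU [x Ux].
have /nbhs_ballP[e /= e0 eU] := open_nbhs_nbhs (conj oU Ux).
have mU := open_measurable_rV oU.
pose a i := x ord0 i - e / 2; pose b i := x ord0 i.
have ab i : a i <= b i by rewrite gerBl divr_ge0// ltW.
apply: (@lt_le_trans _ _ (leb (box a b))).
  rewrite lebesgue_rV_box// lte_fin prodr_gt0// => i _.
  by rewrite /a /b opprB addrC subrK divr_gt0.
apply: le_measure; rewrite ?inE//; first exact: measurable_box.
move=> y hy; apply: eU; split=> // j i; rewrite ord1 /ball/= /ball_/=.
have := hy i; rewrite in_itv/= /a /b => /andP[h1 h2].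
rewrite ger0_norm ?subr_ge0// ltrBlDr -ltrBlDl (le_lt_trans _ h1)//.
by rewrite lerB// ler_pdivrMr// ler_pMr// ler1n.
Qed.

Lemma differentiable_affine m (M : 'M[R]_(n, m)) (p : 'rV[R]_m) (x : vec) :
  differentiable (fun x : vec => p + x *m M) x.
Proof.
rewrite (_ : (fun x : vec => _) =
    cst p + \sum_j (fun x : vec => x ord0 j *: row j M)).
  apply: differentiableD; first exact: differentiable_cst.
  by apply: differentiable_sum => j; apply: differentiableZl;
    exact: differentiable_coord.
by apply/funext => y; rewrite mulmx_sum_row !fctE fct_sumE.
Qed.

Lemma continuous_affine m (M : 'M[R]_(n, m)) (p : 'rV[R]_m) :
  continuous (fun x : vec => p + x *m M).
Proof.
by move=> x; apply: differentiable_continuous; exact: differentiable_affine.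
Qed.

Lemma box_compact (a b : 'I_n -> R) :
  compact [set x : vec | forall i, x ord0 i \in `[a i, b i]].
Proof.
apply: (@rV_compact _ _ (fun i => [set` `[a i, b i]])) => i.
exact: segment_compact.
Qed.

Lemma affine_preimage (M : 'M[R]_n) (p : vec) (A : set vec) : M \in unitmx ->
  (fun x => p + x *m M) @^-1` A = (fun y => (y - p) *m invmx M) @` A.
Proof.
move=> Mu; apply/seteqP; split=> [x Ax|_ [y Ay <-]].
  by exists (p + x *m M) => //; rewrite addrC addKr mulmxK.
by rewrite /preimage/= mulmxKV// addrC subrK.
Qed.

Lemma bounded_setS (B A : set vec) : A `<=` B -> bounded_set B -> bounded_set A.
Proof.
by move=> AB [M [Mr hM]]; exists M; split=> // r /hM hr x /AB; exact: hr.
Qed.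

Lemma compact_affine_preimage (M : 'M[R]_n) (p : vec) (A : set vec) :
  M \in unitmx -> compact A -> compact ((fun x => p + x *m M) @^-1` A).
Proof.
move=> Mu cA; rewrite affine_preimage//.
rewrite (_ : (fun y => _) = (fun y => - p *m invmx M + y *m invmx M)).
  apply: continuous_compact => //; apply: continuous_subspaceT.
  exact: continuous_affine.
by apply/funext => y; rewrite addrC mulmxDl.
Qed.

Lemma pushforward_measure (phi : vec -> vec) : measurable_fun setT phi ->
  exists nu : {measure set vec -> \bar R}, forall A, nu A = leb (phi @^-1` A).
Proof.
move=> mphi.
have @nu : {measure set vec -> \bar R} by refine (pushforward leb phi).
by exists nu.
Qed.

(** The pushforward of [leb] under the affine map is translation invariant and finite on boxes, so
    it is a multiple of [leb]. The factor is positive because the pushforward has positive total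
    mass, and the constant is its inverse. *)
Lemma lebesgue_rV_affine (M : 'M[R]_n) (p : vec) : M \in unitmx ->
  exists c : R, 0 < c /\ forall A : set vec, measurable A ->
    (leb A = c%:E * leb ((fun x : vec => (p + x *m M)%R) @^-1` A))%E.
Proof.
move=> Mu; pose phi (x : vec) := p + x *m M.
have mphi : measurable_fun setT phi by exact: measurable_affine.
have [nu nuE] := pushforward_measure mphi.
have mpre A : measurable A -> measurable (phi @^-1` A).
  by move=> mA; rewrite -[X in measurable X]setTI; exact: mphi.
have nufin a b : (nu (box a b) < +oo)%E.
  rewrite nuE; apply: lebesgue_rV_bounded.
    by apply: mpre; exact: measurable_box.
  apply: (@bounded_setS (phi @^-1` [set x | forall i, x ord0 i \in `[a i, b i]])).
    move=> x h i; have := h i; rewrite !in_itv/= => /andP[/ltW -> ->]//.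
  by apply: compact_bounded; apply: compact_affine_preimage => //; exact: box_compact.
(* A translation by [a] in the image is a translation by [a *m invmx M] in the source. *)
have nut (a : vec) (A : set vec) : measurable A ->
    nu ((fun x => a + x) @^-1` A) = nu A.
  move=> mA; rewrite !nuE.
  rewrite -[RHS](lebesgue_rV_translation (a *m invmx M)); last exact: mpre.
  congr (leb _); apply/funext => x; rewrite /preimage/= /phi.
  by rewrite mulmxDl mulmxKV// addrCA.
have H := translation_invariant_lebesgue nufin nut.
set k := nu (-%R @^-1` unit_box) in H.
have nuT : (0 < nu setT)%E.
  rewrite nuE preimage_setT.
  by apply: open_lebesgue_gt0; [exact: openT|exists 0].
have k_ge0 : (0 <= k)%E by exact: measure_ge0.
have k_lt : (k < +oo)%E.
  have := nufin (fun=> 0) (fun=> 1).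
  by rewrite H ?lebesgue_rV_unit_box ?mule1//; exact: measurable_box.
have k_gt0 : (0 < k)%E.
  rewrite lt_neqAle k_ge0 andbT; apply/eqP => k0.
  by move: nuT; rewrite H// -k0 mul0e ltxx.
have kE : k = (fine k)%:E by rewrite fineK// ge0_fin_numE.
have fk : 0 < fine k by rewrite -lte_fin -kE.
exists (fine k)^-1; split; first by rewrite invr_gt0.
move=> A mA.
have -> : leb ((fun x => p + x *m M) @^-1` A) = nu A by rewrite nuE.
by rewrite H// kE muleA -EFinM mulVf ?mul1e// gt_eqF.
Qed.

(** The constant is quantified before the domain and the integrand: later proofs identify it, or
    compare it, by evaluating the formula on other functions. *)
Lemma Rintegral_affine (M : 'M[R]_n) (p : vec) : M \in unitmx ->
  exists c : R, 0 < c /\ forall (D : set vec) (f : vec -> R), measurable D ->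
    leb.-integrable D (EFin \o f) ->
    leb.-integrable ((fun x : vec => p + x *m M) @^-1` D)
       (EFin \o (fun x => f (p + x *m M))) /\
    \int[leb]_(x in D) f x =
    c * \int[leb]_(x in (fun x : vec => p + x *m M) @^-1` D) f (p + x *m M).
Proof.
move=> Mu; have [c [c0 cE]] := lebesgue_rV_affine p Mu.
exists c; split=> // D f mD /integrableP[mf intf].
pose phi (x : vec) := p + x *m M.
have mphi : measurable_fun setT phi by exact: measurable_affine.
have mpre A : measurable A -> measurable (phi @^-1` A).
  by move=> mA; rewrite -[X in measurable X]setTI; exact: mphi.
have H (g : vec -> \bar R) : measurable_fun D g ->
    (forall x, D x -> 0 <= g x)%E ->
    (\int[leb]_(x in D) g x = c%:E * \int[leb]_(x in phi @^-1` D) g (phi x))%E.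
  move=> mg g0.
  rewrite (@eq_measure_integral _ _ _ _
    (mscale (NngNum (ltW c0)) (pushforward leb phi))); last first.
    by move=> A mA _; rewrite cE.
  rewrite ge0_integral_mscale//; congr (_ * _)%E.
  rewrite ge0_integral_pushforward// => y; rewrite inE; exact: g0.
have mfphi : measurable_fun (phi @^-1` D) (EFin \o (f \o phi)).
  apply/measurable_EFinP; apply: (measurable_comp mD) => //.
  - by move=> _ [x Dx <-].
  - exact/measurable_EFinP.
  - exact: measurable_funTS.
(* Since c is positive, an infinite integral of the pullback would make the integral of [f]
   infinite. *)
have intfphi : leb.-integrable (phi @^-1` D) (EFin \o (f \o phi)).
  apply/integrableP; split=> //.
  move: intf; rewrite H//; last exact: measurableT_comp.
  case: (\int[leb]_(x in phi @^-1` D) _)%E => [r||]; rewrite ?ltry//.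
  by rewrite gt0_muley.
split=> //.
have Ep : (fun x => (EFin \o f)^\+%E (phi x)) = (EFin \o (f \o phi))^\+%E.
  by apply/funext => x; rewrite !funeposE.
have En : (fun x => (EFin \o f)^\-%E (phi x)) = (EFin \o (f \o phi))^\-%E.
  by apply/funext => x; rewrite !funenegE.
have fp := integrable_fin_num (mpre _ mD) (integrable_funepos (mpre _ mD) intfphi).
have fn := integrable_fin_num (mpre _ mD) (integrable_funeneg (mpre _ mD) intfphi).
have -> : \int[leb]_(x in D) f x = fine (c%:E * \int[leb]_(x in phi @^-1` D)
    (EFin \o (f \o phi)) x).
  rewrite /Rintegral integralE [in RHS]integralE -Ep -En.
  rewrite H//; last exact: measurable_funepos.
  rewrite H//; last exact: measurable_funeneg.
  rewrite -muleBr// Ep En; first by rewrite fin_num_adde_defr.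
rewrite fineM// integralE fin_numB fp fn //.
Qed.

End haar.

Section dominated.
Context d {T : measurableType d} {R : realType} (mu : {measure set T -> \bar R}).

Lemma bounded_integrable (D : set T) (f : T -> R) (C : R) : measurable D ->
  (mu D < +oo)%E -> measurable_fun D f -> (forall x, D x -> `|f x| <= C) ->
  mu.-integrable D (EFin \o f).
Proof.
move=> mD fD mf fC; apply: measurable_bounded_integrable => //.
by exists C; split=> [|r Cr x Dx]; [exact: num_real|exact: le_trans (fC x Dx) (ltW Cr)].
Qed.

Lemma le_integrableR (D : set T) (f g : T -> R) : measurable D ->
  measurable_fun D f -> (forall x, D x -> `|f x| <= g x) ->
  mu.-integrable D (EFin \o g) -> mu.-integrable D (EFin \o f).
Proof.
move=> mD mf fg ig; apply: (le_integrable mD _ _ ig); first exact/measurable_EFinP.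
by move=> x Dx /=; rewrite lee_fin (le_trans (fg x Dx))// ler_norm.
Qed.

Lemma integrableDR (D : set T) (f g : T -> R) : measurable D ->
  mu.-integrable D (EFin \o f) -> mu.-integrable D (EFin \o g) ->
  mu.-integrable D (EFin \o (fun x => f x + g x)).
Proof. by move=> mD intf intg; exact: (integrableD mD intf intg). Qed.

Lemma integrableZR (D : set T) (k : R) (f : T -> R) : measurable D ->
  mu.-integrable D (EFin \o f) -> mu.-integrable D (EFin \o (fun x => k * f x)).
Proof. by move=> mD intf; exact: (integrableZl mD k intf). Qed.

Lemma integrableBR (D : set T) (f g : T -> R) : measurable D ->
  mu.-integrable D (EFin \o f) -> mu.-integrable D (EFin \o g) ->
  mu.-integrable D (EFin \o (fun x => f x - g x)).
Proof. by move=> mD intf intg; exact: (integrableB mD intf intg). Qed.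

Lemma integrable_sumR (I : Type) (s : seq I) (D : set T) (f : I -> T -> R) :
  measurable D -> (forall i, mu.-integrable D (EFin \o f i)) ->
  mu.-integrable D (EFin \o (fun x => \sum_(i <- s) f i x)).
Proof.
move=> mD intf; elim: s => [|i s IH].
  rewrite (_ : EFin \o _ = cst 0%E); first exact: integrable0.
  by apply/funext => x /=; rewrite big_nil.
rewrite (_ : EFin \o _ = EFin \o (fun x => f i x + \sum_(i <- s) f i x)).
  exact: integrableDR.
by apply/funext => x /=; rewrite big_cons.
Qed.

Lemma Rintegral_sum (I : Type) (s : seq I) (D : set T) (f : I -> T -> R) :
  measurable D -> (forall i, mu.-integrable D (EFin \o f i)) ->
  \int[mu]_(x in D) (\sum_(i <- s) f i x) = \sum_(i <- s) \int[mu]_(x in D) f i x.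
Proof.
move=> mD intf; elim: s => [|i s IH].
  rewrite big_nil (_ : (fun x => _) = cst 0); last first.
    by apply/funext => x; rewrite big_nil.
  by rewrite Rintegral_cst// mul0r.
rewrite big_cons -IH -RintegralD//; last exact: integrable_sumR.
by congr Rintegral; apply/funext => x; rewrite big_cons.
Qed.

Lemma Rintegral_dominated_cvg (D : set T) (f_ : (T -> R)^nat) (f g : T -> R) :
  measurable D -> (forall k, measurable_fun D (f_ k)) ->
  (forall x, D x -> f_ k x @[k --> \oo] --> f x) ->
  mu.-integrable D (EFin \o g) ->
  (forall k x, D x -> `|f_ k x| <= g x) ->
  (\int[mu]_(x in D) f_ k x) @[k --> \oo] --> \int[mu]_(x in D) f x.
Proof.
move=> mD mf_ f_f ig f_g.
have mf : measurable_fun D f by exact: measurable_fun_cvg f_f.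
have fg x : D x -> `|f x| <= g x.
  move=> Dx; apply: (@closed_cvg _ _ _ eventually_filter
    (fun k => `|f_ k x|) [set y | y <= g x]).
  - exact: closed_le.
  - by near=> k; exact: f_g.
  - by apply: cvg_norm; exact: f_f.
have f_fE : \forall x \ae mu, D x -> (f_ k x)%:E @[k --> \oo] --> (f x)%:E.
  by apply: aeW => x Dx; apply: cvg_EFin; [near=> k|exact: f_f].
have f_gE : \forall x \ae mu, forall k, D x -> (`|(f_ k x)%:E| <= (g x)%:E)%E.
  by apply: aeW => x k Dx; rewrite lee_fin f_g.
have mfE k : measurable_fun D (EFin \o f_ k) by exact/measurable_EFinP.
have [_ _] := dominated_convergence mD mfE ((measurable_EFinP _ _).2 mf) f_fE ig f_gE.
move=> H.
have If : mu.-integrable D (EFin \o f) by exact: le_integrableR fg ig.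
apply: (fine_cvg (f := fun k => (\int[mu]_(x in D) (f_ k x)%:E)%E)).
by rewrite fineK//; exact: integrable_fin_num.
Unshelve. all: by end_near. Qed.

End dominated.

(** * Divergence theorem on the reference simplex *)

Section C1facts.
Context {R : realType} {n : nat}.
Local Notation vec := 'rV[R]_n.
Local Notation leb := (lebesgue_rV n : {measure set vec -> \bar R}).

Lemma continuous_measurable_rV (f : vec -> R) : continuous f ->
  measurable_fun setT f.
Proof.
move=> cf; apply: (measurability _ (RGenOInfty.measurableE R)).
move=> _ [_ [a ->] <-]; rewrite setTI; apply: open_measurable_rV.
apply: open_comp => //; exact: interval_open.
Qed.

Lemma compact_continuous_bounded (K : set vec) (f : vec -> R) :
  compact K -> continuous f -> exists C : R, 0 <= C /\ forall x, K x -> `|f x| <= C.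
Proof.
move=> cK cf.
have : compact (f @` K) by apply: continuous_compact => //; exact: continuous_subspaceT.
move=> /compact_bounded[M [_ hM]]; exists (`|M| + 1); split; first by rewrite addr_ge0.
move=> x Kx; apply: (hM (`|M| + 1)); last by exists x.
by rewrite ltr_pwDr// ler_norm.
Qed.

Lemma ray_derive (f : vec -> R) (x : vec) (t : R) : differentiable f (t *: x) ->
  is_derive t 1 (fun s : R => f (s *: x)) ('D_x f (t *: x)).
Proof.
move=> df.
have E : (fun h : R => h^-1 *: (((fun s : R => f (s *: x)) \o shift t) (h *: 1) - f (t *: x)))
   = (fun h : R => h^-1 *: ((f \o shift (t *: x)) (h *: x) - f (t *: x))).
  by apply/funext => h /=; rewrite scalerDl [h *: 1]mulr1.
split; last by rewrite /derive E.
by rewrite /derivable E; exact: diff_derivable.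
Qed.

(** This is also the parameter set in [face_integral]; the same facts thus serve the cells in
    dimension d and their faces in dimension d - 1. *)
Definition ref_simplex : set vec :=
  [set x | (forall i, 0 <= x ord0 i) /\ \sum_i x ord0 i <= 1].

Lemma ref_simplex_scale (x : vec) (t : R) : ref_simplex x -> 0 <= t <= 1 ->
  ref_simplex (t *: x).
Proof.
move=> [x0 x1] /andP[t0 t1]; split=> [i|]; first by rewrite mxE mulr_ge0.
rewrite (eq_bigr (fun i => t * x ord0 i)) => [|i _]; last by rewrite mxE.
by rewrite -mulr_sumr mulr_ile1// sumr_ge0.
Qed.

Lemma continuous_sum_coord : continuous (fun x : vec => \sum_i x ord0 i : R).
Proof.
move=> x.
have -> : (fun x : vec => \sum_i x ord0 i) =
    \sum_i (fun x : vec => x ord0 i) by apply/funext => y; rewrite fct_sumE.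
apply: differentiable_continuous; apply: differentiable_sum => i.
exact: differentiable_coord.
Qed.

Lemma ref_simplex_closed : closed ref_simplex.
Proof.
rewrite (_ : ref_simplex = (\bigcap_(i in [set: 'I_n]) [set x : vec | 0 <= x ord0 i])
  `&` [set x | \sum_i x ord0 i <= 1]); last first.
  by apply/seteqP; split=> x [h1 h2]; split=> // i; [move=> _; exact: h1|exact: (h1 i)].
apply: closedI.
  apply: closed_bigI => i _.
  apply: (@closed_comp _ _ (fun x : vec => x ord0 i) [set y | 0 <= y]).
    by move=> x _; exact: coord_continuous.
  exact: closed_ge.
apply: (@closed_comp _ _ (fun x : vec => \sum_i x ord0 i) [set y | y <= 1]).
  by move=> x _; exact: continuous_sum_coord.
exact: closed_le.
Qed.

Lemma ref_simplex_compact : compact ref_simplex.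
Proof.
apply: (subclosed_compact ref_simplex_closed (@box_compact _ _ (fun=> 0) (fun=> 1))).
move=> x [x0 x1] i; rewrite in_itv/= x0/=; apply: le_trans x1.
by rewrite (bigD1 i)//= lerDl sumr_ge0.
Qed.

Lemma measurable_ref_simplex : measurable ref_simplex.
Proof. by apply: closed_measurable_rV; exact: ref_simplex_closed. Qed.

Lemma ref_simplex_fin : (leb ref_simplex < +oo)%E.
Proof.
apply: lebesgue_rV_bounded; first exact: measurable_ref_simplex.
exact/compact_bounded/ref_simplex_compact.
Qed.

(** The constant of [Rintegral_affine] for the matrix r I is identified by testing it on the unit
    box, whose preimage has a volume known from [lebesgue_rV_scale]. *)
Lemma Rintegral_scale (r : R) (D : set vec) (f : vec -> R) : 0 < r ->
  measurable D -> leb.-integrable D (EFin \o f) ->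
  \int[leb]_(x in D) f x =
  r ^+ n * \int[leb]_(x in (fun x : vec => r *: x) @^-1` D) f (r *: x).
Proof.
move=> r0 mD intf.
have ru : (r%:M : 'M[R]_n) \in unitmx.
  by rewrite unitmxE det_scalar unitfE expf_neq0// gt_eqF.
have E x : (0 : vec) + x *m r%:M = r *: x by rewrite add0r mul_mx_scalar.
have Ef : (fun x : vec => 0 + x *m r%:M) = (fun x => r *: x) by exact/funext.
have [c [c0 cE]] := Rintegral_affine (0 : vec) ru.
have [_ ->] := cE D f mD intf; rewrite Ef.
under eq_Rintegral do rewrite E.
have [_] := cE (@unit_box R n) (cst 1) (measurable_box _ _)
  (ltac:(apply: (@bounded_integrable _ _ _ _ _ _ 1) => //;
    [exact: measurable_box|by rewrite lebesgue_rV_unit_box ltry|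
     by move=> x _; rewrite normr1])).
have mpre A : measurable A -> measurable ((fun x : vec => r *: x) @^-1` A).
  move=> mA; rewrite -[X in measurable X]setTI -Ef.
  by apply: measurable_affine.
rewrite Ef Rintegral_cst; last exact: measurable_box.
rewrite Rintegral_cst; last by apply: mpre; exact: measurable_box.
rewrite lebesgue_rV_unit_box/= mul1r mul1r.
have := lebesgue_rV_scale r0 (@measurable_box R n (fun=> 0) (fun=> 1)).
rewrite -/unit_box lebesgue_rV_unit_box.
set m := leb _; move=> H1 H2; congr (_ * _).
have mfin : m \is a fin_num.
  rewrite ge0_fin_numE ?measure_ge0// ltNge; apply/negP; rewrite leye_eq => /eqP my.
  by move: H1; rewrite my gt0_muley ?lte_fin ?exprn_gt0.
move: H1; rewrite -(fineK mfin) -EFinM => -[H1].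
have : fine m != 0.
  by apply/eqP => m0; move: H1; rewrite m0 mulr0 => /esym/eqP; rewrite oner_eq0.
by move=> /mulIf; apply; rewrite H1 -H2.
Qed.

(** Dominated convergence is used for sequences, so the derivative is needed as a limit along a
    sequence of increments. *)
Lemma derive_cvg_seq (f : R -> R) (x d : R) (u : R^nat) : is_derive x 1 f d ->
  (forall k, u k != 0) -> u k @[k --> \oo] --> 0 ->
  (u k)^-1 * (f (u k + x) - f x) @[k --> \oo] --> d.
Proof.
move=> [df <-] u0 uc.
have H : (fun h => h^-1 *: ((f \o shift x) (h *: 1) - f x)) @ 0^' --> 'D_1 f x by [].
have uc' : u k @[k --> \oo] --> 0^'.
  move=> B hB.
    by apply: (@filterS _ _ _ (fun k => u k != 0 -> B (u k)) _ _ (uc _ hB)) => k; apply.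
have := cvg_comp _ _ uc' H; apply: cvg_trans.
by apply: near_eq_cvg; near=> k; rewrite /= [_ *: 1]mulr1.
Unshelve. all: by end_near. Qed.

(** Mean value theorem on the segment from s x to x; the derivative along the ray is ['D_x psi],
    whence a bound on derivatives whose direction is itself a point of the simplex. *)
Lemma ray_lipschitz (psi : vec -> R) (C : R) (x : vec) (s : R) :
  (forall x, differentiable psi x) ->
  (forall x y, ref_simplex x -> ref_simplex y -> `|'D_y psi x| <= C) ->
  ref_simplex x -> 0 <= s <= 1 -> `|psi x - psi (s *: x)| <= C * (1 - s).
Proof.
move=> dpsi hC Dx /andP[s0 s1].
have cf : {within `[s, 1], continuous (fun t : R => psi (t *: x))}.
  apply: continuous_subspaceT => t; apply: continuous_comp.
    exact: scalel_continuous.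
  exact/differentiable_continuous.
have [c] := MVT_segment s1 (fun t _ => ray_derive (dpsi (t *: x))) cf.
rewrite in_itv/= scale1r => /andP[sc c1] ->.
rewrite normrM [X in _ * X]ger0_norm ?subr_ge0//.
rewrite ler_wpM2r ?subr_ge0// hC//; apply: ref_simplex_scale => //.
by rewrite c1 (le_trans s0).
Qed.

(* The integral of the divergence of [x |-> psi x *: x] is the limit as
   [r --> 1] of [(int_D psi - int_(r D) psi) / (1 - r)], where [psi] is of order
   [1 - r] on [D \ r D] and the volume of [D \ r D] is also of this order. *)
Lemma ref_simplex_divergence (psi : vec -> R) (C : R) :
  (forall x, differentiable psi x) ->
  (forall x y, ref_simplex x -> ref_simplex y -> `|'D_y psi x| <= C) ->
  (forall x, ref_simplex x -> \sum_i x ord0 i = 1 -> psi x = 0) ->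
  \int[leb]_(x in ref_simplex) (n%:R * psi x + 'D_x psi x) = 0.
Proof.
move=> dpsi hC psi0; set D := ref_simplex.
have cpsi : continuous psi by move=> x; exact/differentiable_continuous.
have mpsi : measurable_fun setT psi by exact: continuous_measurable_rV.
have mD : measurable D by exact: measurable_ref_simplex.
have Dfin := ref_simplex_fin.
have [B [B0 hB]] := compact_continuous_bounded ref_simplex_compact cpsi.
have C0 : 0 <= C.
  have D0 : D 0 by split=> [i|]; [rewrite mxE|rewrite big1// => i _; rewrite mxE].
  by apply: le_trans (hC _ _ D0 D0).
(* The index is shifted by 2 so that [r k] is positive already for k = 0. *)
pose e k : R := k.+2%:R^-1; pose r k := 1 - e k.
have e0 k : 0 < e k by rewrite invr_gt0.
have e1 k : e k < 1 by rewrite invf_lt1// ltr1n.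
have r0 k : 0 < r k by rewrite subr_gt0.
have r1 k : r k <= 1 by rewrite gerBl ltW.
have ec : e k @[k --> \oo] --> 0.
  by have := @cvg_harmonic R; rewrite -(cvg_shiftS (@harmonic R : nat -> R^o)).
have rn k : 1 - r k ^+ n <= n%:R * e k.
  rewrite -[X in X - _](expr1n _ n) subrXX mulrC ler_pM ?subr_ge0//.
    by rewrite sumr_ge0// => i _; rewrite expr1n mul1r exprn_ge0// ltW.
    rewrite -[X in X%:R](card_ord n) -sumr_const ler_sum// => i _.
    by rewrite expr1n mul1r exprn_ile1// ltW.
  by rewrite opprB addrC subrK.
have rX k : 0 <= r k ^+ n <= 1 by rewrite exprn_ge0 ?exprn_ile1// ltW.
(* [g k x] is the difference quotient at t = 1 of the function t^n psi(t x), whose derivative there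
   is the integrand of the statement. The factor t^n is the Jacobian of the scaling, so that the
   integral of [g k] becomes an integral over a thin layer. *)
pose g k (x : vec) := (e k)^-1 * (psi x - r k ^+ n * psi (r k *: x)).
have mscale k : measurable_fun setT (fun x : vec => r k *: x).
  have := measurable_affine (r k)%:M (0 : vec); congr measurable_fun.
  by apply/funext => x; rewrite add0r mul_mx_scalar.
have mpsir k : measurable_fun setT (fun x : vec => psi (r k *: x)).
  exact: measurableT_comp.
have mg k : measurable_fun D (g k).
  apply: measurable_funTS; apply: measurable_funM => //; apply: measurable_funB => //.
  exact: measurable_funM.
have g_cvg x : D x -> g k x @[k --> \oo] --> n%:R * psi x + 'D_x psi x.
  move=> Dx.
  have hd : is_derive (1 : R) 1 (fun t : R => t ^+ n * psi (t *: x))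
      (n%:R * psi x + 'D_x psi x).
    have hX : is_derive (1 : R) 1 (fun t : R => t ^+ n) n%:R.
      split; first exact: exprn_derivable.
      by rewrite exp_derive expr1n scaler1 [_ *: 1]mulr1.
    have := is_deriveM hX (ray_derive (dpsi (1 *: x))).
    rewrite (_ : (GRing.exp (R:=R))^~ n * _ = fun t : R => t ^+ n * psi (t *: x))//.
    move=> /is_derive_eq; apply; rewrite !scale1r expr1n scale1r addrC.
    by congr (_ + _); rewrite [_ *: _]mulrC.
  have := derive_cvg_seq hd (u := fun k => - e k).
  move=> /(_ (fun k => ltac:(by rewrite oppr_eq0 gt_eqF)))/(_ _)H.
  have {}H := H (ltac:(by rewrite -oppr0; apply: cvgN)).
  apply: cvg_trans H; apply: near_eq_cvg; near=> k.
  rewrite /g /r expr1n scale1r mul1r invrN [- e k + 1]addrC mulNr -mulrN opprB//.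
have gB k x : D x -> `|g k x| <= n%:R * B + C.
  move=> Dx.
  have E : psi x - r k ^+ n * psi (r k *: x) =
     (1 - r k ^+ n) * psi x + r k ^+ n * (psi x - psi (r k *: x)) by ring.
  rewrite /g E normrM ger0_norm ?invr_ge0 ?(ltW (e0 k))// ler_pdivrMl//.
  apply: le_trans (ler_normD _ _) _.
  have /andP[h1 h2] := rX k.
  have h3 : `|psi x - psi (r k *: x)| <= C * e k.
    have := ray_lipschitz dpsi hC Dx (s := r k); rewrite (ltW (r0 k)) r1.
    by move=> /(_ isT); rewrite opprB [1 + _]addrC subrK.
  rewrite [leRHS]mulrDr; apply: lerD.
    rewrite normrM ger0_norm ?subr_ge0// mulrA [e k * _]mulrC.
    by rewrite ler_pM ?subr_ge0 ?hB.
  by rewrite normrM ger0_norm// -[leRHS]mul1r ler_pM// [e k * C]mulrC.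
have intpsi A : measurable A -> A `<=` D -> leb.-integrable A (EFin \o psi).
  move=> mA AD; apply: (@bounded_integrable _ _ _ _ _ _ B) => //.
  - by apply: le_lt_trans Dfin; apply: le_measure; rewrite ?inE.
  - exact: measurable_funTS.
  - by move=> x /AD; exact: hB.
have intpsir k : leb.-integrable D (EFin \o (fun x : vec => psi (r k *: x))).
  apply: (@bounded_integrable _ _ _ _ _ _ B) => //; first exact: measurable_funTS.
  by move=> x Dx; apply: hB; apply: ref_simplex_scale => //; rewrite (ltW (r0 k)) r1.
pose Dr k := [set x : vec | D ((r k)^-1 *: x)].
have mDr k : measurable (Dr k).
  rewrite -[X in measurable X]setTI.
  have := measurable_affine ((r k)^-1)%:M (0 : vec) measurableT mD.
  congr measurable; apply/seteqP; split=> x [_ h]; split=> //; move: h;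
  by rewrite /Dr/preimage/= add0r mul_mx_scalar.
have DrD k : Dr k `<=` D.
  move=> x h; have -> : x = r k *: ((r k)^-1 *: x).
    by rewrite scalerA divff ?scale1r// gt_eqF.
  by apply: ref_simplex_scale => //; rewrite (ltW (r0 k)) r1.
have preDr k : (fun x : vec => r k *: x) @^-1` Dr k = D.
  by apply/funext => x; rewrite /preimage/Dr/= scalerA mulVf ?scale1r// gt_eqF.
have Ig k : \int[leb]_(x in D) g k x = (e k)^-1 * \int[leb]_(x in D `\` Dr k) psi x.
  rewrite RintegralZl//; last first.
    by apply: integrableBR => //; [exact: intpsi|exact: integrableZR].
  congr (_ * _); rewrite RintegralB//; [|exact: intpsi|exact: integrableZR].
  rewrite RintegralZl//.
  have := Rintegral_scale (r0 k) (mDr k) (intpsi _ (mDr k) (DrD k)).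
  rewrite preDr => <-.
  have DE : D = (D `\` Dr k) `|` Dr k by rewrite setUC setDUK.
  rewrite [in X in X - _ = _]DE Rintegral_setU//.
  - by rewrite addrK.
  - exact: measurableD.
  - by rewrite -DE; exact: intpsi.
  - by rewrite disj_set2E setDE -setIA setICl setI0.
have lebDr k : (leb (D `\` Dr k) <= (n%:R * e k * fine (leb D))%:E)%E.
  have -> : (leb (D `\` Dr k) = leb D - leb (Dr k))%E.
    by rewrite measureD// setIidr//; exact: DrD.
  rewrite -(lebesgue_rV_scale (r0 k) (mDr k)) preDr.
  have /andP[h1 h2] := rX k.
  have Dfn : leb D \is a fin_num by rewrite ge0_fin_numE ?measure_ge0.
  rewrite -(fineK Dfn) -EFinM -EFinB lee_fin /=.
  rewrite -[X in X - _]mul1r -mulrBl ler_wpM2r ?fine_ge0//.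
(* In the layer the coordinate sum s exceeds [r k]. The point x / s lies on the face where psi
   vanishes, and x is at relative distance 1 - s < [e k] from it along the ray. *)
have psiDr k x : (D `\` Dr k) x -> `|psi x| <= C * e k.
  move=> [Dx nDr]; have [x0 x1] := Dx.
  set s := \sum_i x ord0 i in x1.
  have sr : r k < s.
    rewrite ltNge; apply/negP => sr; apply: nDr; split=> [i|].
      by rewrite mxE mulr_ge0// invr_ge0 ltW.
    rewrite (eq_bigr (fun i => (r k)^-1 * x ord0 i)) => [|i _]; last by rewrite mxE.
    by rewrite -mulr_sumr ler_pdivrMl// mulr1.
  have s0 : 0 < s by exact: lt_trans sr.
  pose y := s^-1 *: x.
  have sy : \sum_i y ord0 i = 1.
    rewrite (eq_bigr (fun i => s^-1 * x ord0 i)) => [|i _]; last by rewrite mxE.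
    by rewrite -mulr_sumr mulVf// gt_eqF.
  have Dy : D y.
    split; last by rewrite sy.
    by move=> i; rewrite mxE mulr_ge0// invr_ge0 ltW.
  have -> : x = s *: y by rewrite scalerA divff ?scale1r// gt_eqF.
  have := ray_lipschitz dpsi hC Dy (s := s); rewrite (ltW s0) x1 => /(_ isT).
  rewrite psi0// sub0r normrN => /le_trans; apply; apply: ler_wpM2l => //.
  by rewrite lerBlDr -lerBlDl ltW.
(* The prefactor 1 / e meets two factors of order e, the size of psi on the layer and the volume of
   the layer, so one power of e survives. *)
have Ig_bound k : `|\int[leb]_(x in D) g k x| <= C * n%:R * fine (leb D) * e k.
  rewrite Ig normrM ger0_norm ?invr_ge0 ?(ltW (e0 k))// ler_pdivrMl//.
  have mDD : measurable (D `\` Dr k) by exact: measurableD.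
  have intDD : leb.-integrable (D `\` Dr k) (EFin \o psi) by apply: intpsi => // x [].
  apply: le_trans (le_normr_Rintegral mDD intDD) _.
  have finDD : (leb (D `\` Dr k) < +oo)%E by apply: le_lt_trans (lebDr k) _; rewrite ltry.
  apply: le_trans (le_Rintegral (f2 := cst (C * e k)) mDD _ _ _) _.
  - exact: integrable_norm.
  - by apply: (@bounded_integrable _ _ _ _ _ _ `|C * e k|).
  - exact: psiDr.
  rewrite Rintegral_cst//.
  have : fine (leb (D `\` Dr k)) <= n%:R * e k * fine (leb D).
    rewrite -lee_fin fineK ?lebDr//.
    by rewrite ge0_fin_numE ?measure_ge0.
  move=> /(ler_wpM2l (mulr_ge0 C0 (ltW (e0 k))))/le_trans; apply.
  by rewrite le_eqVlt; apply/orP; left; apply/eqP; ring.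
have Igc : (\int[leb]_(x in D) g k x) @[k --> \oo] -->
    \int[leb]_(x in D) (n%:R * psi x + 'D_x psi x).
  apply: (@Rintegral_dominated_cvg _ _ _ _ D g _ (cst (n%:R * B + C))) => //.
  exact: (@bounded_integrable _ _ _ _ _ _ `|n%:R * B + C|).
have Ig0 : (\int[leb]_(x in D) g k x) @[k --> \oo] --> 0.
  apply/norm_cvg0P; apply: (@squeeze_cvgr _ _ _ _ (fun=> 0)
    (fun k => C * n%:R * fine (leb D) * e k)).
  - by near=> k; rewrite normr_ge0 Ig_bound.
  - exact: cvg_cst.
  - rewrite -[X in _ --> X](mulr0 (C * n%:R * fine (leb D))).
    by apply: cvgM => //; exact: cvg_cst.
exact: (cvg_unique _ Igc Ig0).
Unshelve. all: by end_near. Qed.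

End C1facts.

(** * Simplices and meshes *)

Section affine_functions.
Context {R : realType} {m : nat}.
Local Notation vec := 'rV[R]_m.
Local Notation leb := (lebesgue_rV m : {measure set vec -> \bar R}).

Definition affine_fun (f : vec -> R) :=
  exists (a : vec) (b : R), forall x, f x = dot a x + b.

Lemma dotDl (u v w : vec) : dot (u + v) w = dot u w + dot v w.
Proof. by rewrite /dot -big_split; apply: eq_bigr => i _; rewrite mxE mulrDl. Qed.

Lemma dotDr (u v w : vec) : dot w (u + v) = dot w u + dot w v.
Proof. by rewrite /dot -big_split; apply: eq_bigr => i _; rewrite mxE mulrDr. Qed.

Lemma dotZl k (u v : vec) : dot (k *: u) v = k * dot u v.
Proof. by rewrite /dot mulr_sumr; apply: eq_bigr => i _; rewrite mxE mulrA. Qed.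

Lemma dotZr k (u v : vec) : dot u (k *: v) = k * dot u v.
Proof. by rewrite /dot mulr_sumr; apply: eq_bigr => i _; rewrite mxE mulrCA. Qed.

Lemma dot0l (v : vec) : dot 0 v = 0.
Proof. by rewrite -(scale0r 0) dotZl mul0r. Qed.

Lemma dot0r (v : vec) : dot v 0 = 0.
Proof. by rewrite -(scale0r 0) dotZr mul0r. Qed.

Lemma dotNl (u v : vec) : dot (- u) v = - dot u v.
Proof. by rewrite -scaleN1r dotZl mulN1r. Qed.

Lemma dotNr (u v : vec) : dot u (- v) = - dot u v.
Proof. by rewrite -scaleN1r dotZr mulN1r. Qed.

Lemma dotC (u v : vec) : dot u v = dot v u.
Proof. by apply: eq_bigr => i _; rewrite mulrC. Qed.

Lemma dot_delta (i : 'I_m) (v : vec) : dot (delta_mx ord0 i) v = v ord0 i.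
Proof.
rewrite /dot (bigD1 i)//= mxE !eqxx mul1r big1 ?addr0// => j ji.
by rewrite mxE (negbTE ji) mul0r.
Qed.

Lemma dot_ge0 (u : vec) : 0 <= dot u u.
Proof. by rewrite sumr_ge0// => i _; rewrite -expr2 sqr_ge0. Qed.

Lemma dot_eq0 (u : vec) : dot u u = 0 -> u = 0.
Proof.
move=> /eqP; rewrite psumr_eq0 => [/allP h|i _]; last by rewrite -expr2 sqr_ge0.
apply/rowP => i; rewrite mxE.
by have := h i (mem_index_enum i); rewrite mulf_eq0 orbb => /eqP.
Qed.

Lemma affine_fun_cst (c : R) : affine_fun (fun=> c).
Proof. by exists 0, c => x; rewrite dot0l add0r. Qed.

Lemma affine_funD (f g : vec -> R) : affine_fun f -> affine_fun g ->
  affine_fun (fun x => f x + g x).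
Proof.
move=> [a [b fE]] [c [e gE]]; exists (a + c), (b + e) => x.
by rewrite fE gE dotDl addrACA.
Qed.

Lemma affine_funZ (k : R) (f : vec -> R) : affine_fun f ->
  affine_fun (fun x => k * f x).
Proof.
by move=> [a [b fE]]; exists (k *: a), (k * b) => x; rewrite fE dotZl mulrDr.
Qed.

Lemma affine_funB (f g : vec -> R) : affine_fun f -> affine_fun g ->
  affine_fun (fun x => f x - g x).
Proof.
move=> hf /(affine_funZ (-1)) hg.
by have [a [b h]] := affine_funD hf hg; exists a, b => x; rewrite -h mulN1r.
Qed.

Lemma affine_fun_sum (I : Type) (s : seq I) (f : I -> vec -> R) :
  (forall i, affine_fun (f i)) -> affine_fun (fun x => \sum_(i <- s) f i x).
Proof.
move=> hf; elim: s => [|i s IH].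
  by have [a [b h]] := affine_fun_cst 0; exists a, b => x; rewrite big_nil.
by have [a [b h]] := affine_funD (hf i) IH; exists a, b => x; rewrite big_cons h.
Qed.

Lemma affine_fun_mulmx k (M : 'M[R]_(m, k)) (p : vec) (j : 'I_k) :
  affine_fun (fun x => ((x - p) *m M) ord0 j).
Proof.
exists (\row_i M i j), (- dot (\row_i M i j) p) => x.
rewrite -dotNr -dotDr mxE /dot; apply: eq_bigr => i _.
by rewrite [in RHS]mxE mulrC.
Qed.

Lemma affine_fun_differentiable (f : vec -> R) : affine_fun f ->
  forall x, differentiable f x.
Proof.
move=> [a [b fE]] x.
have -> : f = (\sum_i a ord0 i *: (fun y : vec => y ord0 i)) + cst b.
  by apply/funext => y; rewrite fE !fctE fct_sumE.
apply: differentiableD; last exact: differentiable_cst.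
by apply: differentiable_sum => i; apply: differentiableZ; exact: differentiable_coord.
Qed.

Lemma affine_fun_derive (f : vec -> R) : affine_fun f ->
  exists a : vec, forall x v, 'D_v f x = dot a v.
Proof.
move=> [a [b fE]]; exists a => x v; rewrite /derive.
apply: cvg_lim => //.
apply: (@cvg_trans _ (cst (dot a v) @ 0^')); last exact: cvg_cst.
apply: near_eq_cvg; near=> h.
have h0 : h != 0 by near: h; exact: nbhs_dnbhs_neq.
rewrite /cst /= !fE dotDr dotZr opprD addrACA subrr addr0 addrK.
by rewrite /GRing.scale/= mulKf.
Unshelve. all: by end_near. Qed.

Lemma affine_fun_continuous (f : vec -> R) : affine_fun f -> continuous f.
Proof.
by move=> hf x; apply: differentiable_continuous; exact: affine_fun_differentiable.
Qed.

Lemma affine_fun_segment (f : vec -> R) (x y : vec) (t : R) : affine_fun f ->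
  f (x + t *: (y - x)) = f x + t * (f y - f x).
Proof.
by move=> [a [b fE]]; rewrite !fE dotDr dotZr dotDr dotNr; ring.
Qed.

Lemma affine_fun_null (f : vec -> R) (c : R) (y z : vec) : affine_fun f ->
  f y != f z -> leb [set x | f x = c] = 0%E.
Proof.
move=> [a [b fE]] yz.
rewrite (_ : [set x | f x = c] = [set x | dot a x = c - b]); last first.
  by apply/seteqP; split=> x /=; rewrite fE => h; [rewrite -h addrK|rewrite h subrK].
apply: hyperplane_null; apply: contraNneq yz => a0.
by rewrite !fE a0 !dot0l.
Qed.

Lemma affine_fun_level_closed (f : vec -> R) (c : R) : affine_fun f ->
  closed [set x | f x = c].
Proof.
move=> hf; apply: (@closed_comp _ _ f [set y | y = c]); last exact: closed_eq.
by move=> x _; exact: affine_fun_continuous.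
Qed.

Lemma affine_fun_negligible (f : vec -> R) (c : R) (y z : vec) : affine_fun f ->
  f y != f z -> leb.-negligible [set x | f x = c].
Proof.
move=> hf yz; apply/negligibleP; last exact: affine_fun_null yz.
by apply: closed_measurable_rV; exact: affine_fun_level_closed.
Qed.

Lemma measurable_affine_fun (f : vec -> R) : affine_fun f -> measurable_fun setT f.
Proof. by move=> /affine_fun_continuous; exact: continuous_measurable_rV. Qed.

End affine_functions.

Section barycentric.
Context {R : realType} {n : nat}.
Local Notation vec := 'rV[R]_n.+1.
Local Notation leb := (lebesgue_rV n.+1 : {measure set vec -> \bar R}).
Implicit Types (p : 'I_n.+2 -> vec) (l : 'I_n.+2 -> R).

(** The base vertex is a parameter because the flux computation takes the vertex opposite to the
    shared facet as origin. *)
Definition edges p (i : 'I_n.+2) : 'M[R]_n.+1 :=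
  \matrix_(j < n.+1) (p (lift i j) - p i).

Lemma comb_edges p i l : \sum_k l k = 1 ->
  \sum_k l k *: p k = p i + (\row_j l (lift i j)) *m edges p i.
Proof.
move=> l1.
have -> : \sum_k l k *: p k = \sum_k l k *: (p k - p i) + p i.
  have E : \sum_k l k *: p i = p i by rewrite -scaler_suml l1 scale1r.
  apply/eqP; rewrite -subr_eq -{1}E -sumrB; apply/eqP.
  by apply: eq_bigr => k _; rewrite scalerBr.
rewrite addrC; congr (_ + _); rewrite (bigD1_ord i)//= subrr scaler0 add0r.
by rewrite mulmx_sum_row; apply: eq_bigr => j _; rewrite mxE rowK.
Qed.

Lemma affinely_independentP p l : affinely_independent p ->
  \sum_k l k = 0 -> \sum_k l k *: p k = 0 -> forall k, l k = 0.
Proof.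
move=> ai l0 lp.
(* Adding 1 to the weight of the base vertex turns a relation of total weight 0 into an affine
   combination, to which [comb_edges] applies. *)
have l1 : \sum_k (if k == ord0 then l k + 1 else l k) = 1.
  rewrite (bigD1_ord ord0)//= addrAC.
  by move: l0; rewrite (bigD1_ord ord0)//= => ->; rewrite add0r.
have := comb_edges p ord0 l1.
have -> : \sum_k (if k == ord0 then l k + 1 else l k) *: p k = p ord0.
  transitivity (p ord0 + \sum_k l k *: p k); last by rewrite lp addr0.
  rewrite (bigD1_ord ord0)//= [in RHS](bigD1_ord ord0)//= addrA; congr (_ + _).
    by rewrite scalerDl scale1r addrC.
rewrite -{1}[p ord0]addr0 => /addrI/esym h.
have /row_freeP[B hB] : row_free (edges p ord0) by exact: ai.
have lj j : l (lift ord0 j) = 0.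
  have := congr1 (mulmx^~ B) h; rewrite -mulmxA hB mulmx1 mul0mx.
  by move=> /rowP/(_ j); rewrite !mxE eq_sym (negbTE (neq_lift _ _)).
move=> k; have [j ->|->] := unliftP ord0 k; first exact: lj.
by move: l0; rewrite (bigD1_ord ord0)//= big1 ?addr0.
Qed.

(** [affinely_independent] is stated with base vertex [ord0]. A row vector in the kernel for base
    [i] gives a second representation of [p i] as an affine combination, and weights are unique. *)
Lemma edges_unit p i : affinely_independent p -> edges p i \in unitmx.
Proof.
move=> ai; rewrite -row_free_unit; apply/inj_row_free => v v0.
pose l k := if unlift i k is Some j then v ord0 j else 1 - \sum_j v ord0 j.
have ll j : l (lift i j) = v ord0 j by rewrite /l liftK.
have li : l i = 1 - \sum_j v ord0 j by rewrite /l unlift_none.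
have l1 : \sum_k l k = 1.
  by rewrite (bigD1_ord i)//= li (eq_bigr _ (fun j _ => ll j)) subrK.
have := comb_edges p i l1.
rewrite (_ : \row_j l (lift i j) = v); last by apply/rowP => j; rewrite mxE ll.
rewrite v0 addr0 => lp.
apply/rowP => j; rewrite mxE -ll.
have := @affinely_independentP p (fun k => l k - (k == i)%:R) ai.
rewrite sumrB l1 (bigD1 i)//= eqxx big1 ?addr0 ?subrr => [|k /negbTE ->//].
move=> /(_ erefl) H; have {}H := H _ (lift i j).
rewrite eq_sym (negbTE (neq_lift _ _)) subr0 in H; apply: H.
rewrite (eq_bigr (fun k => l k *: p k - (k == i)%:R *: p k)) => [|k _]; last first.
  by rewrite scalerBl.
rewrite sumrB lp (bigD1 i)//= eqxx scale1r big1 ?addr0 ?subrr// => k /negbTE ->.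
by rewrite scale0r.
Qed.

Definition bary p (x : vec) (i : 'I_n.+2) : R :=
  let mu := (x - p ord0) *m invmx (edges p ord0) in
  if unlift ord0 i is Some j then mu ord0 j else 1 - \sum_j mu ord0 j.

Lemma bary_sum p x : \sum_i bary p x i = 1.
Proof.
rewrite (bigD1_ord ord0)//= {1}/bary unlift_none.
have E j : bary p x (lift ord0 j) =
    ((x - p ord0) *m invmx (edges p ord0)) ord0 j by rewrite /bary liftK.
by rewrite (eq_bigr _ (fun j _ => E j)) subrK.
Qed.

Lemma bary_comb p x : affinely_independent p -> \sum_i bary p x i *: p i = x.
Proof.
move=> ai; rewrite (comb_edges p ord0 (bary_sum p x)).
have -> : \row_j bary p x (lift ord0 j) = (x - p ord0) *m invmx (edges p ord0).
  by apply/rowP => j; rewrite mxE /bary liftK.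
by rewrite mulmxKV ?edges_unit// addrC subrK.
Qed.

Lemma bary_unique p x l : affinely_independent p -> \sum_i l i = 1 ->
  \sum_i l i *: p i = x -> forall i, bary p x i = l i.
Proof.
move=> ai l1 lx i; apply/eqP; rewrite -subr_eq0; apply/eqP.
apply: (@affinely_independentP p (fun k => bary p x k - l k) ai).
  by rewrite sumrB bary_sum l1 subrr.
rewrite (eq_bigr (fun k => bary p x k *: p k - l k *: p k)) => [|k _].
  by rewrite sumrB bary_comb// lx subrr.
by rewrite scalerBl.
Qed.

Lemma bary_vertex p i k : affinely_independent p -> bary p (p k) i = (i == k)%:R.
Proof.
move=> ai; apply: (@bary_unique p (p k) (fun i => (i == k)%:R)) => //.
  by rewrite (bigD1 k)//= eqxx big1 ?addr0// => j /negbTE ->.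
by rewrite (bigD1 k)//= eqxx scale1r big1 ?addr0// => j /negbTE ->; rewrite scale0r.
Qed.

Lemma bary_affine p i : affine_fun (fun x => bary p x i).
Proof.
rewrite /bary; case: unliftP => [j _|_]; first exact: affine_fun_mulmx.
apply: affine_funB; first exact: affine_fun_cst.
by apply: affine_fun_sum => j; exact: affine_fun_mulmx.
Qed.

Lemma subsimplexP p (S : {set 'I_n.+2}) x : affinely_independent p ->
  subsimplex p S x <->
  (forall i, 0 <= bary p x i) /\ (forall i, i \notin S -> bary p x i = 0).
Proof.
move=> ai; split=> [[l [l0 lS l1 lx]]|[h0 hS]].
  have E := bary_unique ai l1 (esym lx).
  by split=> i; rewrite E//; exact: lS.
by exists (bary p x); split=> //; [exact: bary_sum|rewrite bary_comb].
Qed.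

Lemma simplexP p x : affinely_independent p ->
  subsimplex p [set: 'I_n.+2] x <-> (forall i, 0 <= bary p x i).
Proof.
move=> ai; rewrite subsimplexP//; split=> [[]//|h]; split=> // i.
by rewrite finset.inE.
Qed.

Lemma simplex_param p i :
  subsimplex p [set: 'I_n.+2] = (fun x => p i + x *m edges p i) @` ref_simplex.
Proof.
apply/seteqP; split=> [x [l [l0 _ l1 ->]]|_ [x [x0 x1] <-]].
  exists (\row_j l (lift i j)); last by rewrite (comb_edges p i l1).
  split=> [j|]; first by rewrite mxE.
  rewrite (eq_bigr (fun j => l (lift i j))) => [|j _]; last by rewrite mxE.
  by rewrite -l1 [in leRHS](bigD1_ord i)//= lerDr.
pose l k := if unlift i k is Some j then x ord0 j else 1 - \sum_j x ord0 j.
have ll j : l (lift i j) = x ord0 j by rewrite /l liftK.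
have li : l i = 1 - \sum_j x ord0 j by rewrite /l unlift_none.
have l1 : \sum_k l k = 1.
  by rewrite (bigD1_ord i)//= li (eq_bigr _ (fun j _ => ll j)) subrK.
exists l; split=> //.
- move=> k; rewrite /l; case: unliftP => // _.
  by rewrite subr_ge0.
- by move=> k; rewrite finset.inE.
- rewrite (comb_edges p i l1); congr (_ + _ *m _).
  by apply/rowP => j; rewrite mxE ll.
Qed.

Lemma simplex_compact p : compact (subsimplex p [set: 'I_n.+2]).
Proof.
rewrite (simplex_param p ord0); apply: continuous_compact; last exact: ref_simplex_compact.
exact/continuous_subspaceT/continuous_affine.
Qed.

Lemma simplex_closed p : closed (subsimplex p [set: 'I_n.+2]).
Proof. by apply: compact_closed; [exact: norm_hausdorff|exact: simplex_compact]. Qed.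

Lemma measurable_simplex p : measurable (subsimplex p [set: 'I_n.+2]).
Proof. by apply: closed_measurable_rV; exact: simplex_closed. Qed.

Definition open_simplex p : set vec := [set x | forall i, 0 < bary p x i].

Lemma open_simplex_open p : open (open_simplex p).
Proof.
rewrite (_ : open_simplex p =
    \big[setI/setT]_(i < n.+2) [set x | 0 < bary p x i]).
  elim/big_ind: _ => [|X Y|i _]; [exact: openT|exact: openI|].
  apply: (@open_comp _ _ (fun x => bary p x i) [set y | 0 < y]).
    by move=> x _; exact: affine_fun_continuous (bary_affine p i) x.
  exact: open_gt.
rewrite -bigcap_seq; apply/seteqP; split=> x h i; first by move=> _; exact: h.
exact: (h i (mem_index_enum i)).
Qed.

Lemma open_simplex_sub p : affinely_independent p ->
  open_simplex p `<=` subsimplex p [set: 'I_n.+2].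
Proof. by move=> ai x h; apply/simplexP => // i; exact: ltW. Qed.

Lemma open_simplex_neq0 p : affinely_independent p -> open_simplex p !=set0.
Proof.
move=> ai; exists (\sum_i n.+2%:R^-1 *: p i) => i.
rewrite (@bary_unique p _ (fun=> n.+2%:R^-1))// ?invr_gt0//.
by rewrite sumr_const card_ord -[LHS]mulr_natl mulfV.
Qed.

Lemma bary_negligible p i (c : R) : affinely_independent p ->
  leb.-negligible [set x | bary p x i = c].
Proof.
move=> ai; apply: (affine_fun_negligible c (y := p i) (z := p (lift i ord0)) (bary_affine p i)).
by rewrite !bary_vertex// eqxx (negbTE (neq_lift _ _)) oner_eq0.
Qed.

(** Outside the open simplex some barycentric coordinate vanishes, so the boundary lies in finitely
    many null hyperplanes. *)
Lemma simplex_boundary_negligible p : affinely_independent p ->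
  leb.-negligible (subsimplex p [set: 'I_n.+2] `\` open_simplex p).
Proof.
move=> ai.
apply: (@negligibleS _ _ _ _ (\big[setU/set0]_(i < n.+2) [set x | bary p x i = 0])).
  move=> x [/simplexP h nx]; have {}h := h ai.
  have [i hi] : exists i, bary p x i <= 0.
    by apply/not_existsP => hi; apply: nx => i; rewrite ltNge; apply/negP; exact: hi.
  rewrite -bigcup_seq; exists i; first exact: mem_index_enum.
  by apply/eqP; rewrite eq_le hi h.
elim/big_ind: _ => [|X Y|i _].
- exact: negligible_set0.
- exact: negligibleU.
- exact: bary_negligible.
Qed.

End barycentric.

Section ae_tools.
Context d {T : measurableType d} {R : realType} (mu : {measure set T -> \bar R}).

Lemma ae_eq_Rintegral (D : set T) (f g : T -> R) : measurable D ->
  measurable_fun D f -> measurable_fun D g ->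
  (\forall x \ae mu, D x -> f x = g x) ->
  \int[mu]_(x in D) f x = \int[mu]_(x in D) g x.
Proof.
move=> mD mf mg fg; rewrite /Rintegral.
congr fine; apply: ae_eq_integral => //; [exact/measurable_EFinP..|].
by apply: filterS fg => x h Dx /=; rewrite h.
Qed.

Lemma ae_not_mem (N : set T) : mu.-negligible N -> \forall x \ae mu, ~ N x.
Proof. by move=> hN; apply: negligibleS hN => x /= /contrapT. Qed.

(* Membership in finitely many measurable sets takes finitely many values, on
   each of which [pick] is constant. *)
Lemma measurable_pick (I : finType) (P : I -> set T) (f : option I -> T -> R) :
  (forall i, measurable (P i)) -> (forall o, measurable_fun setT (f o)) ->
  measurable_fun setT (fun x => f [pick i | `[< P i x >]] x).
Proof.
move=> mP mf _ B mB; rewrite setTI.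
pose C (b : {ffun I -> bool}) :=
  (\bigcap_i [set x | `[< P i x >] = b i]) `&` (f [pick i | b i] @^-1` B).
rewrite (_ : _ @^-1` B = \bigcup_b C b).
  apply: countable_bigcupT_measurable; first exact: countableP.
  move=> b; apply: measurableI; last by rewrite -[X in measurable X]setTI; exact: mf.
  apply: fin_bigcap_measurable; first exact: finite_finset.
  move=> i _; case: (b i).
    by rewrite (_ : [set x | _] = P i)//; apply/seteqP; split=> x /=; [move/asboolP|move=> h; apply/asboolP].
  rewrite (_ : [set x | _] = ~` P i); first exact: measurableC.
  by apply/seteqP; split=> x /=; [move/negbT/asboolPn|move=> h; apply/negbTE/asboolPn].
apply/seteqP; split=> [x /= Bx|x [b _ [hb]]] /=.
  exists [ffun i => `[< P i x >]] => //; split=> [i _|] /=; first by rewrite ffunE.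
  by rewrite (eq_pick (Q := fun i => `[< P i x >])) => [|i]; rewrite ?ffunE.
by rewrite (eq_pick (Q := fun i => b i))// => i; exact: hb.
Qed.

End ae_tools.

(** * Cells of a mesh inside a Lipschitz domain *)

Section domain.
Context {R : realType} {n : nat}.
Local Notation vec := 'rV[R]_n.+1.
Local Notation leb := (lebesgue_rV n.+1 : {measure set vec -> \bar R}).
Variables (Omega : set vec).
Hypothesis hO : polytopal_lipschitz_domain Omega.

(* At a boundary point [x] outside [Omega], the points [x - s *: e] below the
   graph are not in the closure. *)
Lemma open_sub_closure (U : set vec) : open U -> U `<=` closure Omega -> U `<=` Omega.
Proof.
have [_ [_ hL _]] := hO.
move=> oU UO x Ux; apply: contrapT => nOx.
have [e [gam [e1 gL hn]]] := hL x (UO x Ux) nOx.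
have dee : dot e e = 1.
  by rewrite -(sqr_sqrtr (dot_ge0 e)) -/(enorm e) e1 expr1n.
have cg : continuous gam.
  have [M [Mr hM]] := gL.
  pose K := `|M| + 1; have K0 : 0 < K by rewrite ltr_wpDl.
  have {}hM y z : `|gam y - gam z| <= K * `|y - z|.
    apply: (hM K _ (y, z)) => //.
    by rewrite /K (le_lt_trans (ler_norm M))// ltrDl.
  move=> y V /nbhs_ballP[eps /= eps0 epsV]; apply/nbhs_ballP.
  exists (eps / K); first by rewrite /= divr_gt0.
  move=> z; rewrite -ball_normE /ball_/= => yz; apply: epsV.
  rewrite -ball_normE /ball_/=; apply: le_lt_trans (hM y z) _.
  by rewrite mulrC -ltr_pdivlMr.
pose proj (y : vec) := y - dot y e *: e.
have adot : affine_fun (fun y : vec => dot y e).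
  by exists e, 0 => y; rewrite addr0 dotC.
have cproj : continuous proj.
  have -> : proj = (fun y => 0 + y *m (1%:M - e^T *m e)).
    apply/funext => y; rewrite add0r mulmxBr mulmx1 mulmxA.
    rewrite (mx11_scalar (y *m e^T)) mul_scalar_mx /proj; congr (_ - _ *: _).
    by rewrite mxE; apply: eq_bigr => i _; rewrite mxE.
  exact: continuous_affine.
pose h y := gam (proj y) - dot y e.
have ch : continuous h.
  have cdot := affine_fun_continuous adot.
  have cgp : continuous (gam \o proj).
    by move=> y; apply: (@continuous_comp _ _ _ proj gam); [exact: cproj|exact: cg].
  by move=> y; apply: (@cvgB _ R^o _ _ _ (gam \o proj) (fun y => dot y e) _ _ (cgp y) (cdot y)).
have [V [oV Vx] hV] : exists2 V : set vec, open V /\ V x & forall y, V y ->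
    U y /\ (Omega y <-> gam (y - dot y e *: e) < dot y e).
  have : \forall y \near x, U y /\ (Omega y <-> gam (y - dot y e *: e) < dot y e).
    near=> y; split; near: y; last exact: hn.
    exact: open_nbhs_nbhs.
  by rewrite /prop_near1 nbhsE => -[V [oV Vx] hV]; exists V.
have /nbhs_ballP[r /= r0 rV] := open_nbhs_nbhs (conj oV Vx).
have hx : 0 <= h x.
  have [_ Px] := hV x Vx.
  by rewrite /h subr_ge0 leNgt; apply/negP => /Px.
pose s := r / (2 * (`|e| + 1)).
have e0 : 0 < `|e| + 1 by rewrite ltr_wpDl.
have s0 : 0 < s by rewrite divr_gt0// mulr_gt0.
pose y := x - s *: e.
have Vy : V y.
  apply: rV.
  rewrite -ball_normE /ball_/= /y opprD addNKr opprK normrZ gtr0_norm//.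
  rewrite /s mulrAC ltr_pdivrMr ?mulr_gt0// ltr_pM2l//.
  have := normr_ge0 e; lra.
have hy : 0 < h y.
  (* Since [e] is a unit vector, moving along [e] leaves the projection unchanged and lowers the
     height by exactly s. *)
  have -> : h y = h x + s.
    have dy : dot y e = dot x e - s by rewrite /y dotDl dotNl dotZl dee mulr1.
    rewrite /h /proj dy /y scalerBl opprB addrA -[x - _ + _]addrA [- _ + _]addrC.
    by rewrite subrr addr0; ring.
  by rewrite ltr_wpDl.
have [Uy _] := hV y Vy.
(* Being strictly below the graph is an open condition, so a whole neighbourhood of y misses
   [Omega], although y is in U and hence in the closure. *)
have /(_ (V `&` [set z | 0 < h z])) := UO y Uy.
case.
  apply: filterI; first exact: (open_nbhs_nbhs (conj oV Vy)).
  apply: open_nbhs_nbhs; split=> //.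
  by apply: (@open_comp _ _ h [set z | 0 < z]); [move=> z _; exact: ch|exact: open_gt].
move=> z [Oz [Vz hz]].
have [_ [/(_ Oz)]] := hV z Vz.
by rewrite -subr_lt0 => /(lt_trans hz); rewrite ltxx.
Unshelve. all: by end_near. Qed.

Lemma domain_open : open Omega. Proof. by have [[]] := hO. Qed.

Lemma domain_measurable : measurable Omega.
Proof. by apply: open_measurable_rV; exact: domain_open. Qed.

Lemma domain_bounded : bounded_set Omega. Proof. by have [_ []] := hO. Qed.

Lemma domain_fin : (leb Omega < +oo)%E.
Proof. by apply: lebesgue_rV_bounded; [exact: domain_measurable|exact: domain_bounded]. Qed.

Lemma domain_gt0 : (0 < leb Omega)%E.
Proof. by apply: open_lebesgue_gt0; [exact: domain_open|have [[]] := hO]. Qed.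

Variable M : mesh R n.
Hypothesis hM : conforming_mesh Omega M.

Definition ocell (T : M) : set vec := open_simplex (vertex T).

Lemma vertex_ai (T : M) : affinely_independent (vertex T).
Proof. by have [] := hM. Qed.

Lemma ocell_sub (T : M) : ocell T `<=` cell T.
Proof. exact: open_simplex_sub (vertex_ai T). Qed.

Lemma cell_sub_closure (T : M) : cell T `<=` closure Omega.
Proof. by have [_ -> _] := hM; move=> x h; exists T. Qed.

Lemma ocell_domain (T : M) : ocell T `<=` Omega.
Proof.
apply: open_sub_closure; first exact: open_simplex_open.
exact: subset_trans (@ocell_sub T) (@cell_sub_closure T).
Qed.

Lemma domain_covered x : Omega x -> exists T : M, cell T x.
Proof.
move=> /subset_closure; have [_ -> _] := hM.
by move=> [T _ Tx]; exists T.
Qed.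

(** Conformity puts the intersection of distinct cells into a proper subsimplex, on which some
    barycentric coordinate of [T] vanishes. *)
Lemma ocell_cell_disjoint (T T' : M) x : ocell T x -> cell T' x -> T = T'.
Proof.
move=> Tx T'x; apply/eqP; apply/negPn/negP => TT'.
have [_ _ /(_ _ _ TT')[S [S' [pS _ E _]]]] := hM.
have : (cell T `&` cell T') x by split=> //; exact: ocell_sub.
rewrite E => /(subsimplexP _ _ (vertex_ai T))[_ h].
have /properP[_ [i _ iS]] := pS.
by have := Tx i; rewrite h ?ltxx.
Qed.

Lemma measurable_ocell (T : M) : measurable (ocell T).
Proof. by apply: open_measurable_rV; exact: open_simplex_open. Qed.

Lemma measurable_cell (T : M) : measurable (cell T).
Proof. exact: measurable_simplex. Qed.

Lemma ocell_gt0 (T : M) : (0 < leb (ocell T))%E.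
Proof.
apply: open_lebesgue_gt0; first exact: open_simplex_open.
exact: open_simplex_neq0 (vertex_ai T).
Qed.

Lemma ocell_fin (T : M) : (leb (ocell T) < +oo)%E.
Proof.
apply: le_lt_trans domain_fin; apply: le_measure; rewrite ?inE.
- exact: measurable_ocell.
- exact: domain_measurable.
- exact: ocell_domain.
Qed.

Lemma ae_ocell : \forall x \ae leb, forall T : M, cell T x -> ocell T x.
Proof.
apply: filter_forall => T.
have := ae_not_mem (simplex_boundary_negligible (vertex_ai T)).
by apply: filterS => x h Tx; apply: contrapT => nTx; apply: h.
Qed.

Lemma ae_domain : \forall x \ae leb, Omega x -> exists T : M, ocell T x.
Proof.
by apply: filterS ae_ocell => x h /domain_covered[T /h Tx]; exists T.
Qed.

Lemma integrable_ocell (T : M) (g : vec -> R) : leb.-integrable Omega (EFin \o g) ->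
  leb.-integrable (ocell T) (EFin \o g).
Proof.
move=> ig; apply: integrableS ig; [exact: domain_measurable|exact: measurable_ocell|].
exact: ocell_domain.
Qed.

(** The open cells are pairwise disjoint and cover [Omega] up to a null set; they replace the closed
    cells as the pieces of integration because they lie inside [Omega]. *)
Lemma Rintegral_domain (g : vec -> R) : leb.-integrable Omega (EFin \o g) ->
  \int[leb]_(x in Omega) g x = \sum_(T : M) \int[leb]_(x in ocell T) g x.
Proof.
move=> ig; have mO := domain_measurable.
have igT (T : M) : leb.-integrable Omega (EFin \o (g \_ (ocell T))).
  rewrite -restrict_EFin; apply/integrable_restrict => //; first exact: measurable_ocell.
  apply: integrableS ig => //; apply: measurableI => //; exact: measurable_ocell.
transitivity (\int[leb]_(x in Omega) \sum_(T : M) (g \_ (ocell T)) x).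
  apply: ae_eq_Rintegral => //.
  - by case/integrableP : ig => /measurable_EFinP.
  - have := integrable_sumR (index_enum M) mO igT.
    by case/integrableP => /measurable_EFinP.
  apply: filterS ae_domain => x h Ox; have [T Tx] := h Ox.
  rewrite (bigD1 T)//= patchE ifT ?inE// big1 ?addr0// => T' T'T.
  rewrite patchE ifF//; apply/negbTE; rewrite notin_setE => T'x.
  by move/eqP: T'T; apply; apply: ocell_cell_disjoint T'x _; exact: ocell_sub.
rewrite Rintegral_sum//; apply: eq_bigr => T _.
by rewrite -Rintegral_mkcondr setIidr//; exact: ocell_domain.
Qed.

End domain.

(** * Connectedness of the mesh through facets *)

Section connectedness.
Context {R : realType}.

(** If the two closed sets did not meet in A, the trace of U on A would be both open and closed. *)
Lemma connected_cover_meet (T : topologicalType) (A U W : set T) : connected A ->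
  closed U -> closed W -> A `<=` U `|` W -> A `&` U !=set0 -> A `&` W !=set0 ->
  exists x, [/\ A x, U x & W x].
Proof.
move=> cA cU cW AUW AU [w [Aw Ww]]; apply: contrapT => h.
have E : A `&` U = A.
  apply: cA => //; [exists (~` W)|exists U] => //; first exact: closed_openC.
  apply/seteqP; split=> x [Ax]; first by move=> Ux; split=> // Wx; apply: h; exists x.
  by move=> nWx; split=> //; case: (AUW x Ax).
by apply: h; exists w; split=> //; have := Aw; rewrite -E => -[].
Qed.

Lemma closed_bigsetU (T : topologicalType) (I : finType) (P : pred I) (F : I -> set T) :
  (forall i, closed (F i)) -> closed (\big[setU/set0]_(i | P i) F i).
Proof.
move=> cF; elim/big_ind: _ => //; [exact: closed0|exact: closedU].
Qed.

Context {n : nat}.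
Local Notation vec := 'rV[R]_n.+1.
Local Notation leb := (lebesgue_rV n.+1 : {measure set vec -> \bar R}).

(** This is how a point in general position is chosen: a nonempty open set is not null. *)
Lemma ae_open_ex (P : vec -> Prop) (G : set vec) : open G -> G !=set0 ->
  (\forall x \ae leb, P x) -> exists2 x, G x & P x.
Proof.
move=> oG G0 aeP; apply: contrapT => h.
have : leb.-negligible G.
  by apply: negligibleS aeP => x Gx /= Px; apply: h; exists x.
move=> /(negligibleP _ (open_measurable_rV oG)) G00.
by have := open_lebesgue_gt0 oG G0; rewrite G00 ltxx.
Qed.

(** A small move from x towards an interior point makes all barycentric coordinates positive. *)
Lemma simplex_closure_open (p : 'I_n.+2 -> vec) (x : vec) (V : set vec) :
  affinely_independent p -> subsimplex p [set: 'I_n.+2] x -> nbhs x V ->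
  exists2 y, open_simplex p y & V y.
Proof.
move=> ai /(simplexP _ ai) x0 xV.
have [c c0] := open_simplex_neq0 ai.
have cs : (fun t : R => x + t *: (c - x)) t @[t --> 0^'+] --> x.
  apply: cvg_at_right_filter.
  suff : x + t *: (c - x) @[t --> (0 : R)] --> x + 0 *: (c - x).
    by rewrite scale0r addr0.
  apply: (@differentiable_continuous _ _ _ 0 (fun t : R => x + t *: (c - x))).
  exact: differentiableD.
have : \forall t \near 0^'+, V (x + t *: (c - x)) by exact: cs.
move=> hV.
have [t [t0 t1 Vt]] : exists t : R, [/\ 0 < t, t < 1 & V (x + t *: (c - x))].
  near (0 : R)^'+ => t; exists t; split; near: t => //.
  - exact: nbhs_right_gt.
  - exact: nbhs_right_lt.
exists (x + t *: (c - x)) => // i.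
rewrite (affine_fun_segment _ _ _ (bary_affine p i)).
have := x0 i; have := c0 i; nra.
Unshelve. all: by end_near. Qed.

Lemma ball_segment (x y z : vec) (r t : R) : ball x r y -> ball x r z ->
  0 <= t <= 1 -> ball x r (y + t *: (z - y)).
Proof.
rewrite -ball_normE /ball_/= => xy xz /andP[t0 t1].
have -> : x - (y + t *: (z - y)) = (1 - t) *: (x - y) + t *: (x - z).
  rewrite !scalerBr !scalerBl !scale1r opprD opprB.
  by apply/rowP => k; rewrite !mxE; ring.
apply: le_lt_trans (ler_normD _ _) _; rewrite !normrZ ger0_norm ?subr_ge0//.
rewrite (ger0_norm t0); pose m := Num.max `|x - y| `|x - z|.
have h1 : 0 <= (1 - t) * (m - `|x - y|) by rewrite mulr_ge0// subr_ge0// le_max lexx.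
have h2 : 0 <= t * (m - `|x - z|) by rewrite mulr_ge0// subr_ge0// le_max lexx orbT.
by apply: (@le_lt_trans _ _ m); [nra|rewrite gt_max xy].
Qed.

End connectedness.

Section mesh_connected.
Context {R : realType} {n : nat}.
Local Notation vec := 'rV[R]_n.+1.
Local Notation leb := (lebesgue_rV n.+1 : {measure set vec -> \bar R}).
Variables (Omega : set vec) (M : mesh R n).
Hypothesis hO : polytopal_lipschitz_domain Omega.
Hypothesis hM : conforming_mesh Omega M.

Definition facet (T : M) (i : 'I_n.+2) : set vec :=
  subsimplex (vertex T) [set~ i]%SET.

Definition cells (C : M -> Prop) : set vec := \bigcup_(T in [set T | C T]) cell T.

Lemma cells_closed (C : M -> Prop) : closed (cells C).
Proof.
rewrite (_ : cells C = \big[setU/set0]_(T | `[< C T >]) cell T).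
  by apply: closed_bigsetU => T; exact: simplex_closed.
apply/seteqP; split=> [x [T /= CT Tx]|x].
  by rewrite (bigD1 T)/=; [left|exact/asboolP].
elim/big_ind: _ => [//|A B hA hB [/hA//|/hB//]|T /asboolP CT Tx].
by exists T.
Qed.

(** The condition n >= 1 provides a third vertex, where the affine function is 0; it is a or b at
    the vertices i or j, so it is not constant. The sets of this form contain the hyperplanes
    through a given point and the codimension-two face opposite to i and j. *)
Lemma bary_pair_negligible (T : M) (i j : 'I_n.+2) (a b : R) : (1 <= n)%N ->
  i != j -> (a != 0) || (b != 0) ->
  leb.-negligible [set x | a * bary (vertex T) x i + b * bary (vertex T) x j = 0].
Proof.
move=> n1 ij ab.
have hf : affine_fun (fun x => a * bary (vertex T) x i + b * bary (vertex T) x j).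
  by apply: affine_funD; apply: affine_funZ; exact: bary_affine.
have [k [ki kj]] : exists k, k != i /\ k != j.
  have : (0 < #|~: [set i; j]%SET|)%N.
    have := cardsC [set i; j]%SET; rewrite cards2 ij card_ord => h.
    by rewrite -(ltn_add2l 2) h.
  by move=> /card_gt0P[k]; rewrite !inE negb_or => /andP[]; exists k.
have ai := vertex_ai hM T.
have [a0|/negPn/eqP a0] := boolP (a != 0).
  apply: (affine_fun_negligible _ (y := vertex T i) (z := vertex T k) hf).
  rewrite !bary_vertex// eqxx (eq_sym j) (negbTE ij) (eq_sym i) (negbTE ki).
  by rewrite (eq_sym j) (negbTE kj) !mulr0 mulr1 !addr0.
move: ab; rewrite a0 eqxx /= => b0.
rewrite a0 in hf *.
apply: (affine_fun_negligible _ (y := vertex T j) (z := vertex T k) hf).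
rewrite !bary_vertex// eqxx.
by rewrite (eq_sym j) (negbTE kj) !mul0r mulr1 mulr0 !add0r.
Qed.

(* A point in the common boundary of the two classes of cells is moved, along a
   generic segment between open cells, to one off the codimension-two faces. *)
Lemma mesh_connected (C : M -> Prop) : (1 <= n)%N ->
  (forall T T' i i', C T -> T != T' ->
     cell T `&` cell T' = facet T i -> cell T `&` cell T' = facet T' i' -> C T') ->
  (exists T, C T) -> forall T, C T.
Proof.
move=> n1 hC [T0 CT0] T1; apply: contrapT => nCT1.
have cover x : Omega x -> (cells C `|` cells (fun T => ~ C T)) x.
  move=> /(domain_covered hM)[T Tx].
  by have [CT|nCT] := pselect (C T); [left|right]; exists T.
have [x [Ox [T CT Tx] [T' nCT' T'x]]] :
    exists x, [/\ Omega x, cells C x & cells (fun T => ~ C T) x].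
  apply: connected_cover_meet => //; [by have [[]] := hO|exact: cells_closed..| |].
    have [y y0] := open_simplex_neq0 (vertex_ai hM T0).
    by exists y; split; [exact: (ocell_domain hO hM y0)|exists T0 => //; exact: (ocell_sub hM)].
  have [y y0] := open_simplex_neq0 (vertex_ai hM T1).
  by exists y; split; [exact: (ocell_domain hO hM y0)|exists T1 => //; exact: (ocell_sub hM)].
have /nbhs_ballP[r /= r0 rO] := open_nbhs_nbhs (conj (domain_open hO) Ox).
have nbr : nbhs x (ball x r) by exact: nbhsx_ballx.
have [z T'z bz] := simplex_closure_open (vertex_ai hM T') T'x nbr.
have [G [oG G0 hG]] : exists G : set vec,
    [/\ open G, G !=set0 & forall y, G y -> ocell T y /\ ball x r y].
  move: nbr; rewrite nbhsE => -[B [oB Bx] hB].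
  have nB : nbhs x B by exact: open_nbhs_nbhs.
  have [y Ty By] := simplex_closure_open (vertex_ai hM T) Tx nB.
  exists (ocell T `&` B); split.
  - by apply: openI => //; exact: open_simplex_open.
  - by exists y.
  - by move=> w [h1 h2]; split=> //; exact: hB.
(* If the segment from y to z meets the face where the coordinates i and j both vanish before
   reaching z, the pairs of coordinates at y and at z are proportional, so their determinant is 0.
   When both coordinates vanish at z this determinant is identically 0, and coordinate i at y being
   0 is used instead, by setting a = 1. *)
pose bad (K : M) (i j : 'I_n.+2) (y : vec) : Prop :=
  let li := bary (vertex K) z i in let lj := bary (vertex K) z j in
  let a := if (li == 0) && (lj == 0) then 1 else lj in
  a * bary (vertex K) y i + (- li) * bary (vertex K) y j = 0.
have [y Gy ygood] : exists2 y, G y & forall K i j, i != j -> ~ bad K i j y.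
  apply: ae_open_ex => //.
  apply: filter_forall => K; apply: filter_forall => i; apply: filter_forall => j.
  have [->|ij] := eqVneq i j; first by apply: aeW => y /eqP.
  have := @bary_pair_negligible K i j
    (if (bary (vertex K) z i == 0) && (bary (vertex K) z j == 0) then 1
     else bary (vertex K) z j) (- bary (vertex K) z i) n1 ij.
  move=> hneg; apply: filterS (ae_not_mem (hneg _)) => [w hw _|]; first exact: hw.
  rewrite oppr_eq0; case: ifPn => [_|]; first by rewrite oner_eq0.
  by rewrite negb_and orbC.
have [Ty byy] := hG y Gy.
pose s (t : R) := y + t *: (z - y).
have cs : continuous s.
  by move=> t; apply: differentiable_continuous; apply: differentiableD.
have cUW (D : M -> Prop) : closed (s @^-1` cells D).
  by apply: closed_comp => [t _|]; [exact: cs|exact: cells_closed].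
have [t [t01 [Ta CTa Ta_t] [Tb nCTb Tb_t]]] :
    exists t, [/\ [set` `[(0:R), 1]] t, (s @^-1` cells C) t
      & (s @^-1` cells (fun T => ~ C T)) t].
  apply: connected_cover_meet => //; first exact: segment_connected.
  - move=> t /=; rewrite in_itv/= => t01.
    by have := cover _ (rO _ (ball_segment byy bz t01)).
  - exists 0; split; first by rewrite /= in_itv/= lexx ler01.
    by exists T => //; rewrite /s scale0r addr0; exact: (ocell_sub hM).
  - exists 1; split; first by rewrite /= in_itv/= lexx ler01.
    by exists T' => //; rewrite /s scale1r addrC subrK; exact: (ocell_sub hM).
have TaTb : Ta != Tb by apply/eqP => E; apply: nCTb; rewrite -E.
(* The case t = 1 is excluded because z lies in an open cell; otherwise 1 - t can be cancelled from
   the determinant. *)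
have nocodim (K : M) i j : i != j -> cell K (s t) -> bary (vertex K) (s t) i = 0 ->
    bary (vertex K) (s t) j = 0 -> False.
  move=> ij Kst bi bj.
  have stz : t <> 1.
    move=> t1; have E : s t = z by rewrite /s t1 scale1r addrC subrK.
    rewrite E in Kst bi; have KT := ocell_cell_disjoint hM T'z Kst.
    by have := T'z i; rewrite KT bi ltxx.
  apply: (ygood K i j ij); rewrite /bad.
  move: bi bj; rewrite /s !(affine_fun_segment _ _ _ (bary_affine _ _)).
  set li := bary _ z i; set lj := bary _ z j.
  set mi := bary _ y i; set mj := bary _ y j => bi bj.
  have t1 : 1 - t != 0 by rewrite subr_eq0 eq_sym; apply/eqP.
  apply: (mulfI t1); rewrite mulr0.
  have ei : (1 - t) * mi = - t * li by rewrite mulrBl mul1r mulNr; move: bi; rewrite mulrBr; lra.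
  have ej : (1 - t) * mj = - t * lj by rewrite mulrBl mul1r mulNr; move: bj; rewrite mulrBr; lra.
  rewrite mulrDr !(mulrCA (1 - t)) ei ej.
  by case: ifPn => [/andP[/eqP -> /eqP ->]|_]; ring.
(* A proper face containing s(t) omits one vertex; omitting a second one would put s(t) on a
   codimension-two face. *)
have single (K : M) (S : {set 'I_n.+2}) : S \proper [set: 'I_n.+2] ->
    subsimplex (vertex K) S (s t) -> exists i, S = [set~ i]%SET.
  move=> /properP[_ [i _ iS]] hS.
  have [h1 h2] := (subsimplexP _ _ (vertex_ai hM K)).1 hS.
  exists i; apply/setP => j; rewrite !inE.
  have [->|ji] := eqVneq j i; first by rewrite (negbTE iS).
  apply/negPn/negP => jS; apply: (nocodim K i j).
  - by rewrite eq_sym.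
  - by apply/simplexP => //; exact: (vertex_ai hM).
  - exact: h2.
  - exact: h2.
have [_ _ /(_ _ _ TaTb)[S [S' [pS pS' ES ES']]]] := hM.
have st : (cell Ta `&` cell Tb) (s t) by [].
have [i Si] := single Ta S pS (ltac:(by rewrite -ES)).
have [i' Si'] := single Tb S' pS' (ltac:(by rewrite -ES')).
apply: nCTb; apply: (hC Ta Tb i i') => //; first by rewrite ES Si.
by rewrite ES' Si'.
Qed.

(** Seen as a cone, a simplex depends only on the point set of its base and on its apex, not on the
    numbering of the vertices of the base. *)
Lemma cone_simplex (p : 'I_n.+2 -> vec) (i : 'I_n.+2) x :
  subsimplex p [set: 'I_n.+2] x <->
  exists t y, [/\ 0 <= t <= 1, subsimplex p [set~ i]%SET y &
                  x = t *: y + (1 - t) *: p i].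
Proof.
split=> [[l [l0 _ l1 ->]]|[t [y [/andP[t0 t1] [l [l0 lS l1 ->]] ->]]]].
  pose t := \sum_j l (lift i j).
  have tE : l i = 1 - t by rewrite -l1 (bigD1_ord i)//= addrK.
  have t0 : 0 <= t by exact: sumr_ge0.
  have t1 : t <= 1 by rewrite -subr_ge0 -tE.
  (* For t = 0 the point is the apex and the weights cannot be divided by t; any point of the base
     serves. *)
  have [te|tn] := eqVneq t 0.
    exists 0, (p (lift i ord0)); split; first by rewrite lexx ler01.
      exists (fun k => (k == lift i ord0)%:R); split.
      - by move=> k; rewrite ler0n.
      - by move=> k; rewrite !inE negbK => /eqP ->; rewrite (negbTE (neq_lift _ _)).
      - by rewrite (bigD1 (lift i ord0))//= eqxx big1 ?addr0// => k /negbTE ->.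
      - rewrite (bigD1 (lift i ord0))//= eqxx scale1r big1 ?addr0// => k /negbTE ->.
        by rewrite scale0r.
    rewrite scale0r add0r subr0 (bigD1_ord i)//= tE te subr0 big1 ?addr0// => j _.
    move: te => /eqP; rewrite psumr_eq0// => /allP/(_ j (mem_index_enum j))/eqP ->.
    by rewrite scale0r.
  exists t, (\sum_j (l (lift i j) / t) *: p (lift i j)); split; first by rewrite t0.
    exists (fun k => if k == i then 0 else l k / t); split.
    - by move=> k; case: ifP => // _; rewrite divr_ge0.
    - by move=> k; rewrite !inE negbK => ->.
    - rewrite (bigD1_ord i)//= eqxx add0r -[RHS](divff tn) mulr_suml.
      by apply: eq_bigr => j _; rewrite eq_sym (negbTE (neq_lift _ _)).
    - rewrite [RHS](bigD1_ord i)//= eqxx scale0r add0r.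
      by apply: eq_bigr => j _; rewrite eq_sym (negbTE (neq_lift _ _)).
  rewrite (bigD1_ord i)//= tE addrC; congr (_ + _); rewrite scaler_sumr.
  by apply: eq_bigr => j _; rewrite scalerA mulrCA divff// mulr1.
exists (fun k => t * l k + (1 - t) * (k == i)%:R); split.
- by move=> k; rewrite addr_ge0// mulr_ge0// ?subr_ge0.
- by move=> k; rewrite inE.
- rewrite big_split/= -!mulr_sumr l1 (bigD1 i)//= eqxx big1 => [|k /negbTE ->//].
  by rewrite (_ : true%:R = 1 :> R)//; ring.
- transitivity (\sum_k (t *: (l k *: p k) + (1 - t) *: ((k == i)%:R *: p k))).
    rewrite big_split/= -!scaler_sumr; congr (_ + _ *: _).
    by rewrite (bigD1 i)//= eqxx scale1r big1 ?addr0// => k /negbTE ->; rewrite scale0r.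
  by apply: eq_bigr => k _; rewrite [RHS]scalerDl !scalerA.
Qed.

(** Neighbouring cells share a facet as a point set, possibly with different numberings. Moving the
    apex of [T] to that of the neighbour describes the neighbour with the facet numbered as in
    [T]. *)
Definition apex_moved (T : M) (i : 'I_n.+2) (P : vec) : 'I_n.+2 -> vec :=
  fun k => if k == i then P else vertex T k.

Lemma apex_moved_cell (T T' : M) (i i' : 'I_n.+2) : facet T i = facet T' i' ->
  subsimplex (apex_moved T i (vertex T' i')) [set: 'I_n.+2] = cell T'.
Proof.
move=> TT'.
have E : subsimplex (apex_moved T i (vertex T' i')) [set~ i]%SET = facet T' i'.
  rewrite -TT'; apply/seteqP; split=> x [l [l0 lS l1 ->]]; exists l; split=> //;
    apply: eq_bigr => k _; rewrite /apex_moved; case: eqP => // ->;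
    by rewrite lS ?scale0r// !inE eqxx.
have Ei : apex_moved T i (vertex T' i') i = vertex T' i' by rewrite /apex_moved eqxx.
apply/funext => x; apply/propext.
by rewrite /cell (cone_simplex _ i) (cone_simplex _ i') E Ei.
Qed.

(** If the edges were dependent, the cell [T'], which they parametrise, would lie in a hyperplane,
    against its positive measure. This avoids matching the vertices of the two facets. *)
Lemma edges_apex_moved_unit (T T' : M) (i i' : 'I_n.+2) : facet T i = facet T' i' ->
  edges (apex_moved T i (vertex T' i')) i \in unitmx.
Proof.
move=> TT'; set p := apex_moved T i (vertex T' i').
rewrite unitmxE unitfE -det_tr; apply/det0P => -[v v0 vE].
have h x : cell T' x -> dot v x = dot v (p i).
  rewrite -(apex_moved_cell TT') (simplex_param _ i) => -[y _ <-].
  rewrite dotDr -[RHS]addr0; congr (_ + _).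
  transitivity ((y *m (v *m (edges p i)^T)^T) ord0 ord0); last first.
    by rewrite vE trmx0 mulmx0 mxE.
  rewrite trmx_mul trmxK mulmxA mxE /dot; apply: eq_bigr => k _.
  by rewrite [v^T _ _]mxE mulrC.
have := ocell_gt0 hM T'; rewrite lt_neqAle => /andP[/eqP + _]; apply; apply/esym.
have mH : measurable [set x | dot v x = dot v (p i)].
  by apply: closed_measurable_rV; apply: affine_fun_level_closed; exists v, 0 => x; rewrite addr0.
apply: subset_measure0 (hyperplane_null (dot v (p i)) v0) => //.
  exact: measurable_ocell.
by move=> x /(ocell_sub hM)/h.
Qed.

End mesh_connected.

(** * Green's formula and weak divergences *)

Section C1_functions.
Context {R : realType} {m : nat}.
Local Notation vec := 'rV[R]_m.

Lemma continuousDR (f g : vec -> R) : continuous f -> continuous g ->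
  continuous (fun x => f x + g x).
Proof. by move=> cf cg x; exact: (@cvgD _ R^o _ _ _ f g _ _ (cf x) (cg x)). Qed.

Lemma continuousMR (f g : vec -> R) : continuous f -> continuous g ->
  continuous (fun x => f x * g x).
Proof. by move=> cf cg x; exact: (@cvgM _ _ _ _ f g _ _ (cf x) (cg x)). Qed.

Lemma continuous_sumR (I : Type) (s : seq I) (f : I -> vec -> R) :
  (forall i, continuous (f i)) -> continuous (fun x => \sum_(i <- s) f i x).
Proof.
move=> cf; elim: s => [|i s IH].
  rewrite (_ : (fun x => _) = cst 0); first exact: cst_continuous.
  by apply/funext => x; rewrite big_nil.
rewrite (_ : (fun x => _) = (fun x => f i x + \sum_(i <- s) f i x)).
  exact: continuousDR (cf i) IH.
by apply/funext => x; rewrite big_cons.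
Qed.

Lemma derive_grad (phi : vec -> R) (x v : vec) : differentiable phi x ->
  'D_v phi x = dot v (grad phi x).
Proof.
move=> dphi; rewrite deriveE// {1}(row_sum_delta v) linear_sum /dot.
by apply: eq_bigr => i _; rewrite linearZ /= mxE deriveE.
Qed.

Lemma derive_affine_comp k (phi : vec -> R) (p : vec) (E : 'M[R]_(k, m)) (x v : 'rV[R]_k) :
  'D_v (fun y : 'rV[R]_k => phi (p + y *m E)) x = 'D_(v *m E) phi (p + x *m E).
Proof.
have E1 : (fun h : R => h^-1 *: (((fun y : 'rV[R]_k => phi (p + y *m E)) \o shift x) (h *: v)
      - phi (p + x *m E))) =
    (fun h : R => h^-1 *: ((phi \o shift (p + x *m E)) (h *: (v *m E)) - phi (p + x *m E))).
  by apply/funext => h /=; rewrite mulmxDl -scalemxAl addrCA.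
by rewrite /derive E1.
Qed.

Lemma C1_continuous (phi : vec -> R) : C1 phi -> continuous phi.
Proof. by move=> [dphi _] x; exact: differentiable_continuous. Qed.

Lemma continuous_coordB (P : vec) (i : 'I_m) : continuous (fun x : vec => (x - P) ord0 i).
Proof.
have := @affine_fun_mulmx R m m 1%:M P i.
by move=> /affine_fun_continuous; under eq_fun do rewrite mulmx1.
Qed.

Lemma C1_radial_continuous (phi : vec -> R) (P : vec) (a : R) : C1 phi ->
  continuous (fun x : vec => dot (x - P) (grad phi x) + a * phi x).
Proof.
move=> Cphi; have [_ cg] := Cphi.
apply: (@continuousDR (fun x => dot (x - P) (grad phi x)) (fun x => a * phi x)).
  apply: (@continuous_sumR _ _ (fun i x => (x - P) ord0 i * grad phi x ord0 i)) => i.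
  exact: continuousMR (@continuous_coordB P i) (cg i).
apply: continuousMR; [exact: cst_continuous|exact: C1_continuous].
Qed.

Lemma grad_bounded (phi : vec -> R) (K : set vec) : C1 phi -> compact K ->
  exists C : R, 0 <= C /\ forall x i, K x -> `|grad phi x ord0 i| <= C.
Proof.
move=> [_ cg] cK.
have /choice[C hC] i := compact_continuous_bounded cK (cg i).
exists (\sum_i C i); split; first by rewrite sumr_ge0// => i _; have [] := hC i.
move=> x i Kx; have [_ /(_ x Kx)/le_trans] := hC i; apply.
by rewrite (bigD1 i)//= lerDl sumr_ge0// => j _; have [] := hC j.
Qed.

Lemma dot_bound (u v : vec) (a b : R) : (forall i, `|u ord0 i| <= a) ->
  (forall i, `|v ord0 i| <= b) -> `|dot u v| <= m%:R * (a * b).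
Proof.
move=> ua vb; apply: le_trans (ler_norm_sum _ _ _) _.
rewrite -[X in X%:R](card_ord m) mulr_natl -sumr_const ler_sum// => i _.
by rewrite normrM ler_pM.
Qed.

Lemma ref_simplex_coord_le (x : vec) (i : 'I_m) : ref_simplex x -> `|x ord0 i| <= 1.
Proof.
move=> [x0 x1]; rewrite ger0_norm//; apply: le_trans x1.
by rewrite (bigD1 i)//= lerDl sumr_ge0.
Qed.

End C1_functions.

(** * Matching fluxes across a facet *)

Section flux.
Context {R : realType} {n : nat}.
Local Notation vec := 'rV[R]_n.+1.
Local Notation leb := (lebesgue_rV n.+1 : {measure set vec -> \bar R}).
Implicit Types (p : 'I_n.+2 -> vec) (phi : vec -> R).

(** This is the divergence of phi(x) (x - P), in dimension n + 1. *)
Definition radial_div phi (P x : vec) : R :=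
  dot (x - P) (grad phi x) + n.+1%:R * phi x.

Lemma edges_preimage p i : edges p i \in unitmx ->
  (fun x : vec => p i + x *m edges p i) @^-1` (subsimplex p [set: 'I_n.+2]) = ref_simplex.
Proof.
move=> Eu; rewrite (simplex_param p i); apply/seteqP; split=> [x [y hy]|x hx]; last by exists x.
by move=> /addrI /(congr1 (mulmx^~ (invmx (edges p i)))); rewrite !mulmxK// => <-.
Qed.

Lemma integrable_simplex p (f : vec -> R) : continuous f ->
  leb.-integrable (subsimplex p [set: 'I_n.+2]) (EFin \o f).
Proof.
move=> cf; have [C [_ hC]] := compact_continuous_bounded (@simplex_compact _ _ p) cf.
apply: (@bounded_integrable _ _ _ _ _ _ C) => //.
- exact: measurable_simplex.
- apply: lebesgue_rV_bounded; first exact: measurable_simplex.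
  by apply: compact_bounded; exact: simplex_compact.
- by apply: measurable_funTS; exact: continuous_measurable_rV.
Qed.

(** With the apex P as origin, x - P pulls back to the position vector, and the integrand takes the
    form treated in [ref_simplex_divergence]. *)
Lemma radial_div_pullback phi (P : vec) (E : 'M[R]_n.+1) (x : vec) : C1 phi ->
  radial_div phi P (P + x *m E) =
  n.+1%:R * phi (P + x *m E) + 'D_x (fun y : vec => phi (P + y *m E)) x.
Proof.
move=> [dphi _]; rewrite /radial_div addrC; congr (_ + _).
by rewrite derive_affine_comp derive_grad// addrC addKr.
Qed.

Lemma derive_pullback_bound phi (P : vec) (E : 'M[R]_n.+1) : C1 phi ->
  exists C : R, forall x y : vec, ref_simplex x -> ref_simplex y ->
    `|'D_y (fun y : vec => phi (P + y *m E)) x| <= C.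
Proof.
move=> Cphi.
have cK : compact ((fun x : vec => P + x *m E) @` ref_simplex).
  apply: continuous_compact; last exact: ref_simplex_compact.
  exact/continuous_subspaceT/continuous_affine.
have [C [C0 hC]] := grad_bounded Cphi cK.
exists (n.+1%:R * ((\sum_i \sum_j `|E i j|) * C)) => x y hx hy.
rewrite derive_affine_comp derive_grad; last by case: Cphi.
apply: dot_bound => i; last by apply: hC; exists x.
rewrite mxE; apply: le_trans (ler_norm_sum _ _ _) _; apply: ler_sum => j _.
rewrite normrM; apply: (@le_trans _ _ `|E j i|).
  by rewrite -[leRHS]mul1r ler_wpM2r// ref_simplex_coord_le.
by rewrite (bigD1 i)//= lerDl sumr_ge0.
Qed.

(** On the face where the coordinates sum to 1, the weight of the apex is 0. *)
Lemma facet_param p p' i (x : vec) : (forall k, k != i -> p k = p' k) ->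
  \sum_j x ord0 j = 1 -> p i + x *m edges p i = p' i + x *m edges p' i.
Proof.
have E q : \sum_j x ord0 j = 1 ->
    q i + x *m edges q i = \sum_j x ord0 j *: q (lift i j).
  move=> x1; rewrite mulmx_sum_row -[q i](scale1r (q i)) -x1 scaler_suml -big_split/=.
  by apply: eq_bigr => j _; rewrite rowK scalerBr addrC subrK.
move=> pp' x1; rewrite !E//; apply: eq_bigr => j _.
by rewrite pp'// eq_sym neq_lift.
Qed.

Lemma radial_div_integral p i : edges p i \in unitmx ->
  exists c : R, 0 < c /\ forall phi, C1 phi ->
    let G (x : vec) := n.+1%:R * phi (p i + x *m edges p i) +
      'D_x (fun y : vec => phi (p i + y *m edges p i)) x in
    leb.-integrable ref_simplex (EFin \o G) /\
    \int[leb]_(x in subsimplex p [set: 'I_n.+2]) radial_div phi (p i) x =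
    c * \int[leb]_(x in ref_simplex) G x.
Proof.
move=> Eu; have [c [c0 hc]] := Rintegral_affine (p i) Eu.
exists c; split=> // phi Cphi G.
have ir : leb.-integrable (subsimplex p [set: 'I_n.+2]) (EFin \o radial_div phi (p i)).
  exact: integrable_simplex (@C1_radial_continuous _ _ _ (p i) n.+1%:R Cphi).
have [i1 ->] := hc _ _ (measurable_simplex p) ir.
have E := edges_preimage Eu.
have GE : (fun x : vec => radial_div phi (p i) (p i + x *m edges p i)) = G.
  by apply/funext => x; rewrite radial_div_pullback.
by rewrite E GE in i1 *.
Qed.

(** Both integrals are pulled back to the reference simplex. The difference of the pullbacks of phi
    vanishes on the common face by [facet_param], so its divergence integral is 0; a and a'
    compensate the Jacobians. *)
Lemma flux_match p p' i : (forall k, k != i -> p k = p' k) ->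
  edges p i \in unitmx -> edges p' i \in unitmx ->
  exists a a' : R, [/\ 0 < a, 0 < a' & forall phi, C1 phi ->
    a * \int[leb]_(x in subsimplex p [set: 'I_n.+2]) radial_div phi (p i) x =
    a' * \int[leb]_(x in subsimplex p' [set: 'I_n.+2]) radial_div phi (p' i) x].
Proof.
move=> pp' Eu Eu'.
have [c [c0 hc]] := radial_div_integral Eu.
have [c' [c'0 hc']] := radial_div_integral Eu'.
exists c^-1, c'^-1; split; rewrite ?invr_gt0// => phi Cphi.
have [i1 ->] := hc phi Cphi; have [i2 ->] := hc' phi Cphi.
rewrite (mulKf (lt0r_neq0 c0)) (mulKf (lt0r_neq0 c'0)).
apply/eqP; rewrite -subr_eq0 -(RintegralB measurable_ref_simplex i1 i2).
have [dphi _] := Cphi.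
pose psi (y : vec) := phi (p i + y *m edges p i) - phi (p' i + y *m edges p' i).
have dcomp (P : vec) (E : 'M[R]_n.+1) (x : vec) : differentiable (fun y : vec => phi (P + y *m E)) x.
  apply: (@differentiable_comp _ _ _ _ (fun y : vec => P + y *m E) phi) => //.
  exact: differentiable_affine.
have dB (x v : vec) : 'D_v psi x = 'D_v (fun y : vec => phi (p i + y *m edges p i)) x -
    'D_v (fun y : vec => phi (p' i + y *m edges p' i)) x.
  by rewrite -deriveB//; exact: diff_derivable.
have [C hC] := derive_pullback_bound (p i) (edges p i) Cphi.
have [C' hC'] := derive_pullback_bound (p' i) (edges p' i) Cphi.
apply/eqP; rewrite -[RHS](@ref_simplex_divergence R n.+1 psi (C + C')).
- apply: eq_Rintegral => x _; rewrite dB /psi; ring.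
- by move=> x; apply: (differentiableB (dcomp _ _ _) (dcomp _ _ _)).
- move=> x y hx hy; rewrite dB; apply: le_trans (ler_normB _ _) _.
  by apply: lerD; [exact: hC|exact: hC'].
- by move=> x _ x1; rewrite /psi (facet_param pp' x1) subrr.
Qed.

End flux.

Section C1_closure.
Context {R : realType} {m : nat}.
Local Notation vec := 'rV[R]_m.

Lemma gradM (f g : vec -> R) x : differentiable f x -> differentiable g x ->
  grad (fun x => f x * g x) x = f x *: grad g x + g x *: grad f x.
Proof.
move=> df dg; apply/rowP => i; rewrite !mxE.
by rewrite [LHS](@deriveM _ _ f g)//; exact: diff_derivable.
Qed.

Lemma C1M (f g : vec -> R) : C1 f -> C1 g -> C1 (fun x => f x * g x).
Proof.
move=> Cf Cg; have [df cf] := Cf; have [dg cg] := Cg; split.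
  by move=> x; exact: (differentiableM (df x) (dg x)).
move=> i.
rewrite [X in continuous X](_ : _ =
    (fun x => f x * grad g x ord0 i + g x * grad f x ord0 i)).
  have ccf := C1_continuous Cf; have ccg := C1_continuous Cg.
  exact: (continuousDR (continuousMR ccf (cg i)) (continuousMR ccg (cf i))).
by apply/funext => x; rewrite gradM// !mxE.
Qed.

Lemma C1_comp (h h' : R -> R) (f : vec -> R) : (forall s : R, is_derive s 1 h (h' s)) ->
  continuous h' -> C1 f -> C1 (h \o f).
Proof.
move=> dh ch' Cf; have [df cf] := Cf.
have dh1 s : differentiable h s by apply/derivable1_diffP; have [] := dh s.
split=> [x|i]; first exact: differentiable_comp.
rewrite (_ : (fun x => _) = (fun x => h' (f x) * grad f x ord0 i)).
  apply: (@continuousMR _ _ (h' \o f)) => // x.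
  by apply: continuous_comp; [exact: C1_continuous|exact: ch'].
apply/funext => x; rewrite !mxE !deriveE//; last exact: differentiable_comp.
rewrite diff_comp//= deriv1E; last by have [] := dh (f x).
by rewrite derive1E (@derive_val _ _ _ _ _ _ _ (dh (f x))) mulrC.
Qed.

Lemma C1_cst (c : R) : C1 (fun _ : vec => c).
Proof.
split=> [x|i]; first exact: differentiable_cst.
rewrite (_ : (fun x => _) = cst 0); first exact: cst_continuous.
by apply/funext => x; rewrite mxE derive_cst.
Qed.

Lemma C1_affine (f : vec -> R) : affine_fun f -> C1 f.
Proof.
move=> hf; split=> [x|i]; first exact: affine_fun_differentiable.
have [a ha] := affine_fun_derive hf.
rewrite (_ : (fun x => _) = cst (a ord0 i)); first exact: cst_continuous.
by apply/funext => x; rewrite mxE ha dotC dot_delta.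
Qed.

Lemma C1_prod (I : Type) (s : seq I) (f : I -> vec -> R) : (forall i, C1 (f i)) ->
  C1 (fun x => \prod_(i <- s) f i x).
Proof.
move=> Cf; elim: s => [|i s IH].
  by rewrite (_ : (fun x => _) = (fun=> 1)); [exact: C1_cst|apply/funext => x; rewrite big_nil].
rewrite (_ : (fun x => _) = (fun x => f i x * \prod_(i <- s) f i x)).
  exact: C1M.
by apply/funext => x; rewrite big_cons.
Qed.

End C1_closure.

(** * Cutoff functions in the open simplices *)

Section cutoff.
Context {R : realType}.

(** Meant for [sqpos], where one quadratic remainder bound covers the gluing point 0 together with
    the smooth pieces. *)
Lemma quadratic_is_derive (f : R -> R) (x d C : R) :
  (forall h, `|f (h + x) - f x - d * h| <= C * h ^+ 2) -> is_derive x 1 f d.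
Proof.
move=> hf.
have H : (fun h => h^-1 *: ((f \o shift x) (h *: 1) - f x)) @ 0^' --> d.
  apply/cvgrPdist_le => e e0.
  have C0 : 0 <= C.
    by have := le_trans (normr_ge0 _) (hf 1); rewrite expr1n mulr1.
  have eC : 0 < e / (C + 1) by rewrite divr_gt0// ltr_wpDl.
  near=> h.
  have h0 : h != 0 by near: h; exact: nbhs_dnbhs_neq.
  rewrite /= [h *: 1]mulr1 distrC.
  have -> : h^-1 *: (f (h + x) - f x) - d = h^-1 * (f (h + x) - f x - d * h).
    by rewrite mulrBr mulrCA mulVf ?mulr1.
  rewrite normrM normfV ler_pdivrMl ?normr_gt0//.
  apply: le_trans (hf h) _.
  have -> : h ^+ 2 = `|h| * `|h| by rewrite -normrM -expr2 ger0_norm ?sqr_ge0.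
  rewrite mulrCA ler_wpM2l//.
  have hd : `|h| <= e / (C + 1) by near: h; exact: dnbhs0_le.
  apply: (@le_trans _ _ ((C + 1) * `|h|)); first by rewrite ler_wpM2r// lerDl.
  by rewrite mulrC -ler_pdivlMr// ltr_wpDl.
split; first by apply/cvg_ex; exists d.
exact: cvg_lim.
Unshelve. all: by end_near. Qed.

Definition sqpos (s : R) : R := (Num.max s 0) ^+ 2.

Lemma sqpos_derive (s : R) : is_derive s 1 sqpos (2 * Num.max s 0).
Proof.
apply: (@quadratic_is_derive _ _ _ 1) => h; rewrite /sqpos.
have [h1|h1] := leP 0 (h + s); have [h2|h2] := leP 0 s;
  rewrite ?(max_l h1) ?(max_l h2) ?(max_r (ltW h1)) ?(max_r (ltW h2)); rewrite ler_norml;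
  apply/andP; split; nra.
Qed.

Lemma sqpos_continuous_der : continuous (fun s : R => 2 * Num.max s 0).
Proof.
move=> s; apply: cvgM; first exact: cvg_cst.
by apply: (continuous_max (f := id) (g := cst 0)) => //; exact: cvg_cst.
Qed.

(** The shift by 1/a makes the function vanish up to s = 1/a, which yields compact support; the
    factor a in the exponent makes it tend to 1 for every s > 0. The square in [sqpos] gives C^1
    regularity. *)
Definition cutoff1 (a s : R) : R := 1 - expR (- (a * sqpos (s - a^-1))).

Definition cutoff1' (a s : R) : R :=
  expR (- (a * sqpos (s - a^-1))) * (a * (2 * Num.max (s - a^-1) 0)).

Lemma cutoff1_derive (a s : R) : is_derive s 1 (cutoff1 a) (cutoff1' a s).
Proof.
have h1 : is_derive s 1 (fun s : R => s - a^-1) 1.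
  have := @is_deriveD _ _ _ id (cst (- a^-1)) s 1 1 0 (is_derive_id _ _) (is_derive_cst _ _ _).
  by move=> /is_derive_eq; apply; rewrite addr0.
have h2 := @is_derive1_comp _ sqpos (fun s : R => s - a^-1) s _ _ (sqpos_derive (s - a^-1)) h1.
have h3 := is_deriveN (is_deriveZ a h2).
have h4 := is_derive1_comp (is_derive_expR _) h3.
have h5 := is_deriveB (is_derive_cst (1 : R) s 1) h4.
rewrite (_ : cutoff1 a = cst 1 - expR \o - (a *: (sqpos \o (fun s : R => s - a^-1))))//.
move: h5 => /is_derive_eq; apply; rewrite /cutoff1' sub0r mulr1 /=.
by rewrite [_ *: _]mulrN1 || rewrite /GRing.scale/= mulrN opprK.
Qed.

Lemma cutoff1'_continuous (a : R) : continuous (cutoff1' a).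
Proof.
have cs : continuous (fun s : R => s - a^-1).
  by move=> s; apply: cvgB; [exact: cvg_id|exact: cvg_cst].
move=> s; apply: cvgM.
  apply: (@continuous_comp _ _ _ (fun s => - (a * sqpos (s - a^-1))) expR); last exact: continuous_expR.
  apply: cvgN; apply: cvgM; first exact: cvg_cst.
  apply: (@continuous_comp _ _ _ (fun s => s - a^-1) sqpos); first exact: cs.
  apply: differentiable_continuous; apply/derivable1_diffP.
  by have [] := sqpos_derive (s - a^-1).
apply: cvgM; first exact: cvg_cst.
apply: (@continuous_comp _ _ _ (fun s => s - a^-1) (fun s => 2 * Num.max s 0)); first exact: cs.
exact: sqpos_continuous_der.
Qed.

Lemma cutoff1_itv (a s : R) : 0 <= a -> 0 <= cutoff1 a s <= 1.
Proof.
move=> a0; rewrite /cutoff1 subr_ge0 gerBl expR_ge0 andbT -expR0 ler_expR.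
by rewrite oppr_le0 mulr_ge0// sqr_ge0.
Qed.

Lemma cutoff1_eq0 (a s : R) : s <= a^-1 -> cutoff1 a s = 0.
Proof.
move=> sa; rewrite /cutoff1 /sqpos max_r ?subr_le0//.
by rewrite expr0n mulr0 oppr0 expR0 subrr.
Qed.

Lemma sqpos_lower (s b : R) : 0 < s -> b <= s / 2 -> s ^+ 2 / 4 <= sqpos (s - b).
Proof.
move=> s0 bs; have h : s / 2 <= s - b by lra.
have hs : 0 <= s / 2 by rewrite divr_ge0// ltW.
have hb : 0 <= s - b by exact: le_trans h.
rewrite /sqpos max_l//.
have -> : s ^+ 2 / 4 = (s / 2) ^+ 2 by field.
by rewrite lerXn2r ?nnegrE.
Qed.

(** Once 1/a <= s/2, the exponent is at least a s^2 / 4, and exp(-y) <= 1/y bounds the distance to 1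
    by 4 / (a s^2). *)
Lemma cutoff1_cvg (s : R) : 0 < s -> cutoff1 k.+1%:R s @[k --> \oo] --> (1 : R).
Proof.
move=> s0; rewrite -[X in _ --> X]subr0 /cutoff1.
apply: cvgB; first exact: cvg_cst.
have hc : (4 / s ^+ 2) * k.+1%:R^-1 @[k --> \oo] --> (0 : R).
  rewrite -[X in _ --> X](mulr0 (4 / s ^+ 2)); apply: cvgM; first exact: cvg_cst.
  exact: cvg_harmonic.
apply: (squeeze_cvgr _ (cvg_cst 0) hc); near=> k; rewrite expR_ge0/=.
have ks : k.+1%:R^-1 <= s / 2.
  near: k; have := @cvg_harmonic R => /cvgrPdist_le/(_ (s / 2)).
  rewrite divr_gt0// => /(_ isT); apply: filterS => k; rewrite sub0r normrN.
  by rewrite ger0_norm// invr_ge0.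
set a := k.+1%:R in ks *; have a0 : 0 < a by rewrite ltr0n.
have hy : a * (s ^+ 2 / 4) <= a * sqpos (s - a^-1).
  by rewrite ler_wpM2l ?(ltW a0)// sqpos_lower.
rewrite expRN; apply: (@le_trans _ _ (a * (s ^+ 2 / 4))^-1).
  rewrite lef_pV2 ?posrE ?expR_gt0 ?mulr_gt0 ?divr_gt0 ?exprn_gt0//.
  apply: le_trans hy _; apply: le_trans (expR_ge1Dx _).
  by rewrite lerDr.
by rewrite invfM invf_div mulrC.
Unshelve. all: by end_near. Qed.

Lemma cvg_prod1 (I : Type) (s : seq I) (f : I -> R^nat) :
  (forall i, f i k @[k --> \oo] --> (1 : R)) ->
  \prod_(i <- s) f i k @[k --> \oo] --> (1 : R).
Proof.
move=> hf; elim: s => [|i s IH].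
  rewrite (_ : (fun k => _) = cst 1); first exact: cvg_cst.
  by apply/funext => k; rewrite big_nil.
rewrite (_ : (fun k => _) = (fun k => f i k * \prod_(i <- s) f i k)).
  by rewrite -[X in _ --> X](mulr1 1); apply: cvgM.
by apply/funext => k; rewrite big_cons.
Qed.

End cutoff.

Section simplex_cutoff.
Context {R : realType} {n : nat}.
Local Notation vec := 'rV[R]_n.+1.
Variable (p : 'I_n.+2 -> vec).
Hypothesis ai : affinely_independent p.

Definition simplex_cutoff (k : nat) (x : vec) : R :=
  \prod_(i < n.+2) cutoff1 k.+1%:R (bary p x i).

Lemma simplex_cutoff_C1 k : C1 (simplex_cutoff k).
Proof.
apply: (@C1_prod _ _ _ _ (fun i x => cutoff1 k.+1%:R (bary p x i))) => i.
apply: (C1_comp (f := fun x => bary p x i) (cutoff1_derive k.+1%:R)).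
  exact: cutoff1'_continuous.
exact/C1_affine/bary_affine.
Qed.

Lemma simplex_cutoff_itv k x : 0 <= simplex_cutoff k x <= 1.
Proof.
have h i := cutoff1_itv (bary p x i) (ler0n R k.+1).
apply/andP; split; first by apply: prodr_ge0 => i _; have /andP[] := h i.
by apply: prodr_ile1 => i _.
Qed.

Lemma simplex_cutoff_cvg x : open_simplex p x ->
  simplex_cutoff k x @[k --> \oo] --> (1 : R).
Proof. by move=> hx; apply: cvg_prod1 => i; apply: cutoff1_cvg; exact: hx. Qed.

Lemma simplex_cutoff_support k : exists K : set vec,
  [/\ compact K, K `<=` open_simplex p & forall x, ~ K x -> simplex_cutoff k x = 0].
Proof.
pose K := \bigcap_(i in [set: 'I_n.+2]) [set x | k.+1%:R^-1 <= bary p x i].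
have Ko : K `<=` open_simplex p.
  by move=> x h i; apply: lt_le_trans (h i I); rewrite invr_gt0 ltr0n.
exists K; split=> //.
  apply: (subclosed_compact _ (@simplex_compact _ _ p)).
    apply: closed_bigI => i _.
    apply: (@closed_comp _ _ (fun x => bary p x i) [set y | k.+1%:R^-1 <= y]).
      by move=> x _; exact: (affine_fun_continuous (bary_affine p i)).
    exact: closed_ge.
  by apply: subset_trans Ko _; exact: open_simplex_sub.
move=> x nKx; have [i hi] : exists i, ~ k.+1%:R^-1 <= bary p x i.
  apply: contrapT => h; apply: nKx => i _; apply: contrapT => hi.
  by apply: h; exists i.
rewrite /simplex_cutoff (bigD1 i)//= cutoff1_eq0 ?mul0r//.
by move/negP: hi; rewrite -ltNge => /ltW.
Qed.

End simplex_cutoff.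

Section L2_spaces.
Context {R : realType} {n : nat}.
Local Notation vec := 'rV[R]_n.+1.
Local Notation leb := (lebesgue_rV n.+1 : {measure set vec -> \bar R}).
Variable D : set vec.
Hypotheses (mD : measurable D) (Dfin : (leb D < +oo)%E).

Lemma L2_bounded (f : vec -> R) (C : R) : measurable_fun D f ->
  (forall x, D x -> `|f x| <= C) -> L2 D f.
Proof.
move=> mf hC; split=> //; apply: (@bounded_integrable _ _ _ _ _ _ (C ^+ 2)) => //.
  exact: measurable_funX.
by move=> x Dx; rewrite normrX lerXn2r ?nnegrE ?hC// (le_trans _ (hC x Dx)).
Qed.

Lemma L2D (f g : vec -> R) : L2 D f -> L2 D g -> L2 D (fun x => f x + g x).
Proof.
move=> [mf f2] [mg g2]; split; first exact: measurable_funD.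
apply: (@le_integrableR _ _ _ _ _ _ (fun x => 2 * f x ^+ 2 + 2 * g x ^+ 2)) => //.
- by apply: measurable_funX; exact: measurable_funD.
- move=> x _; rewrite ger0_norm ?sqr_ge0//; have := sqr_ge0 (f x - g x).
  by rewrite !expr2; lra.
- by apply: integrableDR => //; exact: integrableZR.
Qed.

Lemma L2Z (c : R) (f : vec -> R) : L2 D f -> L2 D (fun x => c * f x).
Proof.
move=> [mf f2]; split; first exact: measurable_funM.
rewrite (_ : (fun x => _) = EFin \o (fun x => c ^+ 2 * f x ^+ 2)).
  exact: integrableZR.
by apply/funext => x /=; rewrite exprMn.
Qed.

Lemma L2_mul_integrable (f g : vec -> R) : L2 D f -> L2 D g ->
  leb.-integrable D (EFin \o (fun x => f x * g x)).
Proof.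
move=> [mf f2] [mg g2].
apply: (@le_integrableR _ _ _ _ _ _ (fun x => f x ^+ 2 + g x ^+ 2)) => //.
- exact: measurable_funM.
- by move=> x _; rewrite ler_norml; apply/andP; split; nra.
- exact: integrableDR.
Qed.

Lemma L2_cst (c : R) : L2 D (fun=> c).
Proof. by apply: (@L2_bounded _ `|c|). Qed.

Lemma L2_integrable (f : vec -> R) : L2 D f -> leb.-integrable D (EFin \o f).
Proof.
move=> hf; have := L2_mul_integrable hf (L2_cst 1).
by rewrite (_ : (fun x => f x * 1) = f)//; apply/funext => x; rewrite mulr1.
Qed.

Lemma L2_sum (I : Type) (s : seq I) (f : I -> vec -> R) : (forall i, L2 D (f i)) ->
  L2 D (fun x => \sum_(i <- s) f i x).
Proof.
move=> hf; elim: s => [|i s IH].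
  by rewrite (_ : (fun x => _) = (fun=> 0)); [exact: L2_cst|apply/funext => x; rewrite big_nil].
rewrite (_ : (fun x => _) = (fun x => f i x + \sum_(i <- s) f i x)).
  exact: L2D.
by apply/funext => x; rewrite big_cons.
Qed.

Lemma L2_mul_bounded (f g : vec -> R) (C : R) : measurable_fun D f ->
  (forall x, D x -> `|f x| <= C) -> L2 D g -> L2 D (fun x => f x * g x).
Proof.
move=> mf hC [mg g2]; split; first exact: measurable_funM.
apply: (@le_integrableR _ _ _ _ _ _ (fun x => C ^+ 2 * g x ^+ 2)) => //.
- by apply: measurable_funX; exact: measurable_funM.
- move=> x Dx; rewrite ger0_norm ?sqr_ge0// exprMn ler_wpM2r ?sqr_ge0//.
  rewrite -[f x ^+ 2]ger0_norm ?sqr_ge0// normrX lerXn2r ?nnegrE ?hC//.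
  by rewrite (le_trans _ (hC x Dx)).
- exact: integrableZR.
Qed.

Lemma L2vec_lin (c : R) (v w : vec -> vec) : L2vec D v -> L2vec D w ->
  L2vec D (c *: v + w).
Proof.
move=> hv hw i; have := L2D (L2Z c (hv i)) (hw i).
by congr L2; apply/funext => x; rewrite !mxE.
Qed.

Lemma L2vec0 : L2vec D 0.
Proof.
move=> i; have := L2_cst 0.
by congr L2; apply/funext => x; rewrite mxE.
Qed.

Lemma dot_integrable (v w : vec -> vec) : L2vec D v -> L2vec D w ->
  leb.-integrable D (EFin \o (fun x => dot (v x) (w x))).
Proof.
move=> hv hw.
apply: (@integrable_sumR _ _ _ _ _ _ D (fun i x => v x ord0 i * w x ord0 i)) => // i.
exact: L2_mul_integrable.
Qed.

End L2_spaces.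

(** * Uniqueness of weak divergences *)

Section weak_divergence.
Context {R : realType} {n : nat}.
Local Notation vec := 'rV[R]_n.+1.
Local Notation leb := (lebesgue_rV n.+1 : {measure set vec -> \bar R}).
Variable Omega : set vec.
Hypothesis hO : polytopal_lipschitz_domain Omega.

Let mO : measurable Omega := domain_measurable hO.
Let Ofin : (leb Omega < +oo)%E := domain_fin hO.

Lemma domain_compact_cover : exists K : set vec, compact K /\ Omega `<=` K.
Proof.
have [k hk] := bounded_subset_box (domain_bounded hO).
exists [set x | forall i, x ord0 i \in `[- k%:R, k%:R]].
split; first exact: (@box_compact _ _ (fun=> - k%:R) (fun=> k%:R)).
by move=> x /hk h i; have := h i; rewrite !in_itv/= => /andP[/ltW -> ->].
Qed.

Lemma continuous_domain_bounded (f : vec -> R) : continuous f ->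
  exists C : R, forall x, Omega x -> `|f x| <= C.
Proof.
have [K [cK OK]] := domain_compact_cover.
by move=> /(compact_continuous_bounded cK)[C [_ hC]]; exists C => x /OK; exact: hC.
Qed.

Lemma continuous_L2 (f : vec -> R) : continuous f -> L2 Omega f.
Proof.
move=> cf; have [C hC] := continuous_domain_bounded cf.
by apply: (L2_bounded mO Ofin _ hC); apply: measurable_funTS; exact: continuous_measurable_rV.
Qed.

Lemma C1_L2 (phi : vec -> R) : C1 phi -> L2 Omega phi.
Proof. by move=> /C1_continuous; exact: continuous_L2. Qed.

Lemma grad_L2vec (phi : vec -> R) : C1 phi -> L2vec Omega (grad phi).
Proof. by move=> [_ cg] i; exact: continuous_L2. Qed.

Variable M : mesh R n.
Hypothesis hM : conforming_mesh Omega M.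

Lemma L2_restrict (T : M) (f : vec -> R) : L2 Omega f -> L2 (ocell T) f.
Proof.
move=> [mf f2]; split; last exact: (integrable_ocell hO hM T f2).
by apply: measurable_funS mf => //; exact: ocell_domain.
Qed.

(** The conclusion gains two things: it is local to a cell, as needed against piecewise constants,
    and [phi] need not vanish near the boundary, as needed for normal traces. The cutoffs converge
    to 1 on the open cell, with |g phi| as dominating function. *)
Lemma weak_zero (g : vec -> R) : L2 Omega g ->
  (forall phi : vec -> R, C1 phi ->
     (exists K : set vec, [/\ compact K, K `<=` Omega & forall x, ~ K x -> phi x = 0]) ->
     \int[leb]_(x in Omega) (g x * phi x) = 0) ->
  forall (T : M) (phi : vec -> R), C1 phi ->
    \int[leb]_(x in ocell T) (g x * phi x) = 0.
Proof.
move=> hg h T phi Cphi; pose chi := simplex_cutoff (vertex T).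
have Cchi k : C1 (fun x => phi x * chi k x) by apply: C1M => //; exact: simplex_cutoff_C1.
have hgphi : leb.-integrable Omega (EFin \o (fun x => g x * phi x)).
  by apply: L2_mul_integrable => //; exact: C1_L2.
have Z k : \int[leb]_(x in ocell T) (g x * phi x * chi k x) = 0.
  have [K [cK Ko K0]] := simplex_cutoff_support (vertex_ai hM T) k.
  have := h _ (Cchi k) (ltac:(exists K; split=> //; [by move=> x /Ko; exact: (ocell_domain hO hM)|
     by move=> x /K0; rewrite /chi => ->; rewrite mulr0])).
  rewrite (Rintegral_domain hO hM); last by apply: L2_mul_integrable => //; exact: C1_L2.
  rewrite (bigD1 T)//= big1 ?addr0 => [|T' T'T].
    by under eq_Rintegral do rewrite mulrA.
  rewrite -[RHS](mul0r (fine (leb (ocell T')))) -Rintegral_cst; last exact: measurable_ocell.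
  apply: eq_Rintegral => x; rewrite inE => T'x; rewrite /chi K0 ?mulr0// => /Ko Tx.
  by move/eqP: T'T; apply; apply: (ocell_cell_disjoint hM T'x); exact: (ocell_sub hM).
have mchi k : measurable_fun setT (chi k).
  by apply: continuous_measurable_rV; apply: C1_continuous; exact: simplex_cutoff_C1.
have hgT := integrable_ocell hO hM T hgphi.
have mgT : measurable_fun (ocell T) (fun x => g x * phi x).
  by case/integrableP : hgT => /measurable_EFinP.
have H : (\int[leb]_(x in ocell T) (g x * phi x * chi k x)) @[k --> \oo] -->
    \int[leb]_(x in ocell T) (g x * phi x).
  apply: (Rintegral_dominated_cvg (g := fun x => `|g x * phi x|)).
  - exact: measurable_ocell.
  - by move=> k; apply: measurable_funM => //; exact: measurable_funTS.
  - move=> x Tx; rewrite -[X in _ --> X]mulr1; apply: cvgM; first exact: cvg_cst.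
    exact: simplex_cutoff_cvg.
  - exact: integrable_norm.
  - move=> k x _; rewrite normrM -[leRHS]mulr1 ler_wpM2l//.
    by have /andP[h0 h1] := simplex_cutoff_itv (vertex T) k x; rewrite ger0_norm.
apply/esym/(cvg_unique _ _ H) => //.
by rewrite (_ : (fun k => _) = cst 0); [exact: cvg_cst|exact/funext].
Qed.

Lemma is_div_unique (v : vec -> vec) (g g' : vec -> R) : L2 Omega g -> L2 Omega g' ->
  is_div Omega v g -> is_div Omega v g' ->
  forall (T : M) (phi : vec -> R), C1 phi ->
    \int[leb]_(x in ocell T) (g x * phi x) = \int[leb]_(x in ocell T) (g' x * phi x).
Proof.
move=> hg hg' dg dg' T phi Cphi; apply/eqP; rewrite -subr_eq0; apply/eqP.
have ip f : L2 Omega f -> leb.-integrable Omega (EFin \o (fun x => f x * phi x)).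
  by move=> hf; apply: L2_mul_integrable => //; exact: C1_L2.
have hd : L2 Omega (fun x => g x - g' x).
  have := L2D mO hg (L2Z mO (-1) hg').
  by congr L2; apply/funext => x; rewrite mulN1r.
rewrite -RintegralB//; [|exact: measurable_ocell|exact: (integrable_ocell hO hM T (ip _ hg))|
  exact: (integrable_ocell hO hM T (ip _ hg'))].
rewrite -[RHS](weak_zero hd _ T Cphi).
  by apply: eq_Rintegral => x _; rewrite mulrBl.
move=> psi Cpsi Kpsi; have h1 := dg psi Cpsi Kpsi; have h2 := dg' psi Cpsi Kpsi.
under eq_Rintegral do rewrite mulrBl.
rewrite RintegralB//; try by apply: L2_mul_integrable => //; exact: C1_L2.
by rewrite -[X in X - _]opprK -h1 h2 opprK subrr.
Qed.

Lemma is_div_unique_domain (v : vec -> vec) (g g' : vec -> R) : L2 Omega g -> L2 Omega g' ->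
  is_div Omega v g -> is_div Omega v g' -> forall phi : vec -> R, C1 phi ->
  \int[leb]_(x in Omega) (g x * phi x) = \int[leb]_(x in Omega) (g' x * phi x).
Proof.
move=> hg hg' dg dg' phi Cphi.
have ip f : L2 Omega f -> leb.-integrable Omega (EFin \o (fun x => f x * phi x)).
  by move=> hf; apply: L2_mul_integrable => //; exact: C1_L2.
rewrite !(Rintegral_domain hO hM); [|exact: ip..].
by apply: eq_bigr => T _; exact: (is_div_unique hg hg' dg dg' T Cphi).
Qed.

(** Green's formula without boundary term, for a divergence [g] given explicitly; [H0div] speaks of
    the representative chosen by [div], which cannot be computed. *)
Definition zero_flux_div (v : vec -> vec) (g : vec -> R) : Prop :=
  L2 Omega g /\ forall phi : vec -> R, C1 phi ->
    \int[leb]_(x in Omega) dot (v x) (grad phi x) +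
    \int[leb]_(x in Omega) (g x * phi x) = 0.

Lemma zero_flux_is_div (v : vec -> vec) (g : vec -> R) : zero_flux_div v g ->
  is_div Omega v g.
Proof. by move=> [_ h] phi Cphi _; apply/eqP; rewrite -addr_eq0 h. Qed.

Lemma divP (v : vec -> vec) : Hdiv Omega v ->
  L2 Omega (div Omega v) /\ is_div Omega v (div Omega v).
Proof.
move=> [_ [g [hg dg]]].
by have := @getPex _ [set g | L2 Omega g /\ is_div Omega v g] (ex_intro _ g (conj hg dg)).
Qed.

(** From right to left, [g] is exchanged for the chosen representative; this is sound against every
    C^1 test function by [is_div_unique_domain]. *)
Lemma H0divP (v : vec -> vec) :
  H0div Omega v <-> L2vec Omega v /\ exists g, zero_flux_div v g.
Proof.
split=> [[hv tr]|[hv [g zg]]].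
  split; first by case: hv.
  by exists (div Omega v); split; [have [] := divP hv|exact: tr].
have dg := zero_flux_is_div zg; have [hg h] := zg.
have hd : Hdiv Omega v by split=> //; exists g.
split=> // phi Cphi; rewrite /normal_trace; have [hdiv ddiv] := divP hd.
by rewrite (is_div_unique_domain hdiv hg ddiv dg Cphi) h.
Qed.

(** Since [q] is constant on each cell, only the cell integrals of the divergence enter, and these
    agree for all representatives: test with the constant 1. *)
Lemma form_bE (v : vec -> vec) (g q : vec -> R) : L2vec Omega v -> L2 Omega g ->
  is_div Omega v g -> P0_mean_zero Omega M q ->
  form_b Omega v q = \int[leb]_(x in Omega) (g x * q x).
Proof.
move=> hv hg dg [[hq _] pq].
have [hdiv ddiv] := divP (conj hv (ex_intro _ g (conj hg dg))).
rewrite /form_b !(Rintegral_domain hO hM); try exact: L2_mul_integrable.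
apply: eq_bigr => T _; have [c hc] := pq T.
have K f : L2 Omega f -> \int[leb]_(x in ocell T) (f x * q x) =
    c * \int[leb]_(x in ocell T) (f x * 1).
  move=> hf; have [mf _] := L2_restrict T hf; have [mq _] := L2_restrict T hq.
  rewrite -RintegralZl//; last 2 first.
  - exact: measurable_ocell.
  - apply: (integrable_ocell hO hM T).
    by apply: L2_mul_integrable => //; exact: L2_cst.
  apply: ae_eq_Rintegral => //.
  - exact: measurable_ocell.
  - exact: measurable_funM.
  - by apply: measurable_funM => //; exact: measurable_funM.
  - apply: filterS hc => x hx Tx; rewrite hx; last exact: (ocell_sub hM).
    by rewrite mulr1 mulrC.
rewrite !K//; congr (_ * _).
by apply: (is_div_unique hdiv hg ddiv dg); exact: C1_cst.
Qed.

End weak_divergence.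

(** * Finite-dimensional variational problems *)

Section finite_dimensional.
Context {R : realType}.

(** Take rows in S of maximal rank: appending a further element of S cannot raise the rank. *)
Lemma subspace_matrix (N : nat) (S : 'rV[R]_N -> Prop) : S 0 ->
  (forall (c : R) u v, S u -> S v -> S (c *: u + v)) ->
  exists (m : nat) (K : 'M[R]_(m, N)),
    (forall i, S (row i K)) /\ forall c, S c -> (c <= K)%MS.
Proof.
move=> S0 SD.
pose Q r := `[< exists (m : nat) (K : 'M[R]_(m, N)),
  (forall i, S (row i K)) /\ \rank K = r >].
have exQ : exists r, Q r.
  exists 0%N; apply/asboolP; exists 0%N, 0; split; last by rewrite mxrank0.
  by case.
have ubQ r : Q r -> (r <= N)%N.
  by move=> /asboolP[m [K [_ <-]]]; exact: rank_leq_col.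
case: (ex_maxnP exQ ubQ) => r /asboolP[m [K [hK rK]]] maxr.
exists m, K; split=> // c Sc.
have hK' i : S (row i (col_mx K c)).
  have [j ->|j ->] := split_ordP i; first by rewrite rowKu.
  by rewrite rowKd row_id.
have : Q (\rank (col_mx K c)) by apply/asboolP; exists (m + 1)%N, (col_mx K c).
move=> /maxr; rewrite -rK -addsmxE => h.
have /mxrank_leqif_sup[_ E] := addsmxSl K c.
have := esym E; rewrite eqn_leq h mxrankS ?addsmxSl// => /esym.
by rewrite addsmx_sub => /esym/andP[].
Qed.

(** The columns of [cokermx B] are annihilated by [B], and [l] is in the row space exactly when it
    annihilates them too. *)
Lemma fredholm_matrix (m k : nat) (B : 'M[R]_(m, k)) (l : 'rV[R]_k) :
  (forall w : 'cV[R]_k, B *m w = 0 -> l *m w = 0) -> exists u, u *m B = l.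
Proof.
move=> h; have /submxP[u lE] : (l <= B)%MS; last by exists u.
rewrite submxE; apply/eqP/matrixP => i j; rewrite mxE.
have := h (col j (cokermx B)).
rewrite colE mulmxA mulmx_coker mul0mx => /(_ erefl).
by rewrite mulmxA -colE => /matrixP/(_ i ord0); rewrite !mxE.
Qed.

Section subspaces.
Context {X : lmodType R}.
Implicit Types (P Z : X -> Prop).

Definition lin_closed P : Prop :=
  P 0 /\ forall (c : R) u v, P u -> P v -> P (c *: u + v).

(* [Z] plays the role of the functions vanishing almost everywhere. *)
Definition finspan P Z : Prop :=
  exists (m : nat) (e : 'I_m -> X), (forall i, P (e i)) /\
    forall v, P v -> exists x : 'rV[R]_m, Z (v - \sum_i x ord0 i *: e i).

Lemma lin_closedZ P c u : lin_closed P -> P u -> P (c *: u).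
Proof. by move=> [P0 PD] Pu; rewrite -[_ *: _]addr0; exact: PD. Qed.

Lemma lin_closedD P u v : lin_closed P -> P u -> P v -> P (u + v).
Proof. by move=> [_ PD] Pu Pv; rewrite -[u]scale1r; exact: PD. Qed.

Lemma lin_closedB P u v : lin_closed P -> P u -> P v -> P (u - v).
Proof. by move=> [_ PD] Pu Pv; rewrite addrC -scaleN1r; exact: PD. Qed.

Lemma lin_closed_sum P (I : Type) (s : seq I) (f : I -> X) : lin_closed P ->
  (forall i, P (f i)) -> P (\sum_(i <- s) f i).
Proof.
move=> hP hf; elim: s => [|i s IH]; first by rewrite big_nil; case: hP.
by rewrite big_cons; exact: lin_closedD.
Qed.

(** The functions [rho] need not lie in P, whereas the generators must. The coordinate vectors of
    elements of P form a subspace of R^N; generators of it are lifted back to P. *)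
Lemma finspan_coord P Z (N : nat) (rho : 'I_N -> X) : lin_closed P -> lin_closed Z ->
  (forall v, P v -> exists c : 'rV[R]_N, Z (v - \sum_i c ord0 i *: rho i)) ->
  finspan P Z.
Proof.
move=> hP hZ hrho; pose r (c : 'rV[R]_N) := \sum_i c ord0 i *: rho i.
have rD (a : R) c d : r (a *: c + d) = a *: r c + r d.
  rewrite /r scaler_sumr -big_split/=; apply: eq_bigr => i _.
  by rewrite !mxE scalerDl scalerA.
have r0 : r 0 = 0 by rewrite /r big1// => i _; rewrite mxE scale0r.
pose S c := exists2 v, P v & Z (v - r c).
have [m [K [SK hK]]] : exists (m : nat) (K : 'M[R]_(m, N)),
    (forall i, S (row i K)) /\ forall c, S c -> (c <= K)%MS.
  apply: subspace_matrix.
    by exists 0; [case: hP|rewrite r0 subr0; case: hZ].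
  move=> a c d [v Pv Zv] [w Pw Zw]; exists (a *: v + w).
    by case: hP => _; exact.
  rewrite rD; have -> : a *: v + w - (a *: r c + r d) = a *: (v - r c) + (w - r d).
    by rewrite scalerBr opprD addrACA.
  by case: hZ => _; exact.
have /choice[e he] i : exists v, P v /\ Z (v - r (row i K)).
  by have [v] := SK i; exists v.
exists m, e; split=> [i|v Pv]; first by have [] := he i.
have [c Zc] := hrho v Pv.
have /submxP[x cE] : (c <= K)%MS by apply: hK; exists v.
exists x.
have rc : r c = \sum_i x ord0 i *: r (row i K).
  rewrite cE mulmx_sum_row; elim: (index_enum _) => [|i t IH].
    by rewrite !big_nil r0.
  by rewrite !big_cons rD IH.
have -> : v - \sum_i x ord0 i *: e i =
    (v - r c) - \sum_i x ord0 i *: (e i - r (row i K)).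
  have E : \sum_i x ord0 i *: (e i - r (row i K)) =
      \sum_i x ord0 i *: e i - \sum_i x ord0 i *: r (row i K).
    by rewrite -sumrB; apply: eq_bigr => i _; rewrite scalerBr.
  by rewrite rc E opprB addrA subrK.
apply: lin_closedB => //; apply: lin_closed_sum => // i.
by apply: lin_closedZ => //; have [] := he i.
Qed.

Section bilinear.
Variables (P Z : X -> Prop) (B : X -> X -> R) (l : X -> R).
Hypotheses (hP : lin_closed P) (spanP : finspan P Z)
  (BDl : forall (c : R) u v w, P u -> P v -> P w -> B (c *: u + v) w = c * B u w + B v w)
  (BDr : forall (c : R) u v w, P u -> P v -> P w -> B w (c *: u + v) = c * B w u + B w v)
  (lD : forall (c : R) u v, P u -> P v -> l (c *: u + v) = c * l u + l v)
  (BZl : forall u z, P u -> P z -> Z z -> B z u = 0)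
  (BZr : forall u z, P u -> P z -> Z z -> B u z = 0)
  (lZ : forall z, P z -> Z z -> l z = 0).

Let P0 : P 0. Proof. by case: hP. Qed.

Let B0l u : P u -> B 0 u = 0.
Proof.
move=> Pu; have := BDl 1 P0 P0 Pu; rewrite scale1r addr0 mul1r => /eqP.
by rewrite -subr_eq0 opprD addrA subrr sub0r oppr_eq0 => /eqP.
Qed.

Let B0r u : P u -> B u 0 = 0.
Proof.
move=> Pu; have := BDr 1 P0 P0 Pu; rewrite scale1r addr0 mul1r => /eqP.
by rewrite -subr_eq0 opprD addrA subrr sub0r oppr_eq0 => /eqP.
Qed.

Let l0 : l 0 = 0.
Proof.
have := lD 1 P0 P0; rewrite scale1r addr0 mul1r => /eqP.
by rewrite -subr_eq0 opprD addrA subrr sub0r oppr_eq0 => /eqP.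
Qed.

Let Psum (I : Type) (s : seq I) (c : I -> R) (f : I -> X) : (forall i, P (f i)) ->
  P (\sum_(i <- s) c i *: f i).
Proof. by move=> hf; apply: lin_closed_sum => // i; exact: lin_closedZ. Qed.

Let Bsuml (I : Type) (s : seq I) (c : I -> R) (f : I -> X) u : (forall i, P (f i)) ->
  P u -> B (\sum_(i <- s) c i *: f i) u = \sum_(i <- s) c i * B (f i) u.
Proof.
move=> hf Pu; elim: s => [|i s IH]; first by rewrite !big_nil B0l.
by rewrite !big_cons BDl ?IH//; exact: Psum.
Qed.

Let Bsumr (I : Type) (s : seq I) (c : I -> R) (f : I -> X) u : (forall i, P (f i)) ->
  P u -> B u (\sum_(i <- s) c i *: f i) = \sum_(i <- s) c i * B u (f i).
Proof.
move=> hf Pu; elim: s => [|i s IH]; first by rewrite !big_nil B0r.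
by rewrite !big_cons BDr ?IH//; exact: Psum.
Qed.

Let lsum (I : Type) (s : seq I) (c : I -> R) (f : I -> X) : (forall i, P (f i)) ->
  l (\sum_(i <- s) c i *: f i) = \sum_(i <- s) c i * l (f i).
Proof.
move=> hf; elim: s => [|i s IH]; first by rewrite !big_nil l0.
by rewrite !big_cons lD ?IH//; exact: Psum.
Qed.

(** Applied to the matrix of [B] on the generators, which may be singular because they may be
    dependent modulo Z. A vector in the kernel of the matrix gives an element of P that [B]
    annihilates from the right, and there [l] vanishes by assumption. *)
Lemma fredholm_solve :
  (forall w, P w -> (forall u, P u -> B u w = 0) -> l w = 0) ->
  exists2 u, P u & forall w, P w -> B u w = l w.
Proof.
move=> hker; have [m [e [Pe espan]]] := spanP.
have [u uE] : exists u : 'rV[R]_m,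
    u *m (\matrix_(i, j) B (e i) (e j)) = \row_j l (e j).
  apply: fredholm_matrix => w wE.
  pose v := \sum_j w j ord0 *: e j.
  have Pv : P v by exact: Psum.
  have ev i : B (e i) v = 0.
    rewrite Bsumr//; have /matrixP/(_ i ord0) := wE; rewrite mxE [in RHS]mxE => wi.
    by rewrite -[RHS]wi; apply: eq_bigr => j _; rewrite mxE mulrC.
  have lv : l v = 0.
    apply: hker => // z Pz; have [x Zx] := espan z Pz.
    pose s := \sum_i x ord0 i *: e i.
    have Ps : P s by exact: Psum.
    have -> : z = 1 *: s + (z - s) by rewrite scale1r addrC subrK.
    have Pzs : P (z - s) by exact: lin_closedB.
    rewrite BDl// (BZl Pv Pzs Zx) addr0 mul1r Bsuml//.
    by rewrite big1// => i _; rewrite ev mulr0.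
  apply/matrixP => a b; rewrite !ord1 mxE [RHS]mxE; rewrite -[RHS]lv lsum//.
  by apply: eq_bigr => j _; rewrite !mxE mulrC.
pose U := \sum_i u ord0 i *: e i.
have PU : P U by exact: Psum.
exists U => // w Pw; have [x Zx] := espan w Pw.
pose s := \sum_i x ord0 i *: e i.
have Ps : P s by exact: Psum.
have -> : w = 1 *: s + (w - s) by rewrite scale1r addrC subrK.
have Pws : P (w - s) by exact: lin_closedB.
rewrite BDr// lD// (BZr PU Pws Zx) (lZ Pws Zx) !addr0 !mul1r Bsumr// lsum//.
apply: eq_bigr => j _; congr (_ * _).
rewrite Bsuml//; have /rowP/(_ j) := uE; rewrite !mxE => <-.
by apply: eq_bigr => i _; rewrite mxE.
Qed.

End bilinear.

End subspaces.

Lemma finspan_pair (X Y : lmodType R) (P Z : X -> Prop) (P' Z' : Y -> Prop) :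
  lin_closed P -> lin_closed P' -> lin_closed Z -> lin_closed Z' ->
  finspan P Z -> finspan P' Z' ->
  finspan (fun w : (X * Y)%type => P w.1 /\ P' w.2) (fun w => Z w.1 /\ Z' w.2).
Proof.
move=> hP hP' hZ hZ' [m [e [Pe he]]] [m' [e' [Pe' he']]].
exists (m + m')%N, (fun i => match fintype.split i with
  | inl j => (e j, 0) | inr j => (0, e' j) end); split.
  move=> i; case: fintype.split => j /=; split=> //.
    by case: hP'.
  by case: hP.
have fst_sum (I : Type) (s : seq I) (F : I -> (X * Y)%type) :
    (\sum_(i <- s) F i).1 = \sum_(i <- s) (F i).1.
  by elim: s => [|i s IH]; rewrite ?big_nil// !big_cons -IH.
have snd_sum (I : Type) (s : seq I) (F : I -> (X * Y)%type) :
    (\sum_(i <- s) F i).2 = \sum_(i <- s) (F i).2.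
  by elim: s => [|i s IH]; rewrite ?big_nil// !big_cons -IH.
move=> [v v'] [/= /he[x Zx] /he'[x' Zx']]; exists (row_mx x x'); split.
  rewrite fst_sum big_split_ord/= [X in _ - (_ + X)]big1 => [|i _].
    rewrite addr0; congr (Z (v - _)): Zx; apply: eq_bigr => i _.
    by rewrite row_mxEl (unsplitK (inl i)).
  by rewrite (unsplitK (inr i)) /= scaler0.
rewrite snd_sum big_split_ord/= [X in _ - (X + _)]big1 => [|i _].
  rewrite add0r; congr (Z' (v' - _)): Zx'; apply: eq_bigr => i _.
  by rewrite row_mxEr (unsplitK (inr i)).
by rewrite (unsplitK (inl i)) /= scaler0.
Qed.

End finite_dimensional.

(** * Raviart-Thomas spaces and the multiscale problem *)

Lemma Rintegral0_eq d {T : measurableType d} {R : realType}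
    (mu : {measure set T -> \bar R}) (D : set T) (f : T -> R) :
  (forall x, D x -> f x = 0) -> \int[mu]_(x in D) f x = 0.
Proof. by move=> f0; rewrite /Rintegral integral0_eq// => x /f0 ->. Qed.

Section raviart_thomas.
Context {R : realType} {n : nat}.
Local Notation vec := 'rV[R]_n.+1.
Local Notation leb := (lebesgue_rV n.+1 : {measure set vec -> \bar R}).
Variable Omega : set vec.

Definition ae_zero {V : lmodType R} (v : vec -> V) : Prop :=
  \forall x \ae leb, Omega x -> v x = 0.

Lemma ae_zero_lin_closed (V : lmodType R) : lin_closed (ae_zero : (vec -> V) -> Prop).
Proof.
split=> [|c u v hu hv]; first exact: aeW.
apply: filterS2 hu hv => x hu hv Ox.
have -> : (c *: u + v) x = c *: u x + v x by [].
by rewrite hu// hv// scaler0 addr0.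
Qed.

Hypothesis hO : polytopal_lipschitz_domain Omega.
Let mO : measurable Omega := domain_measurable hO.
Let Ofin : (leb Omega < +oo)%E := domain_fin hO.

Lemma is_div_lin (c : R) (v w : vec -> vec) (g g' : vec -> R) :
  L2vec Omega v -> L2vec Omega w -> L2 Omega g -> L2 Omega g' ->
  is_div Omega v g -> is_div Omega w g' -> 
  is_div Omega (c *: v + w) (fun x => c * g x + g' x).
Proof.
move=> hv hw hg hg' dv dw phi Cphi Kphi.
have hgr := grad_L2vec hO Cphi; have hphi := C1_L2 hO Cphi.
have i1 := dot_integrable mO hv hgr; have i2 := dot_integrable mO hw hgr.
have i3 := L2_mul_integrable mO hg hphi; have i4 := L2_mul_integrable mO hg' hphi.
transitivity (\int[leb]_(x in Omega)
    (c * dot (v x) (grad phi x) + dot (w x) (grad phi x))).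
  by apply: eq_Rintegral => x _; rewrite -dotZl -dotDl.
rewrite RintegralD//; last exact: integrableZR.
rewrite RintegralZl// dv// dw//.
transitivity (- \int[leb]_(x in Omega) (c * (g x * phi x) + g' x * phi x)); last first.
  by congr (- _); apply: eq_Rintegral => x _; rewrite mulrDl mulrA.
rewrite RintegralD//; last exact: integrableZR.
by rewrite RintegralZl// mulrN opprD.
Qed.

Lemma zero_flux_div_lin (c : R) (v w : vec -> vec) (g g' : vec -> R) :
  L2vec Omega v -> L2vec Omega w -> zero_flux_div Omega v g -> zero_flux_div Omega w g' -> 
  zero_flux_div Omega (c *: v + w) (fun x => c * g x + g' x).
Proof.
move=> hv hw [hg dv] [hg' dw]; split=> [|phi Cphi].
  by apply: L2D => //; exact: L2Z.
have hgr := grad_L2vec hO Cphi; have hphi := C1_L2 hO Cphi.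
have i1 := dot_integrable mO hv hgr; have i2 := dot_integrable mO hw hgr.
have i3 := L2_mul_integrable mO hg hphi; have i4 := L2_mul_integrable mO hg' hphi.
transitivity (\int[leb]_(x in Omega)
    (c * dot (v x) (grad phi x) + dot (w x) (grad phi x)) +
    \int[leb]_(x in Omega) (c * (g x * phi x) + g' x * phi x)).
  congr (_ + _); apply: eq_Rintegral => x _; first by rewrite -dotZl -dotDl.
  by rewrite mulrDl mulrA.
rewrite !RintegralD//; try exact: integrableZR.
rewrite !RintegralZl// addrACA -mulrDr.
by rewrite dv// dw// mulr0 addr0.
Qed.

Lemma H0div_lin_closed (M : mesh R n) : conforming_mesh Omega M -> lin_closed (H0div Omega).
Proof.
move=> hM; split=> [|c u v].
  apply/(H0divP hO hM); split; first exact: L2vec0.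
  exists (fun=> 0); split=> [|phi Cphi]; first exact: L2_cst.
  rewrite !Rintegral0_eq ?addr0// => x _; first by rewrite mul0r.
  by rewrite [X in dot X _](_ : _ = 0)// dot0l.
move=> /(H0divP hO hM)[hu [g zg]] /(H0divP hO hM)[hv [g' zg']].
apply/(H0divP hO hM); split; first exact: L2vec_lin.
by exists (fun x => c * g x + g' x); exact: zero_flux_div_lin.
Qed.

Lemma RT_pieces_lin (M : mesh R n) (a : R) (v w : vec -> vec) (c d : M -> vec * R) :
  RT_pieces v c -> RT_pieces w d ->
  RT_pieces (a *: v + w) (fun T => (a *: (c T).1 + (d T).1, a * (c T).2 + (d T).2)).
Proof.
move=> hv hw T; apply: filterS2 (hv T) (hw T) => x hvx hwx Tx /=.
have -> : (a *: v + w) x = a *: v x + w x by [].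
by rewrite hvx// hwx// scalerDl scalerDr addrACA scalerA.
Qed.

Lemma RT_pieces0 (M : mesh R n) : RT_pieces 0 (fun _ : M => (0, 0)).
Proof. by move=> T; apply: aeW => x _ /=; rewrite scale0r addr0. Qed.

Lemma RT_space_lin_closed (M : mesh R n) : conforming_mesh Omega M ->
  lin_closed (RT_space Omega M).
Proof.
move=> hM; have [h0 hD] := H0div_lin_closed hM; split.
  by split=> //; eexists; exact: RT_pieces0.
move=> c u v [hu [cu pu]] [hv [cv pv]]; split; first exact: hD.
by eexists; exact: (RT_pieces_lin c pu pv).
Qed.

Lemma trace_lin (M : mesh R n) (a : R) (c d : M -> vec * R) (D : set vec) x :
  trace (fun T => (a *: (c T).1 + (d T).1, a * (c T).2 + (d T).2)) D x =
  a *: trace c D x + trace d D x.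
Proof.
rewrite /trace; case: pickP => [t _ /=|_]; last by rewrite scaler0 addr0.
by rewrite scalerDl scalerDr addrACA scalerA.
Qed.

(** On the face the integrand is one of finitely many affine functions, selected by membership in
    cells, hence measurable and bounded. Integrability makes the average fluxes linear, and with
    them the kernel of the interpolation. *)
Lemma trace_flux_integrable (M : mesh R n) (c : M -> vec * R) (D : set vec)
    (p : vec) (E : 'M[R]_(n, n.+1)) (nu : vec) :
  (lebesgue_rV n).-integrable (@ref_simplex R n)
    (EFin \o (fun s => dot (trace c D (p + s *m E)) nu)).
Proof.
pose F (o : option M) (x : vec) :=
  dot (if o is Some t then (c t).1 + (c t).2 *: x else 0) nu.
have aF o : affine_fun (F o).
  case: o => [t|]; last first.
    by exists 0, 0 => x; rewrite /F !dot0l addr0.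
  exists ((c t).2 *: nu), (dot (c t).1 nu) => x.
  by rewrite /F dotDl dotZl addrC dotZl (dotC x).
have trF x : dot (trace c D x) nu = F [pick t : M | `[< cell t `<=` D /\ cell t x >]] x.
  by rewrite /trace /F; case: pickP.
have bnd o : exists C : R, 0 <= C /\
    forall s, ref_simplex s -> `|F o (p + s *m E)| <= C.
  apply: (@compact_continuous_bounded _ _ _ (fun s => F o (p + s *m E))).
    exact: ref_simplex_compact.
  rewrite (_ : (fun s => _) = F o \o (fun s : 'rV[R]_n => p + s *m E))//.
  move=> s; apply: (@continuous_comp _ _ _ (fun s : 'rV[R]_n => p + s *m E) (F o)).
    exact: continuous_affine.
  exact: affine_fun_continuous.
have {bnd}/choice[C hC] := bnd.
apply: (@bounded_integrable _ _ _ _ _ _ (\sum_o C o)).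
- exact: measurable_ref_simplex.
- exact: ref_simplex_fin.
- apply: measurable_funTS.
  apply: (@measurableT_comp _ _ _ _ _ _ (fun x => dot (trace c D x) nu) _
    (fun s => p + s *m E)); last exact: measurable_affine.
  rewrite (_ : (fun x => _) = (fun x => F [pick t : M | `[< cell t `<=` D /\ cell t x >]] x)).
    apply: (measurable_pick (P := fun t => [set x | cell t `<=` D /\ cell t x])).
      move=> t; have [tD|ntD] := pselect (cell t `<=` D).
        rewrite (_ : [set x | _] = cell t); first exact: measurable_cell.
        by apply/seteqP; split=> x /=; [case|].
      rewrite (_ : [set x | _] = set0)//.
      by apply/seteqP; split=> x //= -[].
    by move=> o; exact: measurable_affine_fun.
  by apply/funext => x; exact: trF.
- move=> s hs; rewrite trF; set o := [pick t | _].
  rewrite (bigD1 o)//= -[leLHS]addr0 lerD//; first by have [_] := hC o; exact.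
  by apply: sumr_ge0 => o' _; have [] := hC o'.
Qed.

Lemma average_normal_flux_lin (TH M : mesh R n) (a : R) (c d : M -> vec * R)
    (T : TH) i nu :
  average_normal_flux (fun T => (a *: (c T).1 + (d T).1, a * (c T).2 + (d T).2)) T i nu =
  a * average_normal_flux c T i nu + average_normal_flux d T i nu.
Proof.
rewrite /average_normal_flux /face_average mulrA -mulrDl; congr (_ / _).
rewrite /face_integral mulrCA -mulrDr; congr (_ * _).
set p := face T i ord0; set E := face_edges _.
have ic := trace_flux_integrable c (cell T) p E nu.
have id' := trace_flux_integrable d (cell T) p E nu.
have mr := @measurable_ref_simplex R n.
rewrite -(RintegralZl a mr ic).
rewrite -(RintegralD mr (integrableZR a mr ic) id').
by apply: eq_Rintegral => s _; rewrite trace_lin dotDl dotZl.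
Qed.

Lemma RT_interpolant_lin (TH Th : mesh R n) (a : R) (v w z z' : vec -> vec) :
  conforming_mesh Omega TH ->
  RT_interpolant Omega TH Th v z -> RT_interpolant Omega TH Th w z' ->
  RT_interpolant Omega TH Th (a *: v + w) (a *: z + z').
Proof.
move=> hTH [Hz [cv [cz [h1 h2 h3]]]] [Hz' [cw [cz' [h1' h2' h3']]]].
split; first by have [_] := RT_space_lin_closed hTH; exact.
do 2 eexists; split; [exact: (RT_pieces_lin a h1 h1')|exact: (RT_pieces_lin a h2 h2')|].
by move=> T i nu hnu; rewrite !average_normal_flux_lin h3// h3'.
Qed.

Lemma fine_kernel_lin_closed (TH Th : mesh R n) (U : set vec) :
  conforming_mesh Omega TH -> conforming_mesh Omega Th ->
  lin_closed (fine_kernel Omega TH Th U).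
Proof.
move=> hTH hTh.
have [H0 HD] := RT_space_lin_closed hTH; have [h0 hD] := RT_space_lin_closed hTh.
split=> [|c u v [u1 u2 u3 u4] [v1 v2 v3 v4]].
  split=> //; last exact: aeW.
  - split=> //; do 2 eexists; split; [exact: RT_pieces0..|].
    move=> T i nu _; congr face_average; apply/funext => x.
    congr dot; rewrite /trace /=.
    case: pickP => [? _|_]; case: pickP => [? _|_] //=; by rewrite scale0r addr0.
  - move=> phi _ _; rewrite !Rintegral0_eq ?oppr0// => x _; first by rewrite mul0r.
    by rewrite [X in dot X _](_ : _ = 0)// dot0l.
split; first exact: hD.
- have := RT_interpolant_lin c hTH u2 v2.
  congr RT_interpolant; apply/funext => x.
  by change (c *: (0 : vec) + 0 = 0); rewrite scaler0 addr0.
- have [/(H0divP hO hTh)[l2u _] _] := u1; have [/(H0divP hO hTh)[l2v _] _] := v1.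
  have := is_div_lin c l2u l2v (L2_cst mO Ofin 0) (L2_cst mO Ofin 0) u3 v3.
  by congr is_div; apply/funext => x; rewrite mulr0 addr0.
- apply: filterS2 u4 v4 => x hu hv Dx.
  by rewrite /= [LHS](_ : _ = c *: u x + v x)// hu// hv// scaler0 addr0.
Qed.

Lemma P0_mean_zero_lin_closed (M : mesh R n) :
  lin_closed (P0_mean_zero Omega M : (vec -> R^o) -> Prop).
Proof.
split=> [|c u v [[u1 u2] u3] [[v1 v2] v3]].
  split; first split.
  - exact: (L2_cst mO Ofin 0).
  - by apply: Rintegral0_eq.
  - by move=> T; exists 0; exact: aeW.
split; first split.
- exact: (L2D mO (L2Z mO c u1) v1).
- have iu := L2_integrable mO Ofin u1; have iv := L2_integrable mO Ofin v1.
  transitivity (\int[leb]_(x in Omega) (c * u x + v x)); first by apply: eq_Rintegral.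
  by rewrite RintegralD ?RintegralZl ?u2 ?v2 ?mulr0 ?addr0//; exact: integrableZR.
- move=> T; have [a ha] := u3 T; have [b hb] := v3 T; exists (c * a + b).
  by apply: filterS2 ha hb => x hu hv Tx; rewrite /= [LHS](_ : _ = c * u x + v x)// hu// hv.
Qed.

End raviart_thomas.

Section spanning.
Context {R : realType} {n : nat}.
Local Notation vec := 'rV[R]_n.+1.
Local Notation leb := (lebesgue_rV n.+1 : {measure set vec -> \bar R}).

Lemma finspan_coord_fin (X : lmodType R) (P Z : X -> Prop) (I : finType) (rho : I -> X) :
  lin_closed P -> lin_closed Z ->
  (forall v, P v -> exists c : I -> R, Z (v - \sum_i c i *: rho i)) -> finspan P Z.
Proof.
move=> hP hZ h; apply: (finspan_coord (rho := fun k : 'I_#|I| => rho (enum_val k))) => // v Pv.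
have [c Zc] := h v Pv; exists (\row_k c (enum_val k)).
congr (Z (v - _)): Zc; rewrite (big_enum_val (A := I))/=.
by apply: eq_bigr => k _; rewrite mxE.
Qed.

Variable Omega : set vec.
Hypothesis hO : polytopal_lipschitz_domain Omega.

(** Basis of the discontinuous Raviart-Thomas functions: on each open cell the constant unit vectors
    and, for [None], the field x. They serve only as coordinates, since their normal components
    jump. *)
Definition RT_coord_fun (M : mesh R n) (j : M * option 'I_n.+1) (x : vec) : vec :=
  \1_(ocell j.1) x *: (if j.2 is Some k then delta_mx ord0 k else x).

Lemma RT_pieces_coord (M : mesh R n) (v : vec -> vec) (c : M -> vec * R) :
  conforming_mesh Omega M -> RT_pieces v c ->
  exists a : M * option 'I_n.+1 -> R, ae_zero Omega (v - \sum_j a j *: RT_coord_fun j).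
Proof.
move=> hM hv.
exists (fun j => if j.2 is Some k then (c j.1).1 ord0 k else (c j.1).2).
have {}hv : \forall x \ae leb, forall T : M, cell T x -> v x = (c T).1 + (c T).2 *: x.
  exact: filter_forall.
apply: filterS2 hv (ae_domain hM) => x hv hx Ox; have [T Tx] := hx Ox.
rewrite [LHS](_ : _ = v x - (\sum_j (if j.2 is Some k then (c j.1).1 ord0 k else (c j.1).2)
  *: @RT_coord_fun M j) x)// fct_sumE.
rewrite (hv T (ocell_sub hM Tx)).
rewrite (eq_bigr (fun j => (fun T' o => \1_(ocell T') x *:
    (if o is Some k then (c T').1 ord0 k *: delta_mx ord0 k else (c T').2 *: x)) j.1 j.2)).
  rewrite -(pair_bigA _ (fun T' o => \1_(ocell T') x *:
    (if o is Some k then (c T').1 ord0 k *: delta_mx ord0 k else (c T').2 *: x)))/=.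
  rewrite (bigD1 T)//= [X in _ - (_ + X)]big1 => [|T' T'T]; last first.
    rewrite big1// => o _; rewrite indicE memNset ?scale0r// => T'x.
    move/eqP: T'T; apply; apply: (ocell_cell_disjoint hM T'x).
    exact: (ocell_sub hM).
  rewrite addr0 -scaler_sumr indicE mem_set// scale1r.
  rewrite (bigD1 None)//= (reindex_omap Some id)/=; last by case.
  rewrite (eq_bigl predT); last by move=> k; rewrite eqxx.
  by rewrite [X in _ - X]addrC -row_sum_delta subrr.
move=> [T' [k|]] _ /=; rewrite /RT_coord_fun /=.
  by rewrite [LHS](_ : _ = (c T').1 ord0 k *: (\1_(ocell T') x *: delta_mx ord0 k))//
    scalerA mulrC -scalerA.
by rewrite [LHS](_ : _ = (c T').2 *: (\1_(ocell T') x *: x))// scalerA mulrC -scalerA.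
Qed.

Lemma P0_finspan (M : mesh R n) : conforming_mesh Omega M ->
  finspan (P0_mean_zero Omega M : (vec -> R^o) -> Prop) (ae_zero Omega).
Proof.
move=> hM; apply: (finspan_coord_fin (rho := fun T : M => \1_(ocell T) : vec -> R^o)).
- exact: P0_mean_zero_lin_closed.
- exact: ae_zero_lin_closed.
move=> q [_ /choice[c hc]]; exists c.
have {}hc : \forall x \ae leb, forall T : M, cell T x -> q x = c T.
  exact: filter_forall.
apply: filterS2 hc (ae_domain hM) => x hc hx Ox; have [T Tx] := hx Ox.
rewrite [LHS](_ : _ = q x - (\sum_T c T *: (\1_(ocell T) : vec -> R^o)) x)// fct_sumE.
rewrite (hc T (ocell_sub hM Tx)) (bigD1 T)//= big1 => [|T' T'T].
  by rewrite addr0 [X in _ - X](_ : _ = c T * \1_(ocell T) x)// indicE mem_set// mulr1 subrr.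
rewrite [LHS](_ : _ = c T' * \1_(ocell T') x)// indicE memNset ?mulr0// => T'x.
move/eqP: T'T; apply; apply: (ocell_cell_disjoint hM T'x).
exact: (ocell_sub hM).
Qed.

Lemma RT_finspan (P : (vec -> vec) -> Prop) (M : mesh R n) : conforming_mesh Omega M ->
  lin_closed P -> (forall v, P v -> RT_space Omega M v) -> finspan P (ae_zero Omega).
Proof.
move=> hM hP h; apply: (finspan_coord_fin (rho := @RT_coord_fun M)) => //.
  exact: ae_zero_lin_closed.
by move=> v /h[_ [c hc]]; exact: (RT_pieces_coord hM hc).
Qed.

(** A multiscale function is a coarse field minus a fine one, so its coordinates are taken in the
    local bases of both meshes. *)
Lemma RT_pair_finspan (P : (vec -> vec) -> Prop) (M M' : mesh R n) :
  conforming_mesh Omega M -> conforming_mesh Omega M' -> lin_closed P ->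
  (forall v, P v -> exists w w', [/\ RT_space Omega M w, RT_space Omega M' w' & v = w - w']) ->
  finspan P (ae_zero Omega).
Proof.
move=> hM hM' hP h.
apply: (finspan_coord_fin (rho := fun j : (M * option 'I_n.+1) + (M' * option 'I_n.+1) =>
  match j with inl j => RT_coord_fun j | inr j => RT_coord_fun j end)) => //.
  exact: ae_zero_lin_closed.
move=> v /h[w [w' [[_ [c hc]] [_ [c' hc']] ->]]].
have [a ha] := RT_pieces_coord hM hc; have [a' ha'] := RT_pieces_coord hM' hc'.
exists (fun j => match j with inl j => a j | inr j => - a' j end).
rewrite big_sumType/= [X in _ - (_ + X)](_ : _ = - \sum_j a' j *: RT_coord_fun j); last first.
  by rewrite -sumrN; apply: eq_bigr => j _; rewrite scaleNr.
rewrite opprD addrACA -opprD.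
by apply: (lin_closedB (ae_zero_lin_closed Omega _) ha ha').
Qed.

End spanning.

Lemma measurable_funV d {T : measurableType d} {R : realType} (D : set T) (f : T -> R) :
  measurable_fun D f -> measurable_fun D (fun x => (f x)^-1).
Proof.
move=> mf; suff minv : measurable_fun setT (@GRing.inv R) by exact: measurableT_comp.
have o : open ([set~ 0] : set R) by apply: closed_openC; exact: closed_eq.
have -> : [set: R] = [set 0] `|` [set~ 0] by rewrite setUv.
apply/measurable_funU => //; first by apply: measurableC; exact: measurable_set1.
split; first exact: measurable_fun_set1.
apply: open_continuous_measurable_fun => // x; rewrite inE /= => /eqP x0.
exact: inv_continuous.
Qed.

Lemma ae_eq_L2 {R : realType} {n : nat} (D : set 'rV[R]_n.+1) (f g : 'rV[R]_n.+1 -> R) :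
  measurable D -> measurable_fun D f -> L2 D g ->
  (\forall x \ae lebesgue_rV n.+1, D x -> f x = g x) -> L2 D f.
Proof.
move=> mD mf [mg /integrableP[mg2 g2]] fg; split=> //; apply/integrableP.
have mf2 : measurable_fun D (EFin \o (fun x => f x ^+ 2)).
  by apply/measurable_EFinP; exact: measurable_funX.
split=> //; rewrite (ae_eq_integral (fun x => `|(g x ^+ 2)%:E|)%E)//.
- exact: measurableT_comp.
- exact: measurableT_comp.
- by apply: filterS fg => x h Dx /=; rewrite h.
Qed.

Lemma ae_eq0_Rintegral d {T : measurableType d} {R : realType}
    (mu : {measure set T -> \bar R}) (D : set T) (f : T -> R) : measurable D ->
  mu.-integrable D (EFin \o f) -> (\forall x \ae mu, D x -> 0 <= f x) ->
  \int[mu]_(x in D) f x = 0 -> \forall x \ae mu, D x -> f x = 0.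
Proof.
move=> mD fi f0 If; have /integrableP[mf _] := fi.
have : (\int[mu]_(x in D) `|(EFin \o f) x|)%E = 0%E.
  have <- : (\int[mu]_(x in D) (EFin \o f) x)%E = 0%E.
    rewrite -[LHS]fineK; last exact: integrable_fin_num.
    by congr EFin.
  apply: ae_eq_integral => //; first exact: measurableT_comp.
  by apply: filterS f0 => x h Dx /=; rewrite ger0_norm// h.
by move=> /ae_eq_integral_abs h; apply: filterS (h mD mf) => x e Dx; have [] := e Dx.
Qed.

(** * The weighted scalar product *)

Section elliptic_form.
Context {R : realType} {n : nat}.
Local Notation vec := 'rV[R]_n.+1.
Local Notation leb := (lebesgue_rV n.+1 : {measure set vec -> \bar R}).
Variables (Omega : set vec) (A : vec -> 'M[R]_n.+1) (alpha beta : R).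
Hypotheses (hO : polytopal_lipschitz_domain Omega)
  (hA : elliptic_coefficient Omega A alpha beta).
Let mO : measurable Omega := domain_measurable hO.

(** Cofactor formula where the determinant is nonzero; elsewhere [invmx] returns the matrix
    itself. *)
Lemma measurable_invmx (i j : 'I_n.+1) : measurable_fun Omega (fun x => invmx (A x) i j).
Proof.
have [hL _ _ _] := hA.
have mA k l : measurable_fun Omega (fun x => A x k l) by have [] := hL k l.
have mdet m (B : vec -> 'M[R]_m) : (forall k l, measurable_fun Omega (fun x => B x k l)) ->
    measurable_fun Omega (fun x => \det (B x)).
  move=> mB; apply: measurable_sum => s; apply: measurable_funM => //.
  by apply: measurable_prod => k _.
rewrite (_ : (fun x => _) = (fun x => if \det (A x) == 0 then A x i j
    else (\det (A x))^-1 * cofactor (A x) j i)); last first.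
  apply/funext => x; rewrite /invmx unitmxE unitfE; case: eqP => //= _.
  by rewrite !mxE.
apply: measurable_fun_if => //.
- by apply: measurable_fun_eqr => //; exact: mdet.
- by apply: measurable_funS (mA i j) => // x [].
- apply: (measurable_funS mO); first by move=> x [].
  apply: measurable_funM; first by apply: measurable_funV; exact: mdet.
  apply: measurable_funM => //; apply: mdet => k l.
  rewrite (_ : (fun x => _) = (fun x => A x (lift j k) (lift i l)))//.
  by apply/funext => x; rewrite !mxE.
Qed.

Lemma invmx_bounded : exists C : R, \forall x \ae leb, Omega x ->
  forall i j, `|invmx (A x) i j| <= C.
Proof.
have [_ hs ab hC] := hA; exists (2 * beta).
apply: filterS2 hs hC => x hs hC Ox i j; have {}hs := hs Ox; have [uA {}hC] := hC Ox.
pose B := invmx (A x).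
have BT : B^T = B by rewrite /B trmx_inv hs.
(* The unit vectors bound the diagonal entries of the symmetric matrix B by beta; the vector e_i +
   e_j then controls the off-diagonal entry by polarisation. *)
have q (u : vec) : u != 0 -> 0 <= dot (u *m B) u <= beta * dot u u.
  move=> u0; have := hC u u0; rewrite /Ainv BT.
  have d0 : 0 < dot u u.
    by rewrite lt0r dot_ge0 andbT; apply: contra u0 => /eqP/dot_eq0 ->.
  rewrite ler_pdivlMr// ler_pdivrMr// => /andP[h ->]; rewrite andbT.
  by apply: le_trans h; rewrite mulr_ge0 ?ltW//; case/andP: ab.
have e k l : dot (delta_mx ord0 k *m B) (delta_mx ord0 l) = B k l.
  by rewrite dotC dot_delta -rowE mxE.
have d (k : 'I_n.+1) : (delta_mx ord0 k : vec) != 0.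
  by apply/eqP => /rowP/(_ k); rewrite !mxE !eqxx => /eqP; rewrite oner_eq0.
have dd (k l : 'I_n.+1) : dot (delta_mx ord0 k) (delta_mx ord0 l) = (k == l)%:R :> R.
  by rewrite dot_delta mxE eqxx.
have /andP[ii0 iib] := q _ (d i); have /andP[jj0 jjb] := q _ (d j).
move: ii0 iib jj0 jjb; rewrite !e !dd !eqxx mulr1 => ii0 iib jj0 jjb.
have beta0 : 0 < beta by case/andP: ab; exact: lt_le_trans.
rewrite -/B; have [<-|ij] := eqVneq i j; first by rewrite ger0_norm//; lra.
have nz : (delta_mx ord0 i + delta_mx ord0 j : vec) != 0.
  apply/eqP => /rowP/(_ i); rewrite !mxE !eqxx (negbTE ij) addr0 => /eqP.
  by rewrite oner_eq0.
have Bji : B j i = B i j by rewrite -[in LHS]BT mxE.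
have := q _ nz; rewrite mulmxDl !dotDl !dotDr !e !dd !eqxx [j == i]eq_sym (negbTE ij) Bji /=.
by move=> /andP[h1 h2]; rewrite ler_norml; apply/andP; split; lra.
Qed.

Lemma Ainv_L2vec (v : vec -> vec) : L2vec Omega v -> L2vec Omega (fun x => Ainv A x (v x)).
Proof.
move=> hv i; have [C hC] := invmx_bounded.
have C0 : 0 <= `|C| by [].
(* The entries are truncated because their bound holds only almost everywhere, while
   [L2_mul_bounded] asks for it at every point. *)
pose B j x := Num.max (- `|C|) (Num.min `|C| (invmx (A x) i j)).
have AE x : Ainv A x (v x) ord0 i = \sum_j invmx (A x) i j * v x ord0 j.
  by rewrite mxE; apply: eq_bigr => j _; rewrite mxE mulrC.
apply: (@ae_eq_L2 _ _ _ _ (fun x => \sum_j B j x * v x ord0 j)) => //.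
- under eq_fun do rewrite AE.
  apply: measurable_sum => j; apply: measurable_funM; first exact: measurable_invmx.
  by have [] := hv j.
- apply: L2_sum => //; first exact: domain_fin.
  move=> j; apply: (L2_mul_bounded mO (C := `|C|)) => //.
    + apply: measurable_maxr => //; apply: measurable_minr => //.
      exact: measurable_invmx.
    + move=> x _; rewrite ler_norml /B le_max lexx/= ge_max ge_min lexx/= andbT.
      by rewrite (le_trans _ C0)// oppr_le0.
- apply: filterS hC => x hC Ox; rewrite AE; apply: eq_bigr => j _; congr (_ * _).
  have := hC Ox i j => /le_trans/(_ (ler_norm C)); rewrite ler_norml => /andP[h1 h2].
  by rewrite /B min_r// max_r.
Qed.

Lemma Ainv_integrable (v w : vec -> vec) : L2vec Omega v -> L2vec Omega w ->
  leb.-integrable Omega (EFin \o (fun x => dot (Ainv A x (v x)) (w x))).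
Proof. by move=> hv hw; apply: dot_integrable => //; exact: Ainv_L2vec. Qed.

Section subdomain.
Variable D : set vec.
Hypotheses (mD : measurable D) (DO : D `<=` Omega).

Let Aint (v w : vec -> vec) : L2vec Omega v -> L2vec Omega w ->
  leb.-integrable D (EFin \o (fun x => dot (Ainv A x (v x)) (w x))).
Proof.
by move=> hv hw; apply: (integrableS mO mD DO); exact: Ainv_integrable.
Qed.

Lemma Ainv_formDl (c : R) (u v w : vec -> vec) :
  L2vec Omega u -> L2vec Omega v -> L2vec Omega w ->
  Ainv_form A D (c *: u + v) w = c * Ainv_form A D u w + Ainv_form A D v w.
Proof.
move=> hu hv hw; have i1 := Aint hu hw; have i2 := Aint hv hw.
rewrite /Ainv_form -(RintegralZl c mD i1) -(RintegralD mD (integrableZR c mD i1) i2).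
apply: eq_Rintegral => x _; rewrite -dotZl -dotDl /Ainv.
by rewrite [(c *: u + v) x](_ : _ = c *: u x + v x)// mulmxDl scalemxAl.
Qed.

Lemma Ainv_formDr (c : R) (u v w : vec -> vec) :
  L2vec Omega u -> L2vec Omega v -> L2vec Omega w ->
  Ainv_form A D w (c *: u + v) = c * Ainv_form A D w u + Ainv_form A D w v.
Proof.
move=> hu hv hw; have i1 := Aint hw hu; have i2 := Aint hw hv.
rewrite /Ainv_form -(RintegralZl c mD i1) -(RintegralD mD (integrableZR c mD i1) i2).
apply: eq_Rintegral => x _; rewrite -dotZr -dotDr.
by rewrite [(c *: u + v) x](_ : _ = c *: u x + v x).
Qed.

Let Ameas (v w : vec -> vec) : L2vec Omega v -> L2vec Omega w ->
  measurable_fun D (fun x => dot (Ainv A x (v x)) (w x)).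
Proof.
by move=> hv hw; have /integrableP[/measurable_EFinP] := Aint hv hw.
Qed.

Lemma Ainv_form0l (u v : vec -> vec) : L2vec Omega u -> L2vec Omega v ->
  ae_zero Omega u -> Ainv_form A D u v = 0.
Proof.
move=> hu hv u0; rewrite -[RHS](@Rintegral0_eq _ _ _ leb D (fun=> 0))//.
apply: ae_eq_Rintegral => //; first exact: Ameas.
by apply: filterS u0 => x h Dx; rewrite h ?dot0l /Ainv ?mul0mx ?dot0l//; exact: DO.
Qed.

Lemma Ainv_form0r (u v : vec -> vec) : L2vec Omega u -> L2vec Omega v ->
  ae_zero Omega v -> Ainv_form A D u v = 0.
Proof.
move=> hu hv v0; rewrite -[RHS](@Rintegral0_eq _ _ _ leb D (fun=> 0))//.
apply: ae_eq_Rintegral => //; first exact: Ameas.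
by apply: filterS v0 => x h Dx; rewrite h ?dot0r//; exact: DO.
Qed.

End subdomain.

Lemma Ainv_form_definite (u : vec -> vec) : L2vec Omega u -> Ainv_form A Omega u u = 0 ->
  ae_zero Omega u.
Proof.
move=> hu /ae_eq0_Rintegral h; have [_ _ /andP[a0 _] hC] := hA.
have pos : \forall x \ae leb, Omega x ->
    alpha * dot (u x) (u x) <= dot (Ainv A x (u x)) (u x).
  apply: filterS hC => x /[apply][[_ hx]].
  have [->|u0] := eqVneq (u x) 0; first by rewrite !dot0r mulr0.
  have /andP[+ _] := hx _ u0; rewrite ler_pdivlMr// lt0r dot_ge0 andbT.
  by apply: contra u0 => /eqP/dot_eq0 ->.
have {}h := h mO (Ainv_integrable hu hu).
have /h {}h : \forall x \ae leb, Omega x -> 0 <= dot (Ainv A x (u x)) (u x).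
  apply: filterS pos => x /[apply]; apply: le_trans.
  by rewrite mulr_ge0 ?dot_ge0// ltW.
apply: filterS2 pos h => x px hx Ox; apply: dot_eq0; apply/eqP.
have := px Ox; rewrite hx// pmulr_rle0// => le0.
by rewrite eq_le le0 dot_ge0.
Qed.

End elliptic_form.

(** * Test fields of neighbouring cells and injectivity of the discrete gradient *)

Section divergence_onto.
Context {R : realType} {n : nat}.
Local Notation vec := 'rV[R]_n.+1.
Local Notation leb := (lebesgue_rV n.+1 : {measure set vec -> \bar R}).
Variables (Omega : set vec) (M : mesh R n).
Hypotheses (hO : polytopal_lipschitz_domain Omega) (hM : conforming_mesh Omega M).
Let mO : measurable Omega := domain_measurable hO.
Let Ofin : (leb Omega < +oo)%E := domain_fin hO.

Lemma Rintegral_cell (T : M) (f : vec -> R) : continuous f ->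
  \int[leb]_(x in cell T) f x = \int[leb]_(x in ocell T) f x.
Proof.
move=> cf; have mf := continuous_measurable_rV cf.
have mo : measurable (ocell T) := measurable_ocell T.
have mc : measurable (cell T) := measurable_cell T.
transitivity (\int[leb]_(x in cell T) (f \_ (ocell T)) x); last first.
  by rewrite -Rintegral_mkcondr// setIidr//; exact: (ocell_sub hM).
apply: ae_eq_Rintegral => //.
- exact: measurable_funTS.
- apply: measurable_funTS; apply/(measurable_restrictT _ mo).
  exact: measurable_funTS.
- apply: filterS (ae_ocell hM) => x h /h Tx.
  by rewrite patchE ifT// inE.
Qed.

Lemma Rintegral_indic_ocell (T : M) (f : vec -> R) :
  \int[leb]_(x in Omega) (\1_(ocell T) x * f x) = \int[leb]_(x in ocell T) f x.
Proof.
transitivity (\int[leb]_(x in Omega) (f \_ (ocell T)) x).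
  apply: eq_Rintegral => x _; rewrite patchE indicE.
  by case: (x \in ocell T); rewrite ?mul1r ?mul0r.
by rewrite -Rintegral_mkcondr// setIidr//; exact: (ocell_domain hO hM).
Qed.

Lemma L2_indic_ocell (T : M) (f : vec -> R) : L2 Omega f ->
  L2 Omega (fun x => \1_(ocell T) x * f x).
Proof.
move=> hf; apply: (L2_mul_bounded mO (C := 1)) => //.
  apply: measurable_funTS; apply: measurable_indic; exact: measurable_ocell.
by move=> x _; rewrite indicE; case: (x \in _); rewrite ?normr1 ?normr0.
Qed.

Lemma ocell_indic (T K : M) x : ocell K x -> \1_(ocell T) x = (K == T)%:R :> R.
Proof.
move=> Kx; rewrite indicE; have [<-|KT] := eqVneq K T; first by rewrite mem_set.
rewrite memNset// => Tx; move/eqP: KT; apply.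
by apply: (ocell_cell_disjoint hM Kx); exact: (ocell_sub hM).
Qed.

Section adjacent.
Variables (T T' : M) (P P' : vec) (a a' : R).
Hypothesis TT' : T != T'.

Let w (x : vec) : vec :=
  (a * \1_(ocell T) x) *: (x - P) - (a' * \1_(ocell T') x) *: (x - P').
Let g (x : vec) : R := n.+1%:R * (a * \1_(ocell T) x - a' * \1_(ocell T') x).

Let w_L2 : L2vec Omega w.
Proof.
move=> j.
have c (p : vec) : L2 Omega (fun x => (x - p) ord0 j).
  apply: (continuous_L2 hO); apply: affine_fun_continuous.
  exists (delta_mx ord0 j), (- p ord0 j) => x; by rewrite dot_delta !mxE.
have := L2D mO (L2Z mO a (L2_indic_ocell T (c P))) (L2Z mO (- a') (L2_indic_ocell T' (c P'))).
by congr L2; apply/funext => x; rewrite /w !mxE; ring.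
Qed.

Let g_L2 : L2 Omega g.
Proof.
have c := L2_cst mO Ofin 1.
have := L2Z mO n.+1%:R (L2D mO (L2Z mO a (L2_indic_ocell T c)) (L2Z mO (- a') (L2_indic_ocell T' c))).
by congr L2; apply/funext => x; rewrite /g; ring.
Qed.

Let w_pieces : exists c : M -> vec * R, RT_pieces w c.
Proof.
exists (fun K => if K == T then (- (a *: P), a) else if K == T' then (a' *: P', - a') else (0, 0)).
move=> K; apply: filterS (ae_ocell hM) => x h /h Kx.
rewrite /w !(ocell_indic _ Kx).
have [->|KT] := eqVneq K T.
  by rewrite (negbTE TT') mulr1 mulr0 scale0r subr0 scalerBr addrC.
have [_|KT'] := eqVneq K T'.
  by rewrite mulr0 scale0r sub0r mulr1 scalerBr opprB scaleNr.
by rewrite !mulr0 !scale0r subr0 addr0.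
Qed.

Let fluxE (phi : vec -> R) : C1 phi ->
  \int[leb]_(x in Omega) dot (w x) (grad phi x) + \int[leb]_(x in Omega) (g x * phi x) =
  a * \int[leb]_(x in cell T) radial_div phi P x -
  a' * \int[leb]_(x in cell T') radial_div phi P' x.
Proof.
move=> Cphi; have cr p : continuous (radial_div phi p) by exact: C1_radial_continuous.
have i1 := dot_integrable mO w_L2 (grad_L2vec hO Cphi).
have i2 := L2_mul_integrable mO g_L2 (C1_L2 hO Cphi).
have ir K p := L2_integrable mO Ofin (L2_indic_ocell K (continuous_L2 hO (cr p))).
rewrite !Rintegral_cell// -!Rintegral_indic_ocell -(RintegralD mO i1 i2).
rewrite -(RintegralZl a mO (ir T P)) -(RintegralZl a' mO (ir T' P')).
rewrite -(RintegralB mO (integrableZR a mO (ir T P)) (integrableZR a' mO (ir T' P'))).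
apply: eq_Rintegral => x _.
have -> : dot (w x) (grad phi x) = a * \1_(ocell T) x * dot (x - P) (grad phi x) -
    a' * \1_(ocell T') x * dot (x - P') (grad phi x).
  by rewrite -!dotZl -dotNl -dotDl.
by rewrite /g /radial_div; ring.
Qed.

(** The hypothesis says that the outflow of the two pieces cancels for every test function, which is
    Green's formula without boundary term for the glued field. *)
Lemma adjacent_field :
  (forall phi : vec -> R, C1 phi ->
    a * \int[leb]_(x in cell T) radial_div phi P x =
    a' * \int[leb]_(x in cell T') radial_div phi P' x) ->
  exists v, RT_space Omega M v /\
    forall q (c : M -> R), P0_mean_zero Omega M q ->
      (forall K, \forall x \ae leb, cell K x -> q x = c K) ->
      form_b Omega v q = n.+1%:R * a * fine (leb (ocell T)) * (c T - c T').
Proof.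
move=> h.
have zf : zero_flux_div Omega w g.
  by split=> // phi Cphi; rewrite (fluxE Cphi) (h phi Cphi) subrr.
exists w; split.
  by split; [apply/(H0divP hO hM); split=> //; exists g|].
move=> q c hq hc; rewrite (form_bE hO hM w_L2 g_L2 (zero_flux_is_div zf) hq).
have [[q2 _] _] := hq.
have iq K := L2_integrable mO Ofin (L2_indic_ocell K q2).
transitivity (\int[leb]_(x in Omega) ((n.+1%:R * a) * (\1_(ocell T) x * q x) -
    (n.+1%:R * a') * (\1_(ocell T') x * q x))).
  by apply: eq_Rintegral => x _; rewrite /g; ring.
rewrite (RintegralB mO (integrableZR _ mO (iq T)) (integrableZR _ mO (iq T'))).
rewrite (RintegralZl _ mO (iq T)) (RintegralZl _ mO (iq T')) !Rintegral_indic_ocell.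
have E K : \int[leb]_(x in ocell K) q x = c K * fine (leb (ocell K)).
  rewrite -(Rintegral_cst _ (measurable_ocell K)).
  apply: ae_eq_Rintegral => //; first exact: measurable_ocell.
    by have [] := L2_restrict hO hM K q2.
  by apply: filterS (hc K) => x hx Kx; rewrite hx//; exact: (ocell_sub hM).
(* For phi = 1 the hypothesis reads a |T| = a' |T'|, which lets both cell terms share one factor. *)
have := h (cst 1) (C1_cst 1).
have D (K : M) (p : vec) : \int[leb]_(x in cell K) radial_div (cst 1) p x = n.+1%:R * fine (leb (ocell K)).
  rewrite Rintegral_cell; last exact: (@C1_radial_continuous _ _ _ p n.+1%:R (C1_cst 1)).
  rewrite -(Rintegral_cst _ (measurable_ocell K)).
  apply: eq_Rintegral => x _; rewrite /radial_div mulr1 [grad _ _](_ : _ = 0) ?dot0r ?add0r//.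
  by apply/rowP => j; rewrite !mxE; exact: derive_cst.
rewrite !D !E mulrCA [RHS in _ = RHS -> _]mulrCA => e.
have alg (d b b' m m' y y' : R) : d * (b * m) = d * (b' * m') ->
    d * b * (y * m) - d * b' * (y' * m') = d * b * m * (y - y').
  move=> {}e; transitivity (y * (d * (b * m)) - y' * (d * (b' * m'))); first by ring.
  by rewrite -e; ring.
exact: alg e.
Qed.

End adjacent.

Lemma div_injective (q : vec -> R) : (1 <= n)%N -> P0_mean_zero Omega M q ->
  (forall v, RT_space Omega M v -> form_b Omega v q = 0) ->
  \forall x \ae leb, Omega x -> q x = 0.
Proof.
move=> n1 hq hb; have [[q2 q0] /choice[c hc]] := hq.
have [[_ _ [x0 /(domain_covered hM)[T0 _]]] _] := hO.
have cT0 : forall T, c T = c T0.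
  apply: (mesh_connected hO hM n1); last by exists T0.
  move=> T T' i i' <- TT' E E'.
  have ff : facet T i = facet T' i' by rewrite -E -E'.
  have [a [a' [a0 _ ha]]] := flux_match
    (p := vertex T) (p' := apex_moved T i (vertex T' i')) (i := i)
    (fun k ki => esym (ifN_eq _ _ ki)) (edges_unit i (vertex_ai hM T))
    (edges_apex_moved_unit hM ff).
  have [v [hv bv]] := @adjacent_field T T' (vertex T i) (vertex T' i') a a' TT'
    (fun phi Cphi => ltac:(by have := ha phi Cphi; rewrite (apex_moved_cell ff) /apex_moved eqxx)).
  have := bv q c hq hc; rewrite hb// => /esym/eqP.
  rewrite !mulf_eq0 pnatr_eq0 (gt_eqF a0)/= subr_eq0 gt_eqF/= => [/eqP ->//|].
  by apply: fine_gt0; rewrite (ocell_gt0 hM) (ocell_fin hO hM).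
have hq0 : \forall x \ae leb, Omega x -> q x = c T0.
  have {}hc : \forall x \ae leb, forall T : M, cell T x -> q x = c T.
    exact: filter_forall.
  apply: filterS hc => x hx /(domain_covered hM)[T Tx].
  by rewrite (hx T Tx) cT0.
have c0 : c T0 = 0.
  have : c T0 * fine (leb Omega) = 0.
    rewrite -q0 -(Rintegral_cst _ mO); apply: ae_eq_Rintegral => //.
      by case: q2.
    by apply: filterS hq0 => x h Ox; rewrite h.
  have O0 : 0 < fine (leb Omega) by apply: fine_gt0; rewrite (domain_gt0 hO) Ofin.
  by move/eqP; rewrite mulf_eq0 (gt_eqF O0) orbF => /eqP.
by apply: filterS hq0 => x h Ox; rewrite h.
Qed.

End divergence_onto.

Lemma lin_closed_pair {R : realType} (X Y : lmodType R) (P : X -> Prop) (P' : Y -> Prop) :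
  lin_closed P -> lin_closed P' ->
  lin_closed (fun w : (X * Y)%type => P w.1 /\ P' w.2).
Proof.
move=> [P0 PD] [P'0 P'D]; split=> // c u v [pu p'u] [pv p'v].
by split; [exact: PD|exact: P'D].
Qed.

(** * Correctors and the discrete saddle point problem *)

Section saddle_point.
Context {R : realType} {n : nat}.
Local Notation vec := 'rV[R]_n.+1.
Local Notation leb := (lebesgue_rV n.+1 : {measure set vec -> \bar R}).
Variables (Omega : set vec) (A : vec -> 'M[R]_n.+1) (alpha beta : R) (TH Th : mesh R n).
Hypotheses (hO : polytopal_lipschitz_domain Omega)
  (hA : elliptic_coefficient Omega A alpha beta)
  (hTH : conforming_mesh Omega TH) (hTh : conforming_mesh Omega Th).
Let mO : measurable Omega := domain_measurable hO.
Let Ofin : (leb Omega < +oo)%E := domain_fin hO.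

Let OO : Omega `<=` Omega. Proof. by []. Qed.

Section form_b.
Implicit Types (q : vec -> R^o) (u v : vec -> vec).

(** [div] need not be linear, as it picks one representative for each field; [form_bE] substitutes
    the combination of divergences, which requires q to be piecewise constant. *)
Lemma form_bDl (c : R) u v q : Hdiv Omega u -> Hdiv Omega v -> P0_mean_zero Omega TH q ->
  form_b Omega (c *: u + v) q = c * form_b Omega u q + form_b Omega v q.
Proof.
move=> [hu [g [hg dg]]] [hv [g' [hg' dg']]] hq; have [[q2 _] _] := hq.
rewrite (form_bE hO hTH hu hg dg hq) (form_bE hO hTH hv hg' dg' hq).
rewrite (form_bE hO hTH (L2vec_lin mO c hu hv) (L2D mO (L2Z mO c hg) hg')
  (is_div_lin hO c hu hv hg hg' dg dg') hq).
have i1 := L2_mul_integrable mO hg q2; have i2 := L2_mul_integrable mO hg' q2.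
rewrite -(RintegralZl c mO i1) -(RintegralD mO (integrableZR c mO i1) i2).
by apply: eq_Rintegral => x _; rewrite mulrDl mulrA.
Qed.

Lemma form_bDr (c : R) v q q' : Hdiv Omega v -> L2 Omega q -> L2 Omega q' ->
  form_b Omega v (c *: q + q') = c * form_b Omega v q + form_b Omega v q'.
Proof.
move=> /divP[hd _] hq hq'.
have i1 := L2_mul_integrable mO hd hq; have i2 := L2_mul_integrable mO hd hq'.
rewrite /form_b -(RintegralZl c mO i1) -(RintegralD mO (integrableZR c mO i1) i2).
apply: eq_Rintegral => x _; rewrite [(c *: q + q') x](_ : _ = c * q x + q' x)//.
by rewrite mulrDr mulrCA.
Qed.

Lemma form_b0l v q : Hdiv Omega v -> ae_zero Omega v -> P0_mean_zero Omega TH q ->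
  form_b Omega v q = 0.
Proof.
move=> [hv _] v0 hq; rewrite (form_bE (g := fun=> 0) hO hTH hv _ _ hq).
- by apply: Rintegral0_eq => x _; rewrite mul0r.
- exact: L2_cst.
move=> phi Cphi _; rewrite [RHS](_ : _ = 0).
  rewrite -[RHS](@Rintegral0_eq _ _ _ leb Omega (fun=> 0))//.
  apply: ae_eq_Rintegral => //.
    by have /integrableP[/measurable_EFinP] := dot_integrable mO hv (grad_L2vec hO Cphi).
  by apply: filterS v0 => x h Ox; rewrite h// dot0l.
by apply/eqP; rewrite oppr_eq0; apply/eqP; apply: Rintegral0_eq => x _; rewrite mul0r.
Qed.

Lemma form_b0r v q : Hdiv Omega v -> L2 Omega q -> ae_zero Omega q -> form_b Omega v q = 0.
Proof.
move=> /divP[hd _] hq q0; rewrite -[RHS](@Rintegral0_eq _ _ _ leb Omega (fun=> 0))//.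
apply: ae_eq_Rintegral => //.
  by have /integrableP[/measurable_EFinP] := L2_mul_integrable mO hd hq.
by apply: filterS q0 => x h Ox; rewrite h// mulr0.
Qed.

End form_b.

Lemma RT_space_L2vec (M : mesh R n) v : RT_space Omega M v -> L2vec Omega v.
Proof. by move=> [[[]]]. Qed.

Lemma fine_kernel_L2vec U w : fine_kernel Omega TH Th U w -> L2vec Omega w.
Proof. by move=> [/RT_space_L2vec]. Qed.

Let cellO (T : TH) : measurable (cell T `&` Omega).
Proof. by apply: measurableI => //; exact: measurable_cell. Qed.

Let cellS (T : TH) : cell T `&` Omega `<=` Omega. Proof. by move=> x []. Qed.

Variable k : nat.

(** A kernel element w of the form satisfies a(w, w) = 0, so it vanishes almost everywhere, and so
    does the right-hand side at w. *)
Lemma localized_corrector_exists (T : TH) v : L2vec Omega v ->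
  exists g, localized_corrector Omega A Th k T v g.
Proof.
move=> hv; pose P := fine_kernel Omega TH Th (Defs.patch T k).
have L2P w : P w -> L2vec Omega w by exact: fine_kernel_L2vec.
have hP : lin_closed P by exact: fine_kernel_lin_closed.
have spanP : finspan P (ae_zero Omega) by apply: (RT_finspan hTh) => // w [].
have [g Pg hg] : exists2 g, P g & forall w, P w ->
    Ainv_form A Omega g w = Ainv_form A (cell T `&` Omega) v w.
  apply: (fredholm_solve hP spanP (B := Ainv_form A Omega)
    (l := Ainv_form A (cell T `&` Omega) v)).
  - by move=> c u w z /L2P ? /L2P ? /L2P ?; exact: (Ainv_formDl hO hA mO OO).
  - by move=> c u w z /L2P ? /L2P ? /L2P ?; exact: (Ainv_formDr hO hA mO OO).
  - by move=> c u w /L2P ? /L2P ?; exact: (Ainv_formDr hO hA (@cellO T) (@cellS T)).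
  - by move=> u z /L2P ? /L2P ?; exact: (Ainv_form0l hO hA mO OO).
  - by move=> u z /L2P ? /L2P ?; exact: (Ainv_form0r hO hA mO OO).
  - by move=> z /L2P ?; exact: (Ainv_form0r hO hA (@cellO T) (@cellS T)).
  move=> w Pw /(_ w Pw) ww; have hw := L2P w Pw.
  apply: (Ainv_form0r hO hA (@cellO T) (@cellS T)) => //.
  exact: (Ainv_form_definite hO hA).
by exists g.
Qed.

Lemma localized_corrector_lin (T : TH) (c : R) (v v' g g' : vec -> vec) :
  L2vec Omega v -> L2vec Omega v' ->
  localized_corrector Omega A Th k T v g -> localized_corrector Omega A Th k T v' g' ->
  localized_corrector Omega A Th k T (c *: v + v') (c *: g + g').
Proof.
move=> hv hv' [Pg hg] [Pg' hg']; split.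
  by have [_] := fine_kernel_lin_closed hO (Defs.patch T k) hTH hTh; exact.
move=> w Pw; have hw := fine_kernel_L2vec Pw.
rewrite (Ainv_formDl hO hA mO OO)//; try exact: fine_kernel_L2vec Pg; try exact: fine_kernel_L2vec Pg'.
by rewrite (Ainv_formDl hO hA (@cellO T) (@cellS T))// hg// hg'.
Qed.

Local Notation Vms := (multiscale_space Omega A TH Th k).

Lemma multiscale_lin_closed : lin_closed Vms.
Proof.
split.
  have h0 : L2vec Omega (0 : vec -> vec) by exact: (L2vec0 mO Ofin).
  exists 0, (fun _ => 0); split.
  - by case: (RT_space_lin_closed hO hTH).
  - move=> T; split; first by case: (fine_kernel_lin_closed hO (Defs.patch T k) hTH hTh).
    move=> w /fine_kernel_L2vec hw.
    rewrite (Ainv_form0l hO hA mO OO)//; last exact: aeW.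
    by rewrite (Ainv_form0l hO hA (@cellO T) (@cellS T))//; exact: aeW.
  - by apply/funext => x; rewrite big1// subr0.
move=> c u u' [v [g [hv hg ->]]] [v' [g' [hv' hg' ->]]].
exists (c *: v + v'), (fun T => c *: g T + g' T); split.
- by have [_] := RT_space_lin_closed hO hTH; exact.
- by move=> T; apply: localized_corrector_lin => //; [exact: RT_space_L2vec hv|exact: RT_space_L2vec hv'].
- apply/funext => x.
  rewrite [LHS](_ : _ = c *: (v x - \sum_T g T x) + (v' x - \sum_T g' T x))//.
  rewrite [X in _ = _ - X](eq_bigr (fun T => c *: g T x + g' T x))//.
  rewrite [(c *: v + v') x](_ : _ = c *: v x + v' x)//.
  by rewrite big_split/= -scaler_sumr scalerBr opprD addrACA.
Qed.

(** The correctors live on different patches; with [setT] as support region they lie in one common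
    space and can be added. *)
Lemma correctors_kernel (v : vec -> vec) (g : TH -> vec -> vec) :
  (forall T, localized_corrector Omega A Th k T v (g T)) ->
  fine_kernel Omega TH Th setT (\sum_T g T).
Proof.
move=> hg; apply: (lin_closed_sum _ (fine_kernel_lin_closed hO setT hTH hTh)) => T.
have [[h1 h2 h3 _] _] := hg T; split=> //.
by apply: aeW => x [_]/=; case.
Qed.

Lemma multiscale_Hdiv (v : vec -> vec) (g : TH -> vec -> vec) : RT_space Omega TH v ->
  (forall T, localized_corrector Omega A Th k T v (g T)) ->
  let u := fun x => v x - \sum_(T : TH) g T x in
  Hdiv Omega u /\ forall q, P0_mean_zero Omega TH q -> form_b Omega u q = form_b Omega v q.
Proof.
move=> hv hg u; have hG := correctors_kernel hg; have [_ _ dG _] := hG.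
have [[[v2 [d [hd dv]]] _] _] := hv; have G2 := fine_kernel_L2vec hG.
have uE : u = -1 *: (\sum_T g T) + v.
  apply/funext => x; rewrite [RHS](_ : _ = -1 *: (\sum_T g T) x + v x)// fct_sumE.
  by rewrite scaleN1r addrC.
have u2 : L2vec Omega u by rewrite uE; exact: L2vec_lin.
have du : is_div Omega u d.
  have := is_div_lin hO (-1) G2 v2 (L2_cst mO Ofin 0) hd dG dv.
  by rewrite -uE; congr is_div; apply/funext => x; rewrite mulr0 add0r.
split=> [|q hq]; first by split=> //; exists d.
by rewrite (form_bE hO hTH u2 hd du hq) (form_bE hO hTH v2 hd dv hq).
Qed.

Lemma multiscale_space_Hdiv u : Vms u -> Hdiv Omega u.
Proof. by move=> [v [g [hv hg ->]]]; have [] := multiscale_Hdiv hv hg. Qed.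

Lemma multiscale_space_L2vec u : Vms u -> L2vec Omega u.
Proof. by move=> /multiscale_space_Hdiv[]. Qed.

Lemma multiscale_finspan : finspan Vms (ae_zero Omega).
Proof.
apply: (RT_pair_finspan hTH hTh multiscale_lin_closed) => u [v [g [hv hg ->]]].
exists v, (\sum_T g T); split=> //; first by have [] := correctors_kernel hg.
by apply/funext => x; rewrite [RHS](_ : _ = v x - (\sum_T g T) x)// fct_sumE.
Qed.

Lemma multiscale_div_injective q : (1 <= n)%N -> P0_mean_zero Omega TH q ->
  (forall u, Vms u -> form_b Omega u q = 0) -> \forall x \ae leb, Omega x -> q x = 0.
Proof.
move=> n1 hq hb; apply: (div_injective hO hTH n1 hq) => v hv.
have /choice[g hg] : forall T : TH, exists g, localized_corrector Omega A Th k T v g.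
  by move=> T; apply: localized_corrector_exists; exact: RT_space_L2vec hv.
have [_ <-//] := multiscale_Hdiv hv hg.
by apply: hb; exists v, g.
Qed.

Lemma multiscale_solution_exists (f : vec -> R) : (1 <= n)%N -> L2 Omega f ->
  exists u p, multiscale_solution Omega A f TH Th k u p.
Proof.
move=> n1 hf; pose P' : (vec -> R^o) -> Prop := P0_mean_zero Omega TH.
have hP' : lin_closed P' by exact: P0_mean_zero_lin_closed.
have hV := multiscale_lin_closed.
pose X := ((vec -> vec) * (vec -> R^o))%type.
(* Both equations are added into one on pairs (field, pressure). [R^o] makes the pressures a module,
   so that the pairs form one too. *)
pose B (w z : X) := Ainv_form A Omega w.1 z.1 + form_b Omega z.1 w.2 + form_b Omega w.1 z.2.
pose l (z : X) := - \int[leb]_(x in Omega) (f x * z.2 x).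
have hZ := ae_zero_lin_closed Omega.
have alg (c x x' y y' z z' : R) :
    c * x + x' + (c * y + y') + (c * z + z') = c * (x + y + z) + (x' + y' + z').
  by ring.
have spanX := finspan_pair hV hP' (hZ _) (hZ _) multiscale_finspan (P0_finspan hO hTH).
have V2 := multiscale_space_L2vec; have Vd := multiscale_space_Hdiv.
have P2 q : P' q -> L2 Omega q by move=> [[]].
have iq q : P' q -> leb.-integrable Omega (EFin \o (fun x => f x * q x)).
  by move=> /P2; exact: L2_mul_integrable.
have [[u p] [Vu Pp] hup] : exists2 w : X, Vms w.1 /\ P' w.2 &
    forall z : X, Vms z.1 /\ P' z.2 -> B w z = l z.
  apply: (fredholm_solve (lin_closed_pair hV hP') spanX).
  - move=> c [u p] [v q] [w r] [/= Vu Pp] [/= Vv Pq] [/= Vw Pr]; rewrite /B /=.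
    rewrite (Ainv_formDl hO hA mO OO c (V2 _ Vu) (V2 _ Vv) (V2 _ Vw)).
    rewrite (form_bDr c (Vd _ Vw) (P2 _ Pp) (P2 _ Pq)).
    by rewrite (form_bDl c (Vd _ Vu) (Vd _ Vv) Pr); exact: alg.
  - move=> c [u p] [v q] [w r] [/= Vu Pp] [/= Vv Pq] [/= Vw Pr]; rewrite /B /=.
    rewrite (Ainv_formDr hO hA mO OO c (V2 _ Vu) (V2 _ Vv) (V2 _ Vw)).
    rewrite (form_bDr c (Vd _ Vw) (P2 _ Pp) (P2 _ Pq)).
    by rewrite (form_bDl c (Vd _ Vu) (Vd _ Vv) Pr); exact: alg.
  - move=> c [u p] [v q] [/= Vu Pp] [/= Vv Pq]; rewrite /l /= mulrN -opprD; congr (- _).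
    rewrite -(RintegralZl c mO (iq _ Pp)).
    rewrite -(RintegralD mO (integrableZR c mO (iq _ Pp)) (iq _ Pq)).
    apply: eq_Rintegral => x _; rewrite [(c *: p + q) x](_ : _ = c * p x + q x)//.
    by rewrite mulrDr mulrCA.
  - move=> [u p] [v q] [/= Vu Pp] [/= Vv Pq] [/= Zv Zq]; rewrite /B /=.
    rewrite (Ainv_form0l hO hA mO OO (V2 _ Vv) (V2 _ Vu) Zv).
    by rewrite (form_b0l (Vd _ Vv) Zv Pp) (form_b0r (Vd _ Vu) (P2 _ Pq) Zq) !addr0.
  - move=> [u p] [v q] [/= Vu Pp] [/= Vv Pq] [/= Zv Zq]; rewrite /B /=.
    rewrite (Ainv_form0r hO hA mO OO (V2 _ Vu) (V2 _ Vv) Zv).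
    by rewrite (form_b0l (Vd _ Vv) Zv Pp) (form_b0r (Vd _ Vu) (P2 _ Pq) Zq) !addr0.
  - move=> [v q] [/= Vv Pq] [/= Zv Zq]; rewrite /l /=.
    apply/eqP; rewrite oppr_eq0; apply/eqP.
    rewrite -[RHS](@Rintegral0_eq _ _ _ leb Omega (fun=> 0))//.
    apply: ae_eq_Rintegral => //.
      by have /integrableP[/measurable_EFinP] := iq _ Pq.
    by apply: filterS Zq => x h Ox; rewrite h// mulr0.
  move=> [w r] [/= Vw Pr] hB; rewrite /l /=.
  have PNr : P' (- r) by rewrite -scaleN1r; exact: lin_closedZ.
  have bN : form_b Omega w (- r) = - form_b Omega w r.
    have := form_bDr (-1) (Vd _ Vw) (P2 _ Pr) (L2_cst mO Ofin 0).
    rewrite [form_b _ _ (fun=> 0)]form_b0r//; [|exact: Vd|exact: L2_cst|exact: aeW].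
    by rewrite mulN1r [RHS in _ = RHS -> _]addr0 => <-; congr form_b; rewrite addr0 scaleN1r.
  have Zw : ae_zero Omega w.
    apply: (Ainv_form_definite hO hA (V2 _ Vw)).
    by have := hB (w, - r) (conj Vw PNr); rewrite /B /= bN addrNK.
  have Zr : \forall x \ae leb, Omega x -> r x = 0.
    apply: (multiscale_div_injective n1 Pr) => u Vu.
    have := hB (u, 0) (conj Vu hP'.1); rewrite /B /=.
    rewrite (Ainv_form0r hO hA mO OO (V2 _ Vu) (V2 _ Vw) Zw) add0r.
    by rewrite (form_b0r (q := 0) (Vd _ Vw) (L2_cst mO Ofin 0) (aeW _ _))// add0r.
  apply/eqP; rewrite oppr_eq0; apply/eqP.
  rewrite -[RHS](@Rintegral0_eq _ _ _ leb Omega (fun=> 0))//.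
  apply: ae_eq_Rintegral => //.
    by have /integrableP[/measurable_EFinP] := iq _ Pr.
  by apply: filterS Zr => x h Ox; rewrite h// mulr0.
(* The two equations are recovered by testing with (v, 0) and (0, q). *)
exists u, p; split=> // [v Vv|q Pq].
  have := hup (v, 0) (conj Vv hP'.1); rewrite /B /l /=.
  rewrite (form_b0r (q := 0) (Vd _ Vu) (L2_cst mO Ofin 0) (aeW _ _))// addr0 => ->.
  by rewrite Rintegral0_eq ?oppr0// => x _; rewrite mulr0.
have := hup (0, q) (conj hV.1 Pq); rewrite /B /l /=.
rewrite (Ainv_form0r hO hA mO OO (V2 _ Vu) (L2vec0 mO Ofin) (aeW _ _))//.
by rewrite (form_b0l (v := 0) (Vd _ hV.1) (aeW _ _) Pp)// !add0r.
Qed.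

Lemma multiscale_solution_unique (f : vec -> R) u p u' p' : (1 <= n)%N ->
  multiscale_solution Omega A f TH Th k u p -> multiscale_solution Omega A f TH Th k u' p' ->
  (\forall x \ae leb, Omega x -> u' x = u x) /\ (\forall x \ae leb, Omega x -> p' x = p x).
Proof.
move=> n1 [Vu Pp hu hp] [Vu' Pp' hu' hp'].
have V2 := multiscale_space_L2vec; have Vd := multiscale_space_Hdiv.
have P2 q : P0_mean_zero Omega TH q -> L2 Omega q by move=> [[]].
(* The differences are written in the shape c u + v in which closure and bilinearity are stated. *)
pose w := -1 *: u + u'; pose r : vec -> R^o := -1 *: (p : vec -> R^o) + (p' : vec -> R^o).
have Vw : Vms w by have [_] := multiscale_lin_closed; exact.
have Pr : P0_mean_zero Omega TH r by have [_] := P0_mean_zero_lin_closed hO TH; exact.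
have E1 v : Vms v -> Ainv_form A Omega w v + form_b Omega v r = 0.
  move=> Vv; rewrite (Ainv_formDl hO hA mO OO (-1) (V2 _ Vu) (V2 _ Vu') (V2 _ Vv)).
  rewrite (form_bDr (-1) (Vd _ Vv) (P2 _ Pp) (P2 _ Pp')) addrACA -mulrDr.
  by rewrite hu// hu'// mulr0 addr0.
have E2 : form_b Omega w r = 0.
  by rewrite (form_bDl (-1) (Vd _ Vu) (Vd _ Vu') Pr) hp// hp'// mulN1r addNr.
have Zw : ae_zero Omega w.
  by apply: (Ainv_form_definite hO hA (V2 _ Vw)); have := E1 w Vw; rewrite E2 addr0.
have Zr : \forall x \ae leb, Omega x -> r x = 0.
  apply: (multiscale_div_injective n1 Pr) => v Vv.
  by have := E1 v Vv; rewrite (Ainv_form0l hO hA mO OO (V2 _ Vw) (V2 _ Vv) Zw) add0r.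
split; [apply: filterS Zw|apply: filterS Zr] => x h /h.
  by rewrite [w x](_ : _ = -1 *: u x + u' x)// scaleN1r addrC => /eqP; rewrite subr_eq0 => /eqP.
by rewrite [r x](_ : _ = -1 * p x + p' x)// mulN1r addrC => /eqP; rewrite subr_eq0 => /eqP.
Qed.

End saddle_point.

Theorem lemma12 (R : realType) (n : nat) (hd : n.+1 = 2%N \/ n.+1 = 3%N)
    (Omega : set 'rV[R]_n.+1) (hOmega : polytopal_lipschitz_domain Omega)
    (A : 'rV[R]_n.+1 -> 'M[R]_n.+1) (alpha beta : R)
    (hA : elliptic_coefficient Omega A alpha beta)
    (f : 'rV[R]_n.+1 -> R) (hf : L2_mean_zero Omega f)
    (I J : Type) (TH : I -> mesh R n) (Th : J -> mesh R n)
    (hTH : forall i, conforming_mesh Omega (TH i))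
    (hTh : forall j, conforming_mesh Omega (Th j))
    (rTH : shape_regular TH) (rTh : shape_regular Th)
    (quTH : quasi_uniform TH)
    (i : I) (j : J)
    (href : refinement (TH i) (Th j))
    (hdisj : no_common_element (TH i) (Th j))
    (k : nat) (hk : (1 <= k)%N) :
  exists (u : 'rV[R]_n.+1 -> 'rV[R]_n.+1) (p : 'rV[R]_n.+1 -> R),
    multiscale_solution Omega A f (TH i) (Th j) k u p /\
    forall u' p', multiscale_solution Omega A f (TH i) (Th j) k u' p' ->
      u' = u %[ae lebesgue_rV n.+1 in Omega] /\
      p' = p %[ae lebesgue_rV n.+1 in Omega].
Proof.
have n1 : (1 <= n)%N by case: hd => -[->].
have [f2 _] := hf.
have [u [p hup]] := multiscale_solution_exists hOmega hA (hTH i) (hTh j) k n1 f2.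
exists u, p; split=> // u' p' hup'.
exact: (multiscale_solution_unique hOmega hA (hTH i) (hTh j) n1 hup hup').
Qed.
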